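(* Let the type be ${\tt A}_n$, ${\tt B}_n$ or ${\tt C}_n$ and let $\lambda=\sum_{i=1}^na_i\omega_i$ be a dominant coweight. The correspondence $\gamma\leftrightarrow\mathcal T_\gamma$ describes a bijection between the set of galleries of the same type as $\gamma_{\underline\lambda}$ and the set of Young tableaux of shape $p_{\underline\lambda}$ and type ${\tt A}_n$, respectively ${\tt B}_n$ or ${\tt C}_n$.
   Context: **Coordinates.** $G$ is a connected complex semisimple group with roots $\Phi$, coroots $\Phi^\vee$, Weyl group $W$, $\mathbb A=X^\vee\otimes\mathbb R$ ($X^\vee$ cocharacters of a maximal torus), origin $\mathfrak o$. Fundamental coweights $\omega_1,\dots,\omega_n\in\mathbb A$ are dual to the simple roots, in Bourbaki enumeration. Type ${\tt A}_n,{\tt B}_n,{\tt C}_n$ means that the coweights are realized as the weights of the root system of that type (i.e. $\Phi^\vee$ has this type): $\omega_i=\epsilon_1+\dots+\epsilon_i$ for $1\le i\le n$ (modulo $\epsilon_1+\cdots+\epsilon_{n+1}$ in type ${\tt A}_n$), except $\omega_n=\frac12(\epsilon_1+\dots+\epsilon_n)$ in type ${\tt B}_n$. Put $\epsilon_{\bar i}=-\epsilon_i$. $\omega_i$ is minuscule iff: $i$ arbitrary in type ${\tt A}_n$, $i=n$ in type ${\tt B}_n$, $i=1$ in type ${\tt C}_n$. **Galleries.** Walls are $H_{\alpha,m}=\{x\in\mathbb A:\langle\alpha,x\rangle+m=0\}$, $\alpha\in\Phi,m\in\mathbb Z$; $W^{\mathfrak a}$ is generated by the reflections in the walls; faces are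 the closed faces of this arrangement, vertices and edges those of dimension $0$, $1$; the type of a face is the unique $W^{\mathfrak a}$-conjugate face of the fundamental alcove $\{0\le\langle\alpha,x\rangle\le1\ \forall\alpha\in\Phi^+\}$. A vertex is special if every root has a wall $H_{\alpha,m}$ through it. A (combinatorial one-skeleton) gallery is a sequence $(V_0\subset E_0\supset V_1\subset\dots\subset E_r\supset V_{r+1})$ of vertices $V_i$ and edges $E_i$ in $\mathbb A$ with $V_0,V_{r+1}$ special; its type is the sequence of types of its faces; all galleries here start in $V_0=\mathfrak o$. Concatenation $*$ is after translation of the second gallery to the target of the first. $\gamma_{\omega_i}$ is the gallery of consecutive vertices and edges on the segment from $\mathfrak o$ to $\omega_i$, and $\gamma_{\underline\lambda}=\gamma_{\omega_1}*\cdots*\gamma_{\omega_1}*\cdots*\gamma_{\omega_n}*\cdots*\gamma_{\omega_n}$ with $\gamma_{\omega_i}$ occurring $a_i$ times. If $\omega_i$ is minuscule, the galleries of the same type as $\gamma_{\omega_i}$ are the $(\mathfrak o\subset\sigma(E)\supset\sigma(\omega_i))$, $\sigma\in W/W_{\omega_i}$, $E=\{t\omega_i:t\in[0,1]\}$. If $\omega_i$ is not minuscule, they are of the form $(\mathfrak o\subset\tau(E_1)\supset\frac{\tau(\omega_i)}2\subset\tau\sigma(E_1)+\frac12\tau(\omega_i)\supset\frac{\tau(\omega_i)+\tau\sigma(\omega_i)}2)$, $E_1=\{t\omega_i:t\in[0,\frac12]\}$, $\tau\in W$, $\sigma$ in the subgroup of $W$ generated by the reflections in the roots $\alpha$ with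 $\langle\alpha,\frac12\omega_i\rangle\in\mathbb Z$; such a gallery is determined by the pair $(\tau(\omega_i),\tau\sigma(\omega_i))$. **Tableaux.** The Young diagram of shape $p=(p_1,\dots,p_n)$ has left-justified rows of lengths $p_1,p_2,\dots$ from top to bottom; columns $C_1,C_2,\dots$ are numbered from right to left. Let $\mathfrak N=\{1<2<\dots<n<\bar n<\dots<\bar2<\bar1\}$, $\bar{\bar i}=i$. - Type ${\tt A}_n$: $p_{\underline\lambda}$ has $p_i=a_i+\dots+a_n$. A Young tableau of shape $p_{\underline\lambda}$ is a filling with positive integers $\le n+1$, strictly increasing down the columns. - Type ${\tt B}_n$: $p_i=2a_i+\dots+2a_{n-1}+a_n$. A Young tableau of shape $p_{\underline\lambda}$ is a filling with elements of $\mathfrak N$, strictly increasing down columns, $i$ and $\bar i$ never in the same column, and for each pair $(C_{2j-1},C_{2j})$, $j=1,\dots,a_1+\dots+a_{n-1}$, either $C_{2j-1}=C_{2j}$ or $C_{2j}$ is obtained from $C_{2j-1}$ by exchanging some entries $k$ by $\bar k$ (and reordering). - Type ${\tt C}_n$: $p_1=a_1+\sum_{j\ge2}2a_j$, $p_i=2a_i+\dots+2a_n$ for $i\ge2$. A Young tableau of shape $p_{\underline\lambda}$ is a filling with elements of $\mathfrak N$, strictly increasing down columns, $i$ and $\bar i$ never in the same column, and for each pair $(C_{a_1+2j-1},C_{a_1+2j})$, $j=1,\dots,a_2+\dots+a_n$, either the two columns are equal or $C_{a_1+2j}$ is obtained from $C_{a_1+2j-1}$ by exchanging an even number of entries $k$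 by $\bar k$ (and reordering). **The correspondence.** A weight $\epsilon_{j_1}+\dots+\epsilon_{j_i}$ (or $\frac12(\epsilon_{j_1}+\dots+\epsilon_{j_n})$ for $\omega_n$ in type ${\tt B}_n$) in the $W$-orbit of a fundamental coweight, $j_1<\dots<j_i$, is encoded by the column with entries $j_1,\dots,j_i$ from top to bottom. A gallery of the same type as $\gamma_{\underline\lambda}$ is $\gamma=\gamma_1*\cdots*\gamma_N$, $N=\sum a_i$, where each $\gamma_k$ is of the same type as the corresponding $\gamma_{\omega_j}$. To $\gamma_k$ attach the one-column tableau of $\sigma(\omega_j)$ if $\omega_j$ is minuscule, and otherwise the two-column tableau with first (right) column that of $\tau(\omega_j)$ and second (left) column that of $\tau\sigma(\omega_j)$. $\mathcal T_\gamma$ is obtained by starting with the tableau of $\gamma_1$ and successively adding those of $\gamma_2,\dots,\gamma_N$ to the left. *)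

(* Defs.v *)
From HB Require Import structures.
From mathcomp Require Import all_boot all_order all_algebra.
From mathcomp Require Import boolp classical_sets functions reals.

Set Implicit Arguments.
Unset Strict Implicit.
Unset Printing Implicit Defensive.

Import Order.TTheory GRing.Theory Num.Theory.
Local Open Scope classical_set_scope.
Local Open Scope ring_scope.

(* The type is that of the coroot system. *)
Inductive cartan_type := TA | TB | TC.

(* Number of coordinates epsilon_1, epsilon_2, ... used in rank n. *)
Definition amb (t : cartan_type) (n : nat) : nat :=
  match t with TA => n.+1 | TB | TC => n end.

(* A letter (j, b) is an index of some epsilon, barred when b = true; indices
   start at 0, so (j, false) stands for j+1 and (j, true) for its bar.       *)
Definition letter (t : cartan_type) (n : nat) : Type := ('I_(amb t n) * bool)%type.

Section Letters.
Context {t : cartan_type} {n : nat}.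
Implicit Types (l : letter t n) (c : seq (letter t n)).

Definition bar l : letter t n := (l.1, ~~ l.2).

Definition alphabet l : bool := match t with TA => ~~ l.2 | TB | TC => true end.

(* 1 < 2 < ... < bar 2 < bar 1 *)
Definition letter_key l : nat := (if l.2 then (amb t n).*2 - l.1 else l.1)%N.
Definition letter_lt l l' : bool := (letter_key l < letter_key l')%N.

End Letters.

Section Apartment.
Context (R : realType) (t : cartan_type) (n : nat).

Notation V := 'rV[R]_(amb t n).
Implicit Types (v w x y : V) (F E D : set V) (i : 'I_n).

Definition dot v w : R := \sum_j v 0 j * w 0 j.

(* In type A, the quotient of R^(n+1) by the line of epsilon_1 + ... +
   epsilon_(n+1) is identified with the hyperplane of vectors of coordinate
   sum 0, through the orthogonal projection; see [eps] below.                 *)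
Definition apartment : set V :=
  match t with TA => [set x | \sum_j x 0 j = 0] | TB | TC => setT end.

Definition eps0 (j : 'I_(amb t n)) : V :=
  match t with
  | TA => delta_mx 0 j - const_mx ((amb t n)%:R^-1)
  | TB | TC => delta_mx 0 j
  end.

Definition eps (l : letter t n) : V := if l.2 then - eps0 l.1 else eps0 l.1.

(* Weights are sums of epsilons, except for the coefficient 1/2 of the last
   fundamental coweight in type B.                                           *)
Definition weight_coef i : R :=
  match t with TB => if i.+1 == n then 2^-1 else 1 | TA | TC => 1 end.

Definition omega i : V :=
  weight_coef i *: \sum_(j < amb t n | (j <= i)%N) eps0 j.

Definition pos_coroots : set V :=
  match t with
  | TA => [set b | exists j k : 'I_(amb t n), (j < k)%N /\ b = eps0 j - eps0 k]
  | TB => [set b | (exists j k : 'I_(amb t n), (j < k)%N /\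
                      (b = eps0 j - eps0 k \/ b = eps0 j + eps0 k))
                   \/ (exists j : 'I_(amb t n), b = eps0 j)]
  | TC => [set b | (exists j k : 'I_(amb t n), (j < k)%N /\
                      (b = eps0 j - eps0 k \/ b = eps0 j + eps0 k))
                   \/ (exists j : 'I_(amb t n), b = 2 *: eps0 j)]
  end.

Definition check v : V := (2 / dot v v) *: v.

(* A root alpha is the vector representing the linear form <alpha, -> through
   the dot product; its coroot is [check alpha].                             *)
Definition pos_roots : set V := check @` pos_coroots.
Definition roots : set V := pos_roots `|` [set - a | a in pos_roots].

Definition refl (a : V) (m : int) (x : V) : V :=
  x - (dot a x + m%:~R) *: check a.

(* The generators below are involutions, so the monoid they generate is the
   group they generate.                                                      *)
Inductive generated (S : set (V -> V)) : set (V -> V) :=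
| gen_id : generated S id
| gen_comp (s w : V -> V) : S s -> generated S w -> generated S (s \o w).

Definition weyl : set (V -> V) :=
  generated [set s | exists2 a, roots a & s = refl a 0].

Definition affine_weyl : set (V -> V) :=
  generated [set s | exists a m, roots a /\ s = refl a m].

Definition weyl_half i : set (V -> V) :=
  generated [set s | exists a, [/\ roots a,
    (exists m : int, dot a (2^-1 *: omega i) = m%:~R) & s = refl a 0]].

(* The smallest closed face containing x: the intersection of all closed
   half-spaces bounded by walls that contain x (both sides of a wall occur,
   since the set of roots is symmetric).                                     *)
Definition face_at x : set V :=
  [set y | apartment y /\ forall a (m : int), roots a ->
     0 <= dot a x + m%:~R -> 0 <= dot a y + m%:~R].

Definition is_face F : Prop := exists2 x, apartment x & F = face_at x.

(* d is the dimension of the smallest subspace U of directions of F. *)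
Definition has_dim F (d : nat) : Prop :=
  exists U : {vspace V},
    [/\ \dim U = d,
        (forall x y, F x -> F y -> x - y \in U) &
        (forall U' : {vspace V},
           (forall x y, F x -> F y -> x - y \in U') -> (U <= U')%VS)].

Definition is_vertex x : Prop := is_face [set x] /\ has_dim [set x] 0.
Definition is_edge E : Prop := is_face E /\ has_dim E 1.

Definition special x : Prop :=
  is_vertex x /\ forall a, roots a -> exists m : int, dot a x + m%:~R = 0.

Definition alcove : set V :=
  [set x | apartment x /\ forall a, pos_roots a -> 0 <= dot a x <= 1].

Definition face_type F D : Prop :=
  [/\ is_face D, D `<=` alcove & exists2 w : V -> V, affine_weyl w & w @` F = D].

(* (V_0, [:: (E_0, V_1); ...; (E_r, V_(r+1))]); the sequence of steps may be
   empty, which gives the trivial gallery needed for the zero coweight.      *)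
Definition gallery : Type := (V * seq (set V * V))%type.
Implicit Types (g h : gallery).

Definition source g : V := g.1.
Definition target g : V := last g.1 [seq p.2 | p <- g.2].
Definition vertices g : seq V := g.1 :: [seq p.2 | p <- g.2].
Definition faces g : seq (set V) :=
  [set g.1] :: flatten [seq [:: p.1; [set p.2]] | p <- g.2].

Fixpoint is_walk x (s : seq (set V * V)) : Prop :=
  match s with
  | [::] => True
  | (E, y) :: s' => [/\ is_edge E, E x, E y, is_vertex y & is_walk y s']
  end.

(* All galleries start at the origin. *)
Definition is_gallery g : Prop :=
  [/\ source g = 0, special (source g), special (target g)
    & is_walk (source g) g.2].

Definition gallery_type g (ds : seq (set V)) : Prop :=
  size ds = size (faces g) /\
  forall k, (k < size ds)%N -> face_type (nth set0 (faces g) k) (nth set0 ds k).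

Definition same_type g h : Prop :=
  exists ds, gallery_type g ds /\ gallery_type h ds.

Definition galleries_of_type h : set gallery :=
  [set g | is_gallery g /\ same_type g h].

Definition shift v F : set V := [set v + x | x in F].

Definition gcat g h : gallery :=
  let v := target g - source h in
  (g.1, g.2 ++ [seq (shift v p.1, v + p.2) | p <- h.2]).

Definition trivial_gallery : gallery := (0, [::]).

Definition segment v : set V := [set s *: v | s in [set s : R | 0 <= s <= 1]].

Definition straight v g : Prop :=
  [/\ is_gallery g, target g = v,
      (forall p, p \in g.2 -> p.1 `<=` segment v)
    & exists ss : seq R, sorted <%R ss /\ vertices g = [seq s *: v | s <- ss]].

(* The gallery of consecutive vertices and edges on the segment from 0 to
   omega_i is unique, so the choice made by xget is harmless.                *)
Definition gamma_omega i : gallery :=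
  xget trivial_gallery [set g | straight (omega i) g].

Definition coweight_word (a : 'I_n -> nat) : seq 'I_n :=
  flatten [seq nseq (a i) i | i <- enum 'I_n].

Definition gamma_lambda (a : 'I_n -> nat) : gallery :=
  foldr gcat trivial_gallery [seq gamma_omega i | i <- coweight_word a].

Definition minuscule v : Prop :=
  forall a, roots a -> dot a v = 0 \/ dot a v = 1 \/ dot a v = -1.

(* Columns are read from top to bottom; a tableau is the sequence of its
   columns from right to left (C_1 first).                                   *)
Definition column : Type := seq (letter t n).
Definition tableau : Type := seq column.
Implicit Types (c : column) (T : tableau).

Definition encodes i v c : Prop :=
  [/\ sorted letter_lt c, all alphabet c, size c = i.+1
    & v = weight_coef i *: \sum_(l <- c) eps l].

Definition elementary i g T : Prop :=
  (minuscule (omega i) /\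
     exists (s : V -> V) c, [/\ weyl s,
       g = (0, [:: (s @` segment (omega i), s (omega i))]),
       encodes i (s (omega i)) c & T = [:: c]])
  \/
  (~ minuscule (omega i) /\
     exists (u s : V -> V) c1 c2,
       let E1 := segment (2^-1 *: omega i) in
       let v1 := 2^-1 *: u (omega i) in
       [/\ weyl u /\ weyl_half i s,
           g = (0, [:: (u @` E1, v1);
                       (shift v1 ((u \o s) @` E1),
                        2^-1 *: (u (omega i) + u (s (omega i))))]),
           encodes i (u (omega i)) c1, encodes i (u (s (omega i))) c2
         & T = [:: c1; c2]]).

Inductive tableau_of_word : seq 'I_n -> gallery -> tableau -> Prop :=
| tableau_nil : tableau_of_word [::] trivial_gallery [::]
| tableau_cons i (w : seq 'I_n) g g' T T' :
    galleries_of_type (gamma_omega i) g -> elementary i g T ->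
    tableau_of_word w g' T' ->
    tableau_of_word (i :: w) (gcat g g') (T ++ T').

Definition tableau_of (a : 'I_n -> nat) (g : gallery) (T : tableau) : Prop :=
  tableau_of_word (coweight_word a) g T.

(* Length p_(r+1) of the row r; here j.+1 == n is the last index. *)
Definition row_len (a : 'I_n -> nat) (r : nat) : nat :=
  match t with
  | TA => \sum_(j < n | r <= j) a j
  | TB => \sum_(j < n | r <= j) (if j.+1 == n then a j else 2 * a j)
  | TC => \sum_(j < n | r <= j) (if j == 0 :> nat then a j else 2 * a j)
  end%N.

(* The column C_(k+1) is the one in position row_len a 0 - k.+1 (from 0)
   counted from the left; its boxes are in the rows longer than that.        *)
Definition column_height (a : 'I_n -> nat) (k : nat) : nat :=
  count (fun r => row_len a 0 - k.+1 < row_len a r)%N (iota 0 n).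

Definition has_shape (a : 'I_n -> nat) T : Prop :=
  size T = row_len a 0 /\
  forall k, (k < size T)%N -> size (nth [::] T k) = column_height a k.

Definition no_opposite c : Prop := forall l, l \in c -> bar l \notin c.

(* The entries selected by the mask m are exchanged with their bars. *)
Definition exchange (m : bitseq) c : column :=
  [seq if p.1 then bar p.2 else p.2 | p <- zip m c].

Definition exchanged c c' : Prop :=
  exists m : bitseq, size m = size c /\ perm_eq c' (exchange m c).

Definition even_exchanged c c' : Prop :=
  exists m : bitseq,
    [/\ size m = size c, ~~ odd (count id m) & perm_eq c' (exchange m c)].

Definition young_tableau (a : 'I_n -> nat) T : Prop :=
  [/\ has_shape a T,
      (forall c, c \in T -> all alphabet c /\ sorted letter_lt c)
    & match t with
      | TA => True
      | TB =>
          (forall c, c \in T -> no_opposite c) /\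
          forall j, (j < \sum_(i < n | i.+1 != n) a i)%N ->
            let c := nth [::] T (2 * j) in
            let c' := nth [::] T (2 * j).+1 in
            c = c' \/ exchanged c c'
      | TC =>
          (forall c, c \in T -> no_opposite c) /\
          forall j, (j < \sum_(i < n | i != 0 :> nat) a i)%N ->
            let a1 := (\sum_(i < n | i == 0 :> nat) a i)%N in
            let c := nth [::] T (a1 + 2 * j) in
            let c' := nth [::] T (a1 + 2 * j).+1 in
            c = c' \/ even_exchanged c c'
      end].

End Apartment.

(* Main.v *)
From mathcomp Require Import all_boot all_order all_algebra.
From mathcomp Require Import boolp classical_sets functions reals.
From mathcomp Require Import ring lra zify.
Require Import Defs.

(** The statement splits into geometry (what the galleries of a given type are)
    and combinatorics (which columns they give).

    Everything is read off from signed coordinates.  Up to scale every root is a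
    difference of two signed unit vectors indexed by letters, and its reflection
    exchanges these two letters and their bars ([coord_refl]).  Hence the Weyl
    group permutes letters, and the orbit of a fundamental coweight consists of
    the weights of the sets of i+1 letters without opposite letters
    ([weyl_weight], [weyl_transitive]); sorted, these sets are the columns of a
    tableau.

    Two galleries have the same type when their faces are conjugate, one by one,
    under the affine Weyl group W^a; that every face concerned has a type at all
    is the usual argument moving a point as close as possible to an interior point
    of the alcove ([to_alcove]).  A translation by a coweight permutes the walls,
    and conjugate special vertices differ by a translation lying in W^a.  So a
    gallery of the type of a concatenation can be cut at the special vertices and
    the pieces moved back to the origin ([type_gcat]): it suffices to treat one
    fundamental coweight omega.

    The walls cut the line through omega exactly in the multiples of nu = omega/N,
    with N = 1 if omega is minuscule and N = 2 otherwise ([face_line]).  So the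
    gallery along omega has N steps and is unique ([gamma_omegaE]).  Suppose that a
    gallery of its type starts with the edge w [0, nu], where w is in W^a.  Since
    elements of W^a move the origin by vectors of the coroot lattice, and since nu
    is not in that lattice if N = 1 and not a coweight if N = 2, the origin must be
    w 0; so w is linear, i.e. an element u of the Weyl group ([first_step]).  If
    N = 2, the second edge is w [nu, 2 nu] with w in W^a and w nu = u nu, so that
    h = u^-1 w is in W^a and fixes nu.  If l is the linear part of h, then
    (omega - l omega)/2 = h 0 is in the coroot lattice.  In coordinates this says
    that l omega arises from omega by sign changes, in even number in type C, and
    these are exactly the points reached by the subgroup generated by the
    reflections whose roots are integral at omega/2 ([weyl_half_base],
    [second_step]).

    The same lattice condition, for the weights of two columns, says that the
    second column arises from the first by exchanging entries with their bars, an
    even number of them in type C ([related_lattice]).  So elementary galleries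
    correspond to single columns or to pairs as in the definition of Young tableaux
    ([elementary_block], [block_elementary]).  Finally the coweights occur in
    increasing order, so the heights of the columns are those prescribed by the
    shape, and the pairs are where the definition puts them ([has_shapeE],
    [blocks_young]). *)

Set Implicit Arguments.
Unset Strict Implicit.
Unset Printing Implicit Defensive.

Import Order.TTheory GRing.Theory Num.Theory.
Local Open Scope classical_set_scope.
Local Open Scope ring_scope.

(** * Letters and their exchange *)

Section Letters.
Context {t : cartan_type} {n : nat}.
Implicit Types (k l : letter t n).

Lemma barK : involutive (@bar t n).
Proof. by case=> j b; rewrite /bar /= negbK. Qed.

Lemma bar_inj : injective (@bar t n).
Proof. exact: inv_inj barK. Qed.

Lemma bar_neq l : (bar l == l) = false.
Proof. by case: l => j b; rewrite /bar xpair_eqE /= eqxx; case: b. Qed.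

Lemma neq_bar l : (l == bar l) = false.
Proof. by rewrite eq_sym bar_neq. Qed.

Lemma eq_barC k l : (k == bar l) = (bar k == l).
Proof. by apply/eqP/eqP => [->|<-]; rewrite barK. Qed.

Lemma letter_key_inj : injective (@letter_key t n).
Proof.
move=> [j b] [k c]; rewrite /letter_key /= => h; have := ltn_ord j; have := ltn_ord k.
have jk : (j : nat) = k -> j = k by move/ord_inj.
case: b c h => [] [] h hj hk; try (exfalso; lia); by rewrite jk //; lia.
Qed.

(** The permutation of letters induced by the reflection that exchanges the
    unit vectors of l and l'; it also has to exchange their bars. *)
Definition swap l l' k : letter t n :=
  if k == l then l' else if k == l' then l else
  if k == bar l then bar l' else if k == bar l' then bar l else k.

Lemma swap_bar l l' k : l != l' -> swap l l' (bar k) = bar (swap l l' k).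
Proof.
move=> ll'; rewrite /swap !(inj_eq bar_inj) -!eq_barC.
have [->|kl] := eqVneq k l.
  by rewrite neq_bar; case: eqP.
have [->|kl'] := eqVneq k l'; first by rewrite neq_bar; case: eqP => // ->; rewrite barK.
have [_|_] := eqVneq k (bar l); first by rewrite barK.
by have [_|_] := eqVneq k (bar l'); rewrite ?barK.
Qed.

Lemma swapK l l' : l != l' -> involutive (swap l l').
Proof.
move=> ll' k; rewrite {2}/swap; have [->|kl] := eqVneq k l.
  by rewrite /swap eq_sym (negPf ll') eqxx.
have [->|kl'] := eqVneq k l'; first by rewrite /swap eqxx.
have [->|kbl] := eqVneq k (bar l).
  by rewrite swap_bar // /swap eq_sym (negPf ll') eqxx.
have [->|kbl'] := eqVneq k (bar l'); first by rewrite swap_bar // /swap eqxx.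
by rewrite /swap (negPf kl) (negPf kl') (negPf kbl) (negPf kbl').
Qed.

Lemma swap_alphabet l l' k : alphabet l -> alphabet l' ->
  alphabet (swap l l' k) = alphabet k.
Proof.
rewrite /alphabet /swap; case: t l l' k => //= l l' k hl hl'.
have [->|_] := eqVneq k l; first by rewrite hl hl'.
have [->|_] := eqVneq k l'; first by rewrite hl hl'.
have [->|_] := eqVneq k (bar l); first by rewrite /= !negbK (negPf hl) (negPf hl').
by have [->|_] := eqVneq k (bar l') => //=; rewrite !negbK (negPf hl) (negPf hl').
Qed.

Lemma alphabetF j : alphabet ((j, false) : letter t n).
Proof. by rewrite /alphabet; case: t j. Qed.

Lemma alphabetNA l : t <> TA -> alphabet l.
Proof. by rewrite /alphabet; case: t l. Qed.

Lemma alphabetA l : t = TA -> alphabet l = ~~ l.2.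
Proof. by rewrite /alphabet; case: t l. Qed.

End Letters.

(** * Roots in signed coordinates *)

Section Roots.
Context {R : realType} {t : cartan_type} {n : nat}.
Notation V := 'rV[R]_(amb t n).
Notation L := (letter t n).
Implicit Types (x y v : V) (k l : L).

(** The coordinate along the unit vector of a letter; a bar changes its sign. *)
Definition coord x l : R := if l.2 then - x 0 l.1 else x 0 l.1.
(** In type A this is not [eps]: roots are differences of unprojected unit
    vectors, and it is for these that reflections have simple coordinates. *)
Definition unit_vec l : V := if l.2 then - delta_mx 0 l.1 else delta_mx 0 l.1.

Lemma coordD x y l : coord (x + y) l = coord x l + coord y l.
Proof. by rewrite /coord mxE; case: l.2 => //; rewrite opprD. Qed.
Lemma coordN x l : coord (- x) l = - coord x l.
Proof. by rewrite /coord mxE; case: l.2. Qed.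
Lemma coordB x y l : coord (x - y) l = coord x l - coord y l.
Proof. by rewrite coordD coordN. Qed.
Lemma coordZ r x l : coord (r *: x) l = r * coord x l.
Proof. by rewrite /coord mxE; case: l.2 => //; rewrite mulrN. Qed.
Lemma coord0 l : coord 0 l = 0.
Proof. by rewrite /coord mxE oppr0 if_same. Qed.
Lemma coord_sum (I : Type) (s : seq I) (P : pred I) (F : I -> V) l :
  coord (\sum_(i <- s | P i) F i) l = \sum_(i <- s | P i) coord (F i) l.
Proof.
exact: (big_morph (fun x => coord x l) (fun x y => coordD x y l) (coord0 l)).
Qed.
Lemma coord_bar x l : coord x (bar l) = - coord x l.
Proof. by rewrite /coord /=; case: l.2; rewrite /= ?opprK. Qed.

Lemma coord_unit k l : coord (unit_vec k) l = (k == l)%:R - (k == bar l)%:R.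
Proof.
case: k l => [j b] [i c]; rewrite /coord /unit_vec /bar !xpair_eqE /=.
rewrite (eq_sym j).
case: b c => [] []; rewrite !mxE eqxx /=; case: eqP => //= _; rewrite ?mulr0 ?mulr1; lra.
Qed.

Lemma coord_ext x y : (forall l, alphabet l -> coord x l = coord y l) -> x = y.
Proof.
move=> h; apply/rowP => j; have := h (j, false); rewrite /coord /=; apply.
by rewrite /alphabet; case: t j.
Qed.

Lemma dotC x y : dot x y = dot y x.
Proof. by apply: eq_bigr => j _; rewrite mulrC. Qed.
Lemma dotDr x y z : dot x (y + z) = dot x y + dot x z.
Proof. by rewrite /dot -big_split; apply: eq_bigr => j _; rewrite mxE mulrDr. Qed.
Lemma dotZr r x y : dot x (r *: y) = r * dot x y.
Proof. by rewrite /dot mulr_sumr; apply: eq_bigr => j _; rewrite mxE mulrCA. Qed.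
Lemma dotNr x y : dot x (- y) = - dot x y.
Proof. by rewrite -scaleN1r dotZr mulN1r. Qed.
Lemma dotBr x y z : dot x (y - z) = dot x y - dot x z.
Proof. by rewrite dotDr dotNr. Qed.
Lemma dotDl x y z : dot (y + z) x = dot y x + dot z x.
Proof. by rewrite dotC dotDr !(dotC x). Qed.
Lemma dotZl r x y : dot (r *: y) x = r * dot y x.
Proof. by rewrite dotC dotZr dotC. Qed.
Lemma dotNl x y : dot (- y) x = - dot y x.
Proof. by rewrite dotC dotNr dotC. Qed.
Lemma dotBl x y z : dot (y - z) x = dot y x - dot z x.
Proof. by rewrite dotDl dotNl. Qed.
Lemma dot0r x : dot x 0 = 0.
Proof. by rewrite -(scale0r 0) dotZr mul0r. Qed.

Lemma dot_unit l x : dot (unit_vec l) x = coord x l.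
Proof.
rewrite /unit_vec /coord; suff h : dot (delta_mx 0 l.1) x = x 0 l.1.
  by case: l.2; rewrite ?dotNl h.
rewrite /dot (bigD1 l.1) //= mxE !eqxx mul1r big1 ?addr0 // => j /negPf jl.
by rewrite mxE jl andbF mul0r.
Qed.

(** In type C the root e_j, and in type B the coroot e_j, is half of the
    difference e_j - (- e_j) of the unit vectors of two opposite letters; in all
    other cases roots and coroots are the differences themselves. *)
Definition root_scale l l' : R :=
  if t is TC then if l' == bar l then 2^-1 else 1 else 1.
Definition coroot_scale l l' : R :=
  if t is TB then if l' == bar l then 2^-1 else 1 else 1.
Definition lroot l l' : V := root_scale l l' *: (unit_vec l - unit_vec l').
Definition lcoroot l l' : V := coroot_scale l l' *: (unit_vec l - unit_vec l').

Definition letter_pair l l' := [/\ alphabet l, alphabet l' & l != l'].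

Lemma dot_lroot l l' x : dot (lroot l l') x = root_scale l l' * (coord x l - coord x l').
Proof. by rewrite dotZl dotBl !dot_unit. Qed.

Lemma root_scale_gt0 l l' : 0 < root_scale l l'.
Proof. by rewrite /root_scale; case: (_ == _); case: t => *; lra. Qed.

Lemma alphabet_bar l : letter_pair l (bar l) -> t <> TA.
Proof. by case; rewrite /alphabet; case: t l => // l /= ->. Qed.

(** A root and its coroot on opposite letters are e_j and 2 e_j in some
    order, while the difference of the unit vectors is 2 e_j. *)
Lemma root_scale_bar l : letter_pair l (bar l) ->
  root_scale l (bar l) * coroot_scale l (bar l) = 2^-1.
Proof.
by move/alphabet_bar; rewrite /root_scale /coroot_scale eqxx; case: t => // _; rewrite ?mul1r
  ?mulr1.
Qed.
Lemma root_scale_nbar l l' : l' != bar l -> root_scale l l' = 1.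
Proof. by rewrite /root_scale => /negPf ->; case: t. Qed.
Lemma coroot_scale_nbar l l' : l' != bar l -> coroot_scale l l' = 1.
Proof. by rewrite /coroot_scale => /negPf ->; case: t. Qed.

Lemma check_lroot l l' : letter_pair l l' -> check (lroot l l') = lcoroot l l'.
Proof.
move=> hll'; have [_ _ /negPf ll'] := hll'.
rewrite /check dot_lroot {1 2}/lroot !coordZ !coordB !coord_unit.
rewrite !eqxx !neq_bar (eq_sym l' l) ll' (eq_barC l) (eq_sym (bar l)).
have [e|ne] := eqVneq l' (bar l).
  subst l'; rewrite /lcoroot scalerA /=; congr (_ *: _).
  have := root_scale_bar hll'; have := root_scale_gt0 l (bar l).
  move: (root_scale _ _) (coroot_scale _ _) => a b a0 ab.
  have -> : b = 2^-1 / a by rewrite -ab mulrAC divff ?mul1r // gt_eqF.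
  rewrite [X in 2 / X](_ : _ = 4 * a ^+ 2); last by ring.
  by field; rewrite gt_eqF.
rewrite /lroot root_scale_nbar // /lcoroot coroot_scale_nbar // !scale1r /= -[RHS]scale1r.
by congr (_ *: _); rewrite [X in 2 / X](_ : _ = 2); [field | ring].
Qed.

Lemma lrootC l l' : lroot l' l = - lroot l l'.
Proof.
rewrite /lroot -scalerN opprB; congr (_ *: _).
by rewrite /root_scale eq_sym eq_barC eq_sym.
Qed.

Lemma eps0_delta (j : 'I_(amb t n)) : t <> TA -> eps0 R j = delta_mx 0 j :> V.
Proof. by rewrite /eps0; case: t j. Qed.

Lemma check_eps0B (j k : 'I_(amb t n)) : j <> k ->
  check (eps0 R j - eps0 R k) = lroot (j, false) (k, false).
Proof.
move=> jk; have lp : letter_pair (j, false) (k, false).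
  split; [exact: alphabetF..|].
  by rewrite xpair_eqE /= andbT; apply/eqP.
have nb : (k, false) != bar (j, false) :> L by rewrite /bar xpair_eqE andbF.
transitivity (check (lroot (j,false) (k,false))); last first.
  by rewrite check_lroot // /lcoroot /lroot root_scale_nbar // coroot_scale_nbar.
congr check; rewrite /lroot root_scale_nbar // scale1r /unit_vec /= /eps0.
by case: t j k {jk lp nb} => //= j k; rewrite opprB addrA subrK.
Qed.

Lemma check_eps0D (j k : 'I_(amb t n)) : t <> TA -> j <> k ->
  check (eps0 R j + eps0 R k) = lroot (j, false) (k, true).
Proof.
move=> tA jk; have lp : letter_pair (j, false) (k, true).
  split; [exact: alphabetF|exact: alphabetNA|].
  by rewrite xpair_eqE /= andbF.
have nb : (k, true) != bar (j, false) :> L.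
  by rewrite /bar xpair_eqE andbT /=; apply/eqP => /esym.
transitivity (check (lroot (j,false) (k,true))); last first.
  by rewrite check_lroot // /lcoroot /lroot root_scale_nbar // coroot_scale_nbar.
by congr check; rewrite /lroot root_scale_nbar // scale1r /unit_vec /= !eps0_delta // opprK.
Qed.

Lemma check_eps0 (j : 'I_(amb t n)) :
  check (match t with TC => 2 *: eps0 R j | _ => eps0 R j end) = lroot (j, false) (j, true) \/ t
    = TA.
Proof.
have [tA|tA] := pselect (t = TA); [by right|left].
have lp : letter_pair (j, false) (j, true).
  split; [exact: alphabetF|exact: alphabetNA|].
  by rewrite xpair_eqE /= andbF.
have ee : (j, true) == bar (j, false) :> L by [].
have -> : match t with TC => 2 *: eps0 R j | _ => eps0 R j end = lcoroot (j, false) (j, true).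
  rewrite eps0_delta // /lcoroot /coroot_scale ee /unit_vec /= opprK -mulr2n -(scaler_nat 2).
  move: (delta_mx 0 j) => d; clear j lp ee; case: t tA d => // _ d; last by rewrite scale1r.
  by rewrite scalerA mulVf ?scale1r // pnatr_eq0.
rewrite /lcoroot /lroot.
have d2 : dot (unit_vec (j, false) - unit_vec (j, true))
  (unit_vec (j, false) - unit_vec (j, true)) = 4.
  rewrite dotBl !dot_unit !coordB !coord_unit /bar !xpair_eqE !eqxx /=; lra.
rewrite /check dotZl dotZr d2 scalerA; congr (_ *: _).
by rewrite /root_scale /coroot_scale ee; clear lp ee d2 j; case: t tA => // _; field.
Qed.

Lemma pos_rootsP (a : V) : pos_roots a ->
  exists (j k : 'I_(amb t n)) b, [/\ a = lroot (j, false) (k, b), (j < k)%N || b & b -> t <> TA].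
Proof.
case=> b hb <-.
have E (j k : 'I_(amb t n)) : (j < k)%N -> j <> k by move=> + e; rewrite e ltnn.
have [tA|tA] := pselect (t = TA).
  have {hb} [j [k [jk ->]]] : exists j k : 'I_(amb t n), (j < k)%N /\ b = eps0 R j - eps0 R k.
    by clear E; move: hb; rewrite /pos_coroots; case: t tA b.
  by exists j, k, false; rewrite jk check_eps0B //; exact: E.
have {hb} : (exists j k : 'I_(amb t n), (j < k)%N /\
                      (b = eps0 R j - eps0 R k \/ b = eps0 R j + eps0 R k))
   \/ (exists j, b = match t with TC => 2 *: eps0 R j | _ => eps0 R j end).
  by clear E; move: hb; rewrite /pos_coroots; case: t tA b.
case=> [[j [k [jk [->|->]]]]|[j ->]].
- by exists j, k, false; rewrite jk check_eps0B //; exact: E.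
- by exists j, k, true; rewrite jk check_eps0D //; exact: E.
- by case: (check_eps0 j) => // ->; exists j, j, true; split => //; rewrite orbT.
Qed.

Lemma roots_lroot (a : V) : roots a -> exists l l', letter_pair l l' /\ a = lroot l l'.
Proof.
have H (c : V) : pos_roots c -> exists l l', letter_pair l l' /\ c = lroot l l'.
  move=> /pos_rootsP [j [k [b [-> jk bA]]]]; exists (j, false), (k, b); split => //.
  split; [exact: alphabetF|by case: b {jk} bA => h; [exact/alphabetNA/h|exact: alphabetF]|].
  by move: jk; rewrite xpair_eqE negb_and; case: b {bA}; rewrite ?orbT //= !orbF -val_eqE
    neq_ltn => ->.
case=> [/H//|[c /H[l [l' [[hl hl' ll'] ->]]] <-]].
by exists l', l; split; [split; rewrite // eq_sym|rewrite -lrootC].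
Qed.

Lemma roots_opp (a : V) : roots a -> roots (- a).
Proof.
by case=> [h|[c h <-]]; [right; exists a|left; rewrite opprK].
Qed.

Lemma lroot_roots l l' : letter_pair l l' -> roots (lroot l l').
Proof.
have H1 (j k : 'I_(amb t n)) : j <> k -> roots (lroot (j, false) (k, false)).
  wlog jk : j k / (j < k)%N => [hw|jk'].
    have [jk jk'|kj jk'|/ord_inj-> //] := ltngtP j k; first exact: hw.
    by rewrite lrootC; apply/roots_opp/hw => // /esym.
  left; exists (eps0 R j - eps0 R k); last by rewrite check_eps0B.
  by rewrite /pos_coroots; case: t j k jk {jk'} => j k jk /=; [|left|left]; exists j, k; split
    => //; left.
have H2 (j k : 'I_(amb t n)) : t <> TA -> j <> k -> roots (lroot (j, false) (k, true)).
  move=> tA; wlog jk : j k / (j < k)%N => [hw|jk'].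
    have [jk jk'|kj jk'|/ord_inj-> //] := ltngtP j k; first exact: hw.
    by rewrite -check_eps0D // addrC check_eps0D; [apply: hw => // /esym|by []|exact: nesym].
  left; exists (eps0 R j + eps0 R k); last by rewrite check_eps0D.
  by rewrite /pos_coroots; case: t j k tA jk {jk'} => // j k _ jk /=; left; exists j, k; split
    => //; right.
have H3 (j : 'I_(amb t n)) : t <> TA -> roots (lroot (j, false) (j, true)).
  move=> tA; case: (check_eps0 j) => // <-; left.
  eexists; last reflexivity.
  by rewrite /pos_coroots; case: t j tA => // j _ /=; right; exists j.
case: l l' => [j []] [k []] [h1 h2 h3].
- have jk : k <> j by move=> e; rewrite e eqxx in h3.
  rewrite (_ : lroot _ _ = lroot (k, false) (j, false)); first exact: H1.
  have nb : (k, true) != bar (j, true) :> L by rewrite xpair_eqE andbF.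
  have nb' : (j, false) != bar (k, false) :> L by rewrite xpair_eqE andbF.
  by rewrite /lroot !root_scale_nbar // !scale1r /unit_vec /= opprK addrC.
- have tA : t <> TA by move=> tA; rewrite alphabetA in h1.
  rewrite lrootC; apply: roots_opp; have [<-|jk] := eqVneq j k; first exact: H3.
  by apply: H2 => //; apply/eqP; rewrite eq_sym.
- have tA : t <> TA by move=> tA; rewrite alphabetA in h2.
  by have [<-|/eqP jk] := eqVneq j k; [exact: H3|exact: H2].
- by apply: H1 => e; rewrite e eqxx in h3.
Qed.

End Roots.

(** * The Weyl group acts on letters *)

Section Weyl.
Context {R : realType} {t : cartan_type} {n : nat}.
Notation V := 'rV[R]_(amb t n).
Notation L := (letter t n).
Implicit Types (x y v : V) (k l : L).

Lemma refl0 (a : V) m x : refl a m x = refl a 0 x - m%:~R *: check a.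
Proof. by rewrite /refl addr0 scalerDl opprD addrA. Qed.

Lemma eq_bar_sym k l : (k == bar l) = (l == bar k).
Proof. by rewrite eq_barC eq_sym. Qed.

(** A vector is known by its coordinates, so this makes reflections, hence
    all Weyl group elements, act by permutations of the letters. *)
Lemma coord_refl l l' x k : letter_pair l l' ->
  coord (refl (lroot l l') 0 x) k = coord x (swap l l' k).
Proof.
move=> lp; have [_ _ /negPf ll'] := lp.
rewrite /refl check_lroot // addr0 dot_lroot coordB coordZ /lcoroot coordZ coordB !coord_unit
  /swap.
rewrite (eq_bar_sym k l) (eq_bar_sym k l') (eq_sym k l) (eq_sym k l').
have [e|nb] := eqVneq l' (bar l).
  have rc : root_scale l l' * coroot_scale l l' = 2^-1 :> R by subst l'; rewrite root_scale_bar.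
  rewrite mulrACA rc e coord_bar (inj_eq bar_inj) -(eq_barC l k).
  have [->|lk] := eqVneq l k; first by rewrite neq_bar /= coord_bar; lra.
  by have [->|_] := eqVneq l (bar k); rewrite ?barK ?coord_bar /=; lra.
rewrite root_scale_nbar // coroot_scale_nbar // !mul1r.
have [lk|lk] := eqVneq l k.
  by subst k; rewrite neq_bar (eq_sym l' l) ll' (negPf nb) /=; lra.
have [l'k|l'k] := eqVneq l' k.
  have nb' : l != bar l' by rewrite eq_bar_sym.
  by subst k; rewrite neq_bar (negPf nb') /=; lra.
have [lbk|lbk] := eqVneq l (bar k).
  have e' : k = bar l by rewrite lbk barK.
  by subst k; rewrite barK (eq_sym l' l) ll' !coord_bar /=; lra.
by have [->|_] := eqVneq l' (bar k); rewrite ?coord_bar /=; lra.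
Qed.

Lemma reflL (a : V) x y r : refl a 0 (r *: x + y) = r *: refl a 0 x + refl a 0 y.
Proof.
rewrite /refl !addr0 dotDr dotZr scalerDl -scalerA.
by apply/rowP => j; rewrite !mxE; ring.
Qed.

(** The permutation acts on the argument of coordinates, so it is the inverse
    of the one that u induces on unit vectors. *)
Definition letter_action (u : V -> V) (s : L -> L) :=
  [/\ injective s, (forall k, s (bar k) = bar (s k)),
      (forall k, alphabet (s k) = alphabet k)
    & forall x k, coord (u x) k = coord x (s k)].

Lemma swap_action l l' : letter_pair l l' ->
  letter_action (refl (lroot l l') 0) (swap l l').
Proof.
move=> lp; have [h h' ll'] := lp; split.
- exact: inv_inj (swapK ll').
- by move=> k; rewrite swap_bar.
- by move=> k; rewrite swap_alphabet.
- by move=> x k; rewrite coord_refl.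
Qed.

Lemma weyl_action (u : V -> V) : weyl u -> exists s, letter_action u s.
Proof.
elim=> [|r w [a /roots_lroot[l [l' [lp ->]] ->]] _ [s [s1 s2 s3 s4]]].
  by exists id; split.
have [r1 r2 r3 r4] := swap_action lp.
exists (s \o swap l l'); split => [|k|k|x k] /=.
- exact: inj_comp.
- by rewrite r2 s2.
- by rewrite s3 r3.
- by rewrite r4 s4.
Qed.

Lemma weyl_linear (u : V -> V) : weyl u ->
  forall r x y, u (r *: x + y) = r *: u x + u y.
Proof.
case/weyl_action => s [_ _ _ h] r x y; apply: coord_ext => l _.
by rewrite h !coordD !coordZ !h.
Qed.

Lemma weyl0 (u : V -> V) : weyl u -> u 0 = 0.
Proof. by case/weyl_action => s [_ _ _ h]; apply: coord_ext => l _; rewrite h !coord0. Qed.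
Lemma weylD (u : V -> V) x y : weyl u -> u (x + y) = u x + u y.
Proof. by move=> /weyl_linear h; have := h 1 x y; rewrite !scale1r. Qed.
Lemma weylZ (u : V -> V) r x : weyl u -> u (r *: x) = r *: u x.
Proof. by move=> hu; have := weyl_linear hu r x 0; rewrite addr0 weyl0 // addr0. Qed.
Lemma weylN (u : V -> V) x : weyl u -> u (- x) = - u x.
Proof. by move=> hu; rewrite -scaleN1r weylZ // scaleN1r. Qed.
Lemma weylB (u : V -> V) x y : weyl u -> u (x - y) = u x - u y.
Proof. by move=> hu; rewrite weylD // weylN. Qed.

Lemma action_pair (u : V -> V) s l l' : letter_action u s -> letter_pair l l' ->
  letter_pair (s l) (s l').
Proof. by case=> s1 s2 s3 s4 [h h' ll']; split; rewrite ?s3 // (inj_eq s1). Qed.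

Lemma weyl_roots (u : V -> V) (a : V) : weyl u -> roots a ->
  exists2 b : V, roots b & forall x, dot a (u x) = dot b x.
Proof.
move=> /weyl_action[s us] /roots_lroot[l [l' [lp ->]]].
have [s1 s2 s3 s4] := us; exists (lroot (s l) (s l')).
  exact/lroot_roots/action_pair/lp/us.
move=> x; rewrite !dot_lroot !s4; congr (_ * _); rewrite /root_scale.
by rewrite -s2 (inj_eq s1).
Qed.

Lemma generated_comp (S : set (V -> V)) (u w : V -> V) :
  generated S u -> generated S w -> generated S (u \o w).
Proof.
move=> hu hw; elim: hu => [//|s v Ss _ ih].
exact: (gen_comp Ss ih).
Qed.

Lemma generated1 (S : set (V -> V)) (s : V -> V) : S s -> generated S s.
Proof. by move=> hs; exact: (gen_comp hs (gen_id S)). Qed.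

(** The monoid generated by involutions is a group. *)
Lemma generated_inv (S : set (V -> V)) (u : V -> V) :
  (forall s, S s -> involutive s) -> generated S u ->
  exists w, [/\ generated S w, cancel u w & cancel w u].
Proof.
move=> hS; elim=> [|s v Ss _ [w [gw vw wv]]]; first by exists id; split => //; exact: gen_id.
exists (w \o s); split=> [|x|x] /=; first exact/generated_comp/generated1.
  by rewrite hS.
by rewrite wv hS.
Qed.

Lemma generated_sub (S S' : set (V -> V)) (u : V -> V) :
  (forall s, S s -> S' s) -> generated S u -> generated S' u.
Proof.
move=> hS; elim=> [|s v Ss _ ih]; first exact: gen_id.
exact: gen_comp (hS _ Ss) ih.
Qed.

Lemma root_neq0 (a : V) : roots a -> dot a a != 0.
Proof.
move=> /roots_lroot[l [l' [lp ->]]]; have [_ _ /negPf ll'] := lp.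
rewrite dot_lroot /lroot !coordZ !coordB !coord_unit !eqxx (eq_sym l' l) ll' !neq_bar.
have := root_scale_gt0 (R := R) l l'; move: (root_scale _ _) => c c0.
rewrite -mulrBr; apply: mulf_neq0; first by rewrite gt_eqF.
apply: mulf_neq0; first by rewrite gt_eqF.
by apply: lt0r_neq0; case: (_ == bar _); case: (_ == bar _); rewrite /=; lra.
Qed.

Lemma dot_check (a : V) : roots a -> dot a (check a) = 2.
Proof. by move=> /root_neq0 h; rewrite /check dotZr divfK. Qed.

Lemma reflK (a : V) m : roots a -> involutive (refl a m).
Proof.
move=> ha x; rewrite /refl dotBr dotZr dot_check //.
by apply/rowP => j; rewrite !mxE; ring.
Qed.

Lemma weyl_inv (u : V -> V) : weyl u -> exists w, [/\ weyl w, cancel u w & cancel w u].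
Proof. by apply: generated_inv => s [a ha ->]; exact: reflK. Qed.

Lemma affine_inv (u : V -> V) : affine_weyl u ->
  exists w, [/\ affine_weyl w, cancel u w & cancel w u].
Proof. by apply: generated_inv => s [a [m [ha ->]]]; exact: reflK. Qed.

Lemma weyl_affine (u : V -> V) : weyl u -> affine_weyl u.
Proof. by apply: generated_sub => s [a ha ->]; exists a, 0. Qed.

End Weyl.

(** * The coroot lattice and the affine Weyl group *)

Section Affine.
Context {R : realType} {t : cartan_type} {n : nat}.
Notation V := 'rV[R]_(amb t n).
Notation L := (letter t n).
Implicit Types (x y v : V) (k l : L).

Definition csum x : R := \sum_j x 0 j.
Definition letter_sign l : R := if l.2 then -1 else 1.

Lemma csumE x : csum x = dot (const_mx 1) x.
Proof. by apply: eq_bigr => j _; rewrite mxE mul1r. Qed.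
Lemma csumD x y : csum (x + y) = csum x + csum y.
Proof. by rewrite !csumE dotDr. Qed.
Lemma csumZ r x : csum (r *: x) = r * csum x.
Proof. by rewrite !csumE dotZr. Qed.
Lemma csumB x y : csum (x - y) = csum x - csum y.
Proof. by rewrite !csumE dotBr. Qed.
Lemma csum0 : csum 0 = 0.
Proof. by rewrite !csumE dot0r. Qed.
Lemma csum_unit l : csum (unit_vec l) = letter_sign l.
Proof.
rewrite csumE dotC dot_unit /coord /letter_sign.
by case: l.2; rewrite mxE.
Qed.

Lemma apartmentE x : apartment x <-> (t = TA -> csum x = 0).
Proof.
rewrite /apartment /csum; case: t x => x /=; split => //; first exact.
Qed.

Lemma apartment0 : apartment (0 : V).
Proof. by apply/apartmentE => _; rewrite csum0. Qed.
Lemma apartmentD x y : apartment x -> apartment y -> apartment (x + y).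
Proof. by move=> /apartmentE hx /apartmentE hy; apply/apartmentE => tA; rewrite csumD hx // hy
  // addr0. Qed.
Lemma apartmentZ r x : apartment x -> apartment (r *: x).
Proof. by move=> /apartmentE hx; apply/apartmentE => tA; rewrite csumZ hx // mulr0. Qed.
Lemma apartmentN x : apartment x -> apartment (- x).
Proof. by move=> hx; rewrite -scaleN1r; exact: apartmentZ. Qed.

Lemma csum_lroot l l' : t = TA -> letter_pair l l' -> csum (lroot l l') = 0.
Proof.
move=> tA [h h' _]; rewrite csumZ csumB !csum_unit /letter_sign.
by move: h h'; rewrite !alphabetA // => /negPf -> /negPf ->; rewrite subrr mulr0.
Qed.

Lemma apartment_check (a : V) : roots a -> apartment (check a).
Proof.
move=> /roots_lroot[l [l' [lp ->]]]; apply/apartmentE => tA.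
by rewrite csumZ csum_lroot // mulr0.
Qed.

Lemma apartment_refl (a : V) m x : roots a -> apartment x -> apartment (refl a m x).
Proof.
move=> ha hx; apply: apartmentD => //; apply: apartmentN; apply: apartmentZ.
exact: apartment_check.
Qed.

Lemma apartment_affine (w : V -> V) x : affine_weyl w -> apartment x -> apartment (w x).
Proof.
move=> hw hx; elim: hw => //= s v [a [m [ha ->]]] _; exact: apartment_refl.
Qed.

(** The points in the apartment where all roots are integral, i.e. the lattice
    of the special vertices ([special_coweight], [special_coweightP]). *)
Definition coweight x := apartment x /\ forall a, roots a -> dot a x \is a Num.int.

Lemma coweight0 : coweight 0.
Proof. by split; [exact: apartment0|move=> a _; rewrite dot0r rpred0]. Qed.
Lemma coweightD x y : coweight x -> coweight y -> coweight (x + y).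
Proof.
move=> [hx hx'] [hy hy']; split; first exact: apartmentD.
by move=> a ha; rewrite dotDr rpredD ?hx' ?hy'.
Qed.
Lemma coweightN x : coweight x -> coweight (- x).
Proof.
move=> [hx hx']; split; first exact: apartmentN.
by move=> a ha; rewrite dotNr rpredN ?hx'.
Qed.
Definition int_vec x := forall j, x 0 j \is a Num.int.

Lemma int_vecP x : int_vec x <-> forall l, coord x l \is a Num.int.
Proof.
split=> h.
  by move=> l; rewrite /coord; case: l.2; rewrite ?rpredN; exact: h.
by move=> j; exact: (h (j, false)).
Qed.

Lemma int_vec_dot x y : int_vec x -> int_vec y -> dot x y \is a Num.int.
Proof. by move=> hx hy; apply: rpred_sum => j _; rewrite rpredM ?hx ?hy. Qed.

Lemma int_vec_unit l : int_vec (unit_vec l).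
Proof. by apply/int_vecP => k; rewrite coord_unit rpredB // natr_int. Qed.

Lemma int_vecB x y : int_vec x -> int_vec y -> int_vec (x - y).
Proof. by move=> hx hy j; rewrite !mxE rpredB ?hx ?hy. Qed.
Lemma int_vecD x y : int_vec x -> int_vec y -> int_vec (x + y).
Proof. by move=> hx hy j; rewrite !mxE rpredD ?hx ?hy. Qed.
Lemma int_vecZ r x : r \is a Num.int -> int_vec x -> int_vec (r *: x).
Proof. by move=> hr hx j; rewrite !mxE rpredM ?hx ?hy. Qed.

Lemma unit_vec_bar l : unit_vec (bar l) = - unit_vec l :> V.
Proof. by rewrite /unit_vec /=; case: l.2; rewrite //= opprK. Qed.

Lemma half_diff l : 2^-1 *: (unit_vec l - unit_vec (bar l)) = unit_vec l :> V.
Proof.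
by rewrite unit_vec_bar opprK -mulr2n -scaler_nat scalerA mulVf ?scale1r // pnatr_eq0.
Qed.

Lemma root_scale_cases l l' : root_scale l l' = 1 :> R \/
  (root_scale l l' = 2^-1 :> R /\ l' = bar l).
Proof.
rewrite /root_scale; case: eqP => [e|_]; last by left; clear l l'; case: (t).
suff : (match t with TC => 2^-1 | _ => 1 end = 1 :> R) \/
  (match t with TC => 2^-1 | _ => 1 end = 2^-1 :> R) by tauto.
by move=> {l l' e}; case: (t); tauto.
Qed.

Lemma coroot_scale_cases l l' : coroot_scale l l' = 1 :> R \/
  (coroot_scale l l' = 2^-1 :> R /\ l' = bar l).
Proof.
rewrite /coroot_scale; case: eqP => [e|_]; last by left; clear l l'; case: (t).
suff : (match t with TB => 2^-1 | _ => 1 end = 1 :> R) \/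
  (match t with TB => 2^-1 | _ => 1 end = 2^-1 :> R) by tauto.
by move=> {l l' e}; case: (t); tauto.
Qed.

Lemma int_vec_lroot l l' : int_vec (lroot l l').
Proof.
rewrite /lroot; case: (root_scale_cases l l') => [->|[-> ->]].
  by rewrite scale1r; apply: int_vecB; exact: int_vec_unit.
by rewrite half_diff; exact: int_vec_unit.
Qed.

(** An explicit lattice containing the coroot lattice (and equal to it inside the
    apartment).  It is used to show that points are not W^a-conjugate. *)
Definition lattice x := int_vec x /\ (t = TC -> csum x / 2 \is a Num.int).

Lemma latticeD x y : lattice x -> lattice y -> lattice (x + y).
Proof.
move=> [hx hx'] [hy hy']; split; first exact: int_vecD.
by move=> tC; rewrite csumD mulrDl rpredD ?hx' ?hy'.
Qed.
Lemma latticeZ r x : r \is a Num.int -> lattice x -> lattice (r *: x).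
Proof.
move=> hr [hx hx']; split; first exact: int_vecZ.
by move=> tC; rewrite csumZ -mulrA rpredM ?hx'.
Qed.
Lemma latticeN x : lattice x -> lattice (- x).
Proof. by rewrite -scaleN1r; apply: latticeZ; rewrite rpredN rpred1. Qed.
Lemma latticeB x y : lattice x -> lattice y -> lattice (x - y).
Proof. by move=> hx hy; apply: latticeD => //; exact: latticeN. Qed.
Lemma lattice0 : lattice 0.
Proof. by rewrite -(scale0r 0); apply: latticeZ; rewrite ?rpred0 //; split => [j|]; rewrite
  ?csum0 ?mxE ?mul0r rpred0. Qed.

Lemma lattice_lcoroot l l' : lattice (lcoroot l l').
Proof.
split.
  rewrite /lcoroot; case: (coroot_scale_cases l l') => [->|[-> ->]].
    by rewrite scale1r; apply: int_vecB; exact: int_vec_unit.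
  by rewrite half_diff; exact: int_vec_unit.
move=> tC; have -> : lcoroot l l' = unit_vec l - unit_vec l' :> V.
  rewrite -[RHS]scale1r /lcoroot; congr (_ *: _); rewrite /coroot_scale.
  by move: (l' == _) => b; clear l l'; case: (t) tC.
rewrite csumB !csum_unit /letter_sign; case: l.2; case: l'.2.
- by rewrite (_ : _ / _ = 0) ?rpred0 //; ring.
- by rewrite (_ : _ / _ = -1) ?rpredN ?rpred1 //; field.
- by rewrite (_ : _ / _ = 1) ?rpred1 //; field.
- by rewrite (_ : _ / _ = 0) ?rpred0 //; ring.
Qed.

Lemma lattice_check (a : V) : roots a -> lattice (check a).
Proof. by move=> /roots_lroot[l [l' [lp ->]]]; rewrite check_lroot //; exact: lattice_lcoroot.
  Qed.

Lemma lattice_dot (a : V) x : roots a -> lattice x -> dot a x \is a Num.int.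
Proof.
by move=> /roots_lroot[l [l' [lp ->]]] [hx _]; apply: int_vec_dot => //; exact: int_vec_lroot.
Qed.

Lemma lattice_coweight x : apartment x -> lattice x -> coweight x.
Proof. by move=> hx hl; split => // a ha; exact: lattice_dot. Qed.

(** A reflection of the affine Weyl group subtracts from a lattice vector
    an integral multiple of a coroot. *)
Lemma affine_lattice (w : V -> V) : affine_weyl w -> lattice (w 0).
Proof.
elim=> [|s v [a [m [ha ->]]] _ ih] /=; first exact: lattice0.
apply: latticeB => //; apply: latticeZ; last exact: lattice_check.
by rewrite rpredD ?intr_int ?lattice_dot.
Qed.

Lemma affine_coweight0 (w : V -> V) : affine_weyl w -> coweight (w 0).
Proof.
move=> hw; apply: lattice_coweight; last exact: affine_lattice.
exact: (apartment_affine hw apartment0).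
Qed.

(** The linear part of a reflection is the reflection in the parallel mirror
    through the origin. *)
Lemma affine_linear (w : V -> V) : affine_weyl w ->
  exists2 u, weyl u & forall x, w x = u x + w 0.
Proof.
elim=> [|s v [a [m [ha ->]]] _ [u hu vu]] /=.
  by exists id; [exact: gen_id|move=> x; rewrite addr0].
exists (refl a 0 \o u); first by apply: gen_comp => //; exists a.
move=> x /=; rewrite vu !(refl0 a m).
have := reflL a (u x) (v 0) 1; rewrite !scale1r => ->.
exact: esym (addrA _ _ _).
Qed.

(** The extended affine Weyl group: its elements permute the walls, so they
    map faces to faces, but it also contains all translations by coweights. *)
Definition ext_affine (w : V -> V) :=
  exists u p, [/\ weyl u, coweight p & forall x, w x = u x + p].

Lemma affine_ext_affine (w : V -> V) : affine_weyl w -> ext_affine w.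
Proof.
by move=> hw; have [u hu h] := affine_linear hw; exists u, (w 0); split=> //; exact:
  affine_coweight0.
Qed.

Lemma ext_affine_translation p : coweight p -> ext_affine (fun x => p + x).
Proof. by move=> hp; exists id, p; split=> //; [exact: gen_id|move=> x; rewrite addrC]. Qed.

Lemma weyl_apartment (u : V -> V) x : weyl u -> apartment x -> apartment (u x).
Proof. by move=> hu; apply/apartment_affine/weyl_affine. Qed.

Lemma weyl_coweight (u : V -> V) p : weyl u -> coweight p -> coweight (u p).
Proof.
move=> hu [hp hp']; split; first exact: weyl_apartment.
by move=> a ha; have [b hb ->] := weyl_roots hu ha; exact: hp'.
Qed.

Lemma ext_affine_inv (w : V -> V) : ext_affine w -> exists w',
  [/\ ext_affine w', cancel w w' & cancel w' w].
Proof.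
move=> [u [p [hu hp h]]]; have [u' [hu' uu' u'u]] := weyl_inv hu.
exists (fun x => u' x - u' p); split.
- exists u', (- u' p); split=> //; exact/coweightN/weyl_coweight.
- by move=> x; rewrite h weylD // uu' addrK.
- by move=> x; rewrite h weylB // !u'u subrK.
Qed.

Lemma ext_affine_apartment (w : V -> V) x : ext_affine w -> apartment x -> apartment (w x).
Proof. by move=> [u [p [hu [hp _] h]]] hx; rewrite h; apply: apartmentD => //; exact:
  weyl_apartment. Qed.

Lemma ext_affine_coweight (w : V -> V) x : ext_affine w -> coweight x -> coweight (w x).
Proof. by move=> [u [p [hu hp h]]] hx; rewrite h; apply: coweightD => //; exact: weyl_coweight.
  Qed.

Lemma ext_affine_dot (w : V -> V) (a : V) (m : int) : ext_affine w -> roots a ->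
  exists b (m' : int), roots b /\ forall x, dot a (w x) + m%:~R = dot b x + m'%:~R.
Proof.
move=> [u [p [hu [hp hp'] h]]] ha; have [b hb hab] := weyl_roots hu ha.
have /intrP[k hk] := hp' _ ha.
exists b, (k + m); split=> // x.
by rewrite h dotDr hab hk intrD addrA.
Qed.

Lemma face_ext_sub (w : V -> V) x y : ext_affine w -> face_at x y -> face_at (w x) (w y).
Proof.
move=> hw [hy hxy]; split; first exact: ext_affine_apartment.
by move=> a m ha; have [b [m' [hb hab]]] := ext_affine_dot m hw ha; rewrite !hab; exact: hxy.
Qed.

Lemma face_ext (w : V -> V) x : ext_affine w -> face_at (w x) = w @` face_at x.
Proof.
move=> hw; have [w' [hw' ww' w'w]] := ext_affine_inv hw.
apply/seteqP; split => [y hy|_ [y hy <-]]; last exact: face_ext_sub.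
exists (w' y) => //; rewrite -(ww' x); exact: face_ext_sub.
Qed.

Lemma face_refl x : apartment x -> face_at x x.
Proof. by split. Qed.

Lemma is_face_ext (w : V -> V) F : ext_affine w -> is_face F -> is_face (w @` F).
Proof.
by move=> hw [x hx ->]; exists (w x); [exact: ext_affine_apartment|rewrite face_ext].
Qed.

Lemma has_dim_point x : has_dim [set x] 0.
Proof.
exists 0%VS; split; first exact: dimv0.
  by move=> y z -> ->; rewrite subrr mem0v.
by move=> U' _; exact: sub0v.
Qed.

Lemma is_vertexP x : is_vertex x <-> apartment x /\ forall y, face_at x y -> y = x.
Proof.
split.
  move=> [[z hz e] _]; have xz : z = x.
    by have : [set x] z by rewrite e; exact: face_refl.
  by subst z; split => // y; rewrite -e.
move=> [hx h]; split; last exact: has_dim_point.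
exists x => //; apply/seteqP; split => [_ ->|y /h//]; exact: face_refl.
Qed.

Lemma is_vertex_ext (w : V -> V) x : ext_affine w -> is_vertex x -> is_vertex (w x).
Proof.
move=> hw /is_vertexP[hx h]; apply/is_vertexP; split; first exact: ext_affine_apartment.
by move=> y; rewrite face_ext // => -[z /h -> ->].
Qed.

Lemma special_ext (w : V -> V) x : ext_affine w -> special x -> special (w x).
Proof.
move=> hw [hx h]; split; first exact: is_vertex_ext.
move=> a ha; have [b [m [hb hab]]] := ext_affine_dot 0 hw ha.
have [k hk] := h b hb; exists (k - m); move: (hab x).
by rewrite addr0 => ->; rewrite intrB addrACA subrr addr0.
Qed.

Lemma special_coweight x : special x -> coweight x.
Proof.
move=> [/is_vertexP[hx _] h]; split => // a ha; have [m hm] := h a ha.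
by rewrite (_ : dot a x = - m%:~R) ?rpredN ?intr_int //; apply/eqP; rewrite -addr_eq0 hm.
Qed.

End Affine.

(** * Faces, their types and conjugacy *)

Section Typing.
Context {R : realType} {t : cartan_type} {n : nat}.
Notation V := 'rV[R]_(amb t n).
Notation L := (letter t n).
Implicit Types (x y v : V) (k l : L).

(** Rationality makes the distances of the points of a W^a-orbit to a rational
    point discrete; see [to_alcove]. *)
Definition rational x := exists2 M : nat, (0 < M)%N & int_vec (M%:R *: x).

Lemma rationalD x y : rational x -> rational y -> rational (x + y).
Proof.
move=> [M M0 hx] [K K0 hy]; exists (M * K)%N; first by rewrite muln_gt0 M0.
rewrite scalerDr natrM -[in X in _ + X]scalerA mulrC -scalerA.
by apply: int_vecD; apply: int_vecZ => //; exact: natr_int.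
Qed.

Lemma rationalZ r x : r \is a Num.int -> rational x -> rational (r *: x).
Proof.
move=> hr [M M0 hx]; exists M => //.
by rewrite scalerA mulrC -scalerA; exact: int_vecZ.
Qed.

Lemma rationalV m x : (0 < m)%N -> rational x -> rational (m%:R^-1 *: x).
Proof.
move=> m0 [M M0 hx]; exists (M * m)%N; first by rewrite muln_gt0 M0.
by rewrite scalerA natrM mulfK // pnatr_eq0 -lt0n.
Qed.

(** A rational point in the interior of the fundamental alcove; decreasing
    coordinates between 0 and 1/4 make all positive roots take values in ]0, 1[. *)
Definition base_point : V :=
  \row_j (((amb t n) - j)%:R / (4 * (amb t n))%:R).

Lemma base_point_itv j : 0 < base_point 0 j <= 1 / 4.
Proof.
rewrite mxE; have := ltn_ord j; move: (amb t n) (j : nat) => m k km.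
have m0 : (0 : R) < (4 * m)%:R by rewrite ltr0n; lia.
rewrite divr_gt0 //= ?ltr0n ?subn_gt0 // ler_pdivrMr //.
have -> : 1 / 4 * (4 * m)%:R = m%:R :> R by rewrite natrM; field.
by rewrite ler_nat; lia.
Qed.

Lemma base_point_lt (j k : 'I_(amb t n)) : (j < k)%N -> base_point 0 k < base_point 0 j.
Proof.
rewrite !mxE; have := ltn_ord k; move: (amb t n) (j : nat) (k : nat) => m i i' im ii'.
have m0 : (0 : R) < (4 * m)%:R by rewrite ltr0n; lia.
by rewrite ltr_pM2r ?invr_gt0 // ltr_nat; lia.
Qed.

Lemma base_point_rational : rational base_point.
Proof.
case: (posnP (amb t n)) => m0; first by exists 1%N => // j; have := ltn_ord j; rewrite {2}m0.
exists (4 * amb t n)%N => [|j]; first by rewrite muln_gt0.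
by rewrite !mxE mulrC divfK ?natr_int // pnatr_eq0 muln_eq0 /= -lt0n.
Qed.

Lemma base_point_root (a : V) : pos_roots a -> 0 < dot a base_point < 1.
Proof.
move=> /pos_rootsP[j [k [b [-> jk bA]]]]; rewrite dot_lroot /coord /=.
have hj := base_point_itv j; have hk := base_point_itv k.
have c : root_scale (j, false) (k, b) = 1 :> R \/ root_scale (j, false) (k, b) = 2^-1 :> R.
  by case: (root_scale_cases (R := R) (j, false) (k, b)) => [|[]]; tauto.
have hjk : ~~ b -> base_point 0 k < base_point 0 j.
  by case: b jk {bA c} => // + _; rewrite orbF; exact: base_point_lt.
move: (base_point 0 j) (base_point 0 k) hj hk hjk => u v hj hk hjk.
by case: b hjk c {jk bA} => hjk [->|->]; try have {}hjk := hjk isT; lra.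
Qed.

Definition dist2 x : R := dot (x - base_point) (x - base_point).

(** If p is the base point, the reflection changes the square of the distance by
    4 (a x + m) (a p + m) / (a, a). *)
Lemma dist2_refl (a : V) m x : roots a ->
  dot a x + m%:~R < 0 < dot a base_point + m%:~R -> dist2 (refl a m x) < dist2 x.
Proof.
move=> ha /andP[h1 h2]; rewrite /dist2 /refl.
have a0 := root_neq0 ha.
have a1 : 0 < dot a a.
  by rewrite lt_neqAle eq_sym a0 /=; apply: sumr_ge0 => j _; rewrite -expr2 sqr_ge0.
rewrite /check scalerA; set c := dot a x + _ in h1 *; set d := dot a base_point + _ in h2.
have E (z : V) r : dot (z - r *: a) (z - r *: a) = dot z z - 2 * r * dot a z + r ^+ 2 * dot a a.
  by rewrite !dotBl !dotBr !dotZl !dotZr (dotC z a); ring.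
rewrite addrAC E (dotBr a x).
have -> : dot a x = c - m%:~R by rewrite /c; ring.
have -> : dot a base_point = d - m%:~R by rewrite /d; ring.
rewrite -subr_gt0; set q := dot a a in a0 a1 *.
rewrite (_ : _ - _ = (- c) * d * (4 / q)); last by field.
by rewrite !mulr_gt0 ?oppr_gt0 ?invr_gt0 // ?ltr0n.
Qed.

Lemma int_vec_refl (a : V) m x M : roots a -> int_vec (M%:R *: x) -> int_vec (M%:R *: refl a m x).
Proof.
move=> ha hx; rewrite /refl scalerBr scalerA; apply: int_vecB => //.
apply: int_vecZ; last by have [] := lattice_check ha.
rewrite mulrDr -dotZr rpredD ?rpredM ?natr_int ?intr_int //.
by move: ha => /roots_lroot[l [l' [lp ->]]]; apply: int_vec_dot => //; exact: int_vec_lroot.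
Qed.

(** Of the points conjugate to x, one at minimal distance from the base
    point is in the alcove, since otherwise some wall of the alcove separates it
    from the base point and the reflection in this wall brings it closer.  The
    minimum exists: with a common denominator D, the integer D^2 times the square
    of the distance decreases. *)
Lemma to_alcove x : apartment x -> rational x -> exists2 w, affine_weyl w & alcove (w x).
Proof.
move=> hx [M M0 hM]; have [K K0 hK] := base_point_rational.
have {hM} hM : int_vec ((M * K)%:R *: x).
  by rewrite natrM mulrC -scalerA; apply: int_vecZ; rewrite ?natr_int.
have {hK} hK : int_vec ((M * K)%:R *: base_point).
  by rewrite natrM -scalerA; apply: int_vecZ; rewrite ?natr_int.
have {M0 K0} D0 : (0 < M * K)%N by rewrite muln_gt0 M0.
move: (M * K)%N D0 hM hK => D D0 hM hK.
have D2 : (0 : R) < D%:R ^+ 2 by rewrite exprn_gt0 // ltr0n.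
have hnat y : int_vec (D%:R *: y) -> exists k : nat, D%:R ^+ 2 * dist2 y = k%:R.
  move=> hy; apply/natrP; rewrite natrEint; apply/andP; split.
    rewrite /dist2 expr2 -mulrA -dotZl -dotZr scalerBr.
    by apply: int_vec_dot; exact: int_vecB.
  apply: mulr_ge0; first exact: ltW.
  by apply: sumr_ge0 => j _; rewrite -expr2 sqr_ge0.
have [k hk] := hnat x hM.
elim/ltn_ind: k x hx hM hk => k ih x hx hM hk.
have [hal|hal] := pselect (alcove x); first by exists id => //; exact: gen_id.
(* a wall of the alcove separating x from the base point *)
have [a [m [ha h]]] : exists a (m : int), roots a /\ dot a x + m%:~R < 0 < dot a base_point +
  m%:~R.
  apply: contrapT => hn; apply: hal; split=> // a ha.
  have hr : roots a by left.
  have /andP[h0 h1] := base_point_root ha.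
  rewrite !leNgt; apply/andP; split; apply/negP => h.
    by apply: hn; exists a, 0; rewrite !addr0 h.
  apply: hn; exists (- a), 1; split; first exact: roots_opp.
  by rewrite !dotNl; apply/andP; split; lra.
have hM' := int_vec_refl m ha hM; have [k' hk'] := hnat _ hM'.
have kk' : (k' < k)%N.
  by rewrite -(ltr_nat R) -hk -hk' ltr_pM2l //; exact: dist2_refl.
have [w hw hw'] := ih k' kk' _ (apartment_refl m ha hx) hM' hk'.
exists (w \o refl a m) => //; apply: generated_comp => //; apply: generated1.
by exists a, m.
Qed.

Lemma alcove_face x : alcove x -> face_at x `<=` @alcove R t n.
Proof.
move=> [hx h] y [hy hxy]; split=> // a ha; have /andP[h0 h1] := h a ha.
have hr : roots a by left.
apply/andP; split.
  by have := hxy a 0 hr; rewrite !addr0; exact.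
have := hxy (- a) 1 (roots_opp hr); rewrite !dotNl; lra.
Qed.

Definition typed (F : set V) := exists D, face_type F D.
Definition conjugate (F H : set V) := exists2 w, affine_weyl w & w @` F = H.

Lemma typed_face x : apartment x -> rational x -> typed (face_at x).
Proof.
move=> hx /(to_alcove hx)[w hw hwx]; exists (face_at (w x)); split.
- by exists (w x) => //; exact: apartment_affine.
- exact: alcove_face.
- by exists w => //; rewrite face_ext //; exact: affine_ext_affine.
Qed.

Lemma conjugate_refl F : conjugate F F.
Proof. by exists id; [exact: gen_id|exact: image_id]. Qed.

Lemma conjugate_sym F H : conjugate F H -> conjugate H F.
Proof.
move=> [w hw <-]; have [w' [hw' ww' _]] := affine_inv hw.
exists w' => //; rewrite image_comp; apply/seteqP; split.
  by move=> _ [x hx <-] /=; rewrite ww'.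
by move=> x hx; exists x => //=; rewrite ww'.
Qed.

Lemma conjugate_trans F H K : conjugate F H -> conjugate H K -> conjugate F K.
Proof.
move=> [w hw <-] [w' hw' <-]; exists (w' \o w); first exact: generated_comp.
by rewrite image_comp.
Qed.

(** Faces with a common type are conjugate through it; conversely a type of a
    face is a type of all faces conjugate to it. *)
Lemma same_face_type F H :
  (exists D, face_type F D /\ face_type H D) <-> typed H /\ conjugate F H.
Proof.
split=> [[D [hF hH]]|[[D hD] hFH]].
  split; first by exists D.
  case: hF => _ _ hF; case: hH => _ _ hH.
  exact: (conjugate_trans hF (conjugate_sym hH)).
exists D; split => //; case: hD => h1 h2 h3; split => //.
exact: (conjugate_trans hFH h3).
Qed.

(** Conjugation by the translation by a coweight maps a wall to a parallel
    wall, so it preserves W^a. *)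
Lemma translation_weyl (p : V) (w : V -> V) : coweight p -> affine_weyl w ->
  affine_weyl (fun x => - p + w (p + x)).
Proof.
move=> [_ hp]; elim=> [|s v [a [m [ha ->]]] _ ih].
  rewrite (_ : (fun _ => _) = id); first exact: gen_id.
  by apply/funext => x; rewrite addKr.
have /intrP[k hk] := hp a ha.
rewrite (_ : (fun _ => _) = refl a (m + k) \o (fun x => - p + v (p + x))).
  by apply: gen_comp => //; exists a, (m + k).
apply/funext => x /=; rewrite /refl addrA; congr (_ - _ *: _).
by rewrite dotDr dotNr hk intrD; ring.
Qed.

(** If u is the linear part of w, then u composed with the map
    x |-> - p + w^-1 (p + x) is this translation. *)
Lemma translation_diff (p : V) (w : V -> V) : coweight p -> affine_weyl w ->
  affine_weyl (fun x => (p - w p) + x).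
Proof.
move=> hp hw; have [w' [hw' ww' w'w]] := affine_inv hw.
have [u hu uE] := affine_linear hw.
have h1 := generated_comp (weyl_affine hu) (translation_weyl hp hw').
rewrite (_ : (fun _ => _) = u \o (fun x => - p + w' (p + x))) //.
apply/funext => x /=; rewrite (weylD _ _ hu) (weylN _ hu) (uE p).
have : w (w' (p + x)) = p + x by rewrite w'w.
rewrite uE => /(canRL (addrK _)) ->.
by apply/rowP => j; rewrite !mxE; ring.
Qed.

(** Congruence of coweights modulo the coroot lattice, in the form used below:
    the translations between p and q belong to W^a. *)
Definition congr_lat (p q : V) := [/\ coweight p, coweight q,
  affine_weyl (fun x => (p - q) + x) & affine_weyl (fun x => (q - p) + x)].

Lemma congr_lat_conj p q : coweight p -> conjugate [set p] [set q] -> congr_lat p q.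
Proof.
move=> hp [w hw]; rewrite image_set1 => e.
have {e} e : w p = q by have : [set q] (w p) by rewrite -e.
have hq : coweight q by rewrite -e; exact: (ext_affine_coweight (affine_ext_affine hw)).
have [w' [hw' ww' w'w]] := affine_inv hw.
have e' : w' q = p by rewrite -e ww'.
by split => //; [rewrite -e|rewrite -e']; exact: translation_diff.
Qed.

Lemma congr_latC p q : congr_lat p q -> congr_lat q p.
Proof. by case. Qed.

Lemma congr_latN p q : congr_lat p q -> congr_lat (- p) (- q).
Proof.
move=> [hp hq h1 h2]; split; rewrite ?opprK; [exact: coweightN..| |].
  by rewrite addrC.
by rewrite addrC.
Qed.

Lemma shiftE v (F : set V) : shift v F = (fun x => v + x) @` F.
Proof. by []. Qed.

Lemma shift_shift v v' (F : set V) : shift v (shift v' F) = shift (v + v') F.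
Proof.
rewrite !shiftE image_comp; congr (_ @` _).
by apply/funext => x /=; rewrite addrA.
Qed.
Lemma shift0 (F : set V) : shift 0 F = F.
Proof. by rewrite shiftE -[RHS]image_id; congr (_ @` _); apply/funext => x; rewrite add0r. Qed.
Lemma shift1 v y : shift v [set y] = [set v + y].
Proof. by rewrite shiftE image_set1. Qed.

(** Translated by p, the conjugating element is still in W^a, and p and q
    differ by a translation in W^a. *)
Lemma conjugate_shift p q (F H : set V) : congr_lat p q -> conjugate F H -> conjugate
  (shift p F) (shift q H).
Proof.
move=> [hp hq _ hqp] [w hw <-].
exists ((fun x => (q - p) + x) \o (fun x => p + w (- p + x))).
  apply: generated_comp => //; have := translation_weyl (coweightN hp) hw.
  by rewrite opprK.
rewrite !shiftE !image_comp; congr (_ @` _); apply/funext => x /=.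
by rewrite addKr addrA subrK.
Qed.

Lemma has_dim_shift v (F : set V) d : has_dim F d -> has_dim (shift v F) d.
Proof.
have E (x y : V) : (v + x) - (v + y) = x - y by apply/rowP => j; rewrite !mxE; ring.
move=> [U [dU hU hmin]]; exists U; split=> //.
  by move=> _ _ [x hx <-] [y hy <-]; rewrite E; exact: hU.
move=> U' hU'; apply: hmin => x y hx hy; rewrite -(E x y).
by apply: hU'; [exists x|exists y].
Qed.

Lemma is_edge_shift p (E : set V) : coweight p -> is_edge E -> is_edge (shift p E).
Proof.
move=> hp [hE hd]; split; last exact: has_dim_shift.
exact/is_face_ext/hE/ext_affine_translation.
Qed.

Lemma is_vertex_shift p x : coweight p -> is_vertex x -> is_vertex (p + x).
Proof. by move=> hp; exact: (is_vertex_ext (ext_affine_translation hp)). Qed.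

Lemma has_dim_segment (x v : V) (r1 r2 : R) : v != 0 -> r1 < r2 ->
  has_dim [set x + s *: v | s in [set s : R | r1 <= s <= r2]] 1.
Proof.
move=> v0 r12; exists <[v]>%VS; split; first by rewrite dim_vline v0.
  move=> _ _ [s _ <-] [s' _ <-]; rewrite (_ : _ - _ = (s - s') *: v) ?memvZ ?memv_line //.
  by apply/rowP => j; rewrite !mxE; ring.
move=> U' hU'; rewrite -memvE.
have : (x + r2 *: v) - (x + r1 *: v) \in U'.
  by apply: hU'; [exists r2|exists r1] => //=; rewrite lexx ltW.
rewrite (_ : _ - _ = (r2 - r1) *: v); last by apply/rowP => j; rewrite !mxE; ring.
move=> h; have r0 : r2 - r1 != 0 by rewrite subr_eq0 gt_eqF.
by rewrite -(scalerK r0 v) memvZ.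
Qed.

End Typing.

(** * Orbits of fundamental coweights as sets of letters *)

Section Weights.
Context {R : realType} {t : cartan_type} {n : nat}.
Notation V := 'rV[R]_(amb t n).
Notation L := (letter t n).
Implicit Types (x y v : V) (k l : L) (S C : {set L}) (i : 'I_n).

Definition in_alphabet S := forall l, l \in S -> alphabet l.
(** The sets of letters whose weights form the W-orbit of the i-th fundamental
    coweight. *)
Definition weight_set i S :=
  [/\ in_alphabet S, (forall l, l \in S -> bar l \notin S) & #|S| = i.+1].
Definition weight i S : V := weight_coef R t i *: \sum_(l in S) eps R l.
(** What the projection to vectors of sum 0 subtracts from each coordinate of a
    unit vector in type A. *)
Definition mean : R := if t is TA then (amb t n)%:R^-1 else 0.
(** Up to the factor and the constant in [coord_weight], the coordinate along
    l of the weight of S. *)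
Definition signed_ind S l : R := (l \in S)%:R - (bar l \in S)%:R.

Lemma eps_unit l : alphabet l -> eps R l = unit_vec l - mean *: const_mx 1.
Proof.
rewrite /eps /unit_vec /mean /eps0 /alphabet; case: t l => l /=; last 2 first.
- by rewrite scale0r subr0.
- by rewrite scale0r subr0.
move/negPf ->; congr (_ - _).
by apply/rowP => j; rewrite !mxE mulr1.
Qed.

Lemma sum_indicator S l : \sum_(m in S) (m == l)%:R = (l \in S)%:R :> R.
Proof.
have [lS|lS] := boolP (l \in S).
  by rewrite (bigD1 l) //= eqxx big1 ?addr0 // => m /andP[_ /negPf ->].
by rewrite big1 // => m mS; case: eqP => // e; rewrite -e mS in lS.
Qed.

Lemma coord_weight i S l : alphabet l -> in_alphabet S ->
  coord (weight i S) l = weight_coef R t i * (signed_ind S l - mean * #|S|%:R).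
Proof.
move=> hl hS; rewrite coordZ coord_sum; congr (_ * _).
rewrite (eq_bigr (fun m => (m == l)%:R - (m == bar l)%:R - mean)) => [|m mS].
  by rewrite !sumrB !sum_indicator sumr_const mulr_natr.
rewrite eps_unit ?hS // coordB coordZ coord_unit; congr (_ - _).
rewrite /coord mxE; move: hl; rewrite /mean /alphabet; clear; case: (t) l => l /=.
- by move/negPf ->; rewrite mulr1.
- by rewrite mul0r.
- by rewrite mul0r.
Qed.

Lemma dot_weight i S l l' : letter_pair l l' -> in_alphabet S ->
  dot (lroot l l') (weight i S) = root_scale l l' * (weight_coef R t i *
    (signed_ind S l - signed_ind S l')).
Proof. by move=> [hl hl' _] hS; rewrite dot_lroot !coord_weight //; ring. Qed.

Lemma card_letter_preim (s : L -> L) S : injective s -> #|[set k | s k \in S]%SET| = #|S|.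
Proof. by move=> s1; exact: (on_card_preimset (R := mem S) (onW_bij _ (injF_bij s1))). Qed.

Lemma weight_action i (u : V -> V) s S : letter_action u s -> in_alphabet S ->
  u (weight i S) = weight i [set k | s k \in S]%SET.
Proof.
move=> [s1 s2 s3 s4] hS; apply: coord_ext => l hl.
rewrite s4 !coord_weight ?s3 //; last by move=> k; rewrite inE => /hS; rewrite s3.
rewrite /signed_ind !inE s2; congr (_ * (_ - _ * _%:R)).
by rewrite card_letter_preim.
Qed.

Lemma weight_set_action i (u : V -> V) s S : letter_action u s -> weight_set i S ->
  weight_set i [set k | s k \in S]%SET.
Proof.
move=> [s1 s2 s3 s4] [h1 h2 h3]; split.
- by move=> k; rewrite inE => /h1; rewrite s3.
- by move=> k; rewrite !inE s2 => /h2.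
- by rewrite card_letter_preim.
Qed.

Definition base_letters i : {set L} := [set l : L | ~~ l.2 && (l.1 <= i)%N]%SET.

Lemma amb_ge : (n <= amb t n)%N.
Proof. by rewrite /amb; case: t. Qed.

Lemma base_lettersE i : base_letters i = [set (j, false) | j : 'I_(amb t n) & (j <= i)%N]%SET.
Proof.
apply/setP => -[j b]; rewrite inE /=; apply/idP/imsetP => [/andP[/negPf -> ji]|[k]].
  by exists j; rewrite ?inE.
by rewrite inE => ki [-> ->].
Qed.

Lemma pair_false_inj : injective (fun j : 'I_(amb t n) => (j, false) : L).
Proof. by move=> j k []. Qed.

Lemma card_base_letters i : #|base_letters i| = i.+1.
Proof.
rewrite base_lettersE card_imset; last exact: pair_false_inj.
have h : (i.+1 <= amb t n)%N by apply: leq_trans amb_ge.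
have inj : injective (widen_ord h) by move=> j k /(congr1 val) /= /val_inj.
rewrite -(card_ord i.+1) -(card_imset _ inj).
apply: eq_card => j; rewrite !inE; apply/idP/imsetP => [ji|[k _ ->] /=].
  by exists (Ordinal (ji : (j < i.+1)%N)) => //; exact: val_inj.
by rewrite -ltnS.
Qed.

Lemma weight_set_base i : weight_set i (base_letters i).
Proof.
split; last exact: card_base_letters.
- by move=> [j b]; rewrite inE => /andP[/negPf /= -> _]; exact: alphabetF.
- by move=> [j b]; rewrite !inE /= => /andP[-> _].
Qed.

Lemma omega_weight i : omega R t i = weight i (base_letters i).
Proof.
rewrite /omega /weight; congr (_ *: _); rewrite base_lettersE.
rewrite big_imset /=; last by move=> j k _ _ [].
by apply: eq_bigl => j; rewrite inE.
Qed.

(** In types B and C the letters of S are those where the coordinate of its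
    weight is maximal, in type A those where it exceeds the minimum.  With opposite
    letters, i+1 letters would give too few nonzero coordinates. *)
Lemma weight_inj i S C : weight_set i S -> in_alphabet C -> #|C| = i.+1 -> weight i C = weight i
  S -> C = S.
Proof.
move=> [h1 h2 h3] hC cC e; apply/esym/eqP; rewrite eqEcard cC h3 leqnn andbT.
apply/fintype.subsetP => l lS; have := congr1 (fun x => coord x l) e.
have w0 : weight_coef R t i != 0.
  by rewrite /weight_coef; case: (i.+1 == n); case: (t); rewrite ?invr_eq0 ?pnatr_eq0 ?oner_eq0.
have hl := h1 l lS; rewrite !coord_weight // cC h3 => /(mulfI w0) /addIr.
rewrite /signed_ind lS (negPf (h2 _ lS)) subr0.
case: (l \in C) => //=; case: (bar l \in C) => /=; lra.
Qed.

Lemma weyl_weight i (u : V -> V) S : weyl u -> weight_set i S ->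
  exists2 S', weight_set i S' & u (weight i S) = weight i S'.
Proof.
move=> /weyl_action[s us] hS; exists [set k | s k \in S]%SET; first exact: weight_set_action us
  hS.
by apply: weight_action => //; case: hS.
Qed.

Lemma swap_set i l l' S : letter_pair l l' -> weight_set i S ->
  weight_set i [set k | swap l l' k \in S]%SET /\
  refl (lroot l l') 0 (weight i S) = weight i [set k | swap l l' k \in S]%SET.
Proof.
move=> lp hS; have us := swap_action (R := R) lp.
by split; [exact: weight_set_action us hS|apply: weight_action => //; case: hS].
Qed.

Lemma weyl_lroot l l' : letter_pair l l' -> weyl (refl (lroot l l') 0 : V -> V).
Proof. by move=> lp; apply: generated1; exists (lroot l l') => //; exact: lroot_roots. Qed.

(** By induction on the number of letters of S outside S': a reflection
    replaces one of them by a letter l' of S' missing in S.  If bar l' is in S,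
    it must be the letter replaced, since the reflection moves bar l' as well. *)
Lemma weyl_transitive i S S' : weight_set i S -> weight_set i S' ->
  exists2 u : V -> V, weyl u & u (weight i S) = weight i S'.
Proof.
move=> hS hS'; have [k] := ubnP #|S :\: S'|; elim: k S hS => // k ih S hS Sk.
have [h1 h2 h3] := hS; have [h1' h2' h3'] := hS'.
have [S'S|] := boolP (S' \subset S).
  exists id; first exact: gen_id.
  by congr weight; apply/esym/eqP; rewrite eqEcard S'S h3 h3' leqnn.
case/fintype.subsetPn => l' l'S' l'S.
(* the letter to be replaced by l' *)
have [l [lS lS' hbar]] : exists l, [/\ l \in S, l \notin S' & bar l' \in S -> l = bar l'].
  have [bS|bS] := boolP (bar l' \in S); first by exists (bar l'); rewrite bS h2'.
  have : ~~ (S \subset S').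
    apply/negP => SS'; move: l'S; have -> : S = S' by apply/eqP; rewrite eqEcard SS' h3 h3' leqnn.
    by rewrite l'S'.
  by case/fintype.subsetPn => l lS lS'; exists l; split.
have ll' : l != l' by apply/eqP => e; rewrite e l'S' in lS'.
have lp : letter_pair l l' by split; [exact: h1|exact: h1'|].
have [hv hw] := swap_set lp hS; set S1 := [set _ | _]%SET in hv hw.
have [u hu uw] : exists2 u : V -> V, weyl u & u (weight i S1) = weight i S'.
  rewrite ltnS in Sk; apply: ih => //; apply: leq_trans Sk.
  rewrite [in X in (_ < X)%N](cardsD1 l) inE lS lS' /= add1n ltnS.
  apply/subset_leq_card/fintype.subsetP => m; rewrite !inE => /andP[mS' mS1].
  have ml' : m != l' by apply/eqP => e; rewrite e l'S' in mS'.
  have ml : m != l.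
    apply/eqP => e; move: mS1; rewrite e /swap eqxx; exact/negP.
  rewrite ml mS' /=; move: mS1; rewrite /swap (negPf ml) (negPf ml').
  case: eqP => [e|_]; first by move/hbar => e'; rewrite e e' barK eqxx in ml'.
  case: eqP => [e|_] //; first by rewrite (negPf (h2 _ lS)).
exists (u \o refl (lroot l l') 0); first exact/generated_comp/weyl_lroot.
by rewrite /= hw.
Qed.

(** The number of steps of the gallery along omega_i; it is also the maximal
    value of a root on omega_i, hence 1 exactly in the minuscule case
    ([omega_bound], [root_dot_num_steps], [minusculeP]). *)
Definition num_steps i : nat :=
  match t with
  | TA => 1%N
  | TB => if i.+1 == n then 1%N else 2%N
  | TC => if i == 0 :> nat then 1%N else 2%N
  end.

Lemma num_steps12 i : num_steps i = 1%N \/ num_steps i = 2%N.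
Proof. by rewrite /num_steps; case: t; [left|case: ifP; [left|right]..]. Qed.

Lemma apartment_eps (l : L) : alphabet l -> apartment (eps R l).
Proof.
move=> hl; apply/apartmentE => tA; rewrite eps_unit // csumB csum_unit csumZ /letter_sign.
move: hl; rewrite alphabetA // => /negPf ->.
rewrite /csum (eq_bigr (fun=> 1)) => [|j _]; last by rewrite mxE.
rewrite sumr_const card_ord /mean; clear -tA; case: (t) tA => // _.
by rewrite mulVf ?subrr // pnatr_eq0.
Qed.

Lemma apartment_weight i S : in_alphabet S -> apartment (weight i S).
Proof.
move=> hS; apply: apartmentZ.
elim/big_ind: _ => [||l lS]; [exact: apartment0|exact: apartmentD|exact/apartment_eps/hS].
Qed.

End Weights.
Arguments num_steps t {n} i.
Arguments mean : clear implicits.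
Arguments base_letters {t n} i.

(** * Values of roots on fundamental coweights *)

Section Omega.
Context {R : realType} {t : cartan_type} {n : nat}.
Notation V := 'rV[R]_(amb t n).
Notation L := (letter t n).
Implicit Types (x y v : V) (k l : L) (S C : {set L}) (i : 'I_n).
Notation om i := (omega R t i).

Lemma typeP : [\/ t = TA, t = TB | t = TC].
Proof. by case: (t); [constructor 1|constructor 2|constructor 3]. Qed.

Lemma root_scaleNC l l' : t <> TC -> root_scale l l' = 1 :> R.
Proof. by move=> tC; rewrite /root_scale; move: (l' == _) => b; clear -tC; case: (t) tC. Qed.
Lemma root_scaleC l l' : t = TC -> root_scale l l' = (if l' == bar l then 2^-1 else 1) :> R.
Proof. by move=> tC; rewrite /root_scale; move: (l' == _) => b; clear -tC; case: (t) tC. Qed.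
Lemma weight_coefNB i : t <> TB -> weight_coef R t i = 1.
Proof. by rewrite /weight_coef; case: (t). Qed.
Lemma weight_coefB i : t = TB -> weight_coef R t i = if i.+1 == n then 2^-1 else 1.
Proof. by rewrite /weight_coef => ->. Qed.
Lemma num_stepsA i : t = TA -> num_steps t i = 1%N.
Proof. by rewrite /num_steps; case: (t). Qed.
Lemma num_stepsB i : t = TB -> num_steps t i = if i.+1 == n then 1%N else 2%N.
Proof. by rewrite /num_steps; case: (t). Qed.
Lemma num_stepsC i : t = TC -> num_steps t i = if i == 0 :> nat then 1%N else 2%N.
Proof. by rewrite /num_steps; case: (t). Qed.
Lemma meanA : t = TA -> mean R t n = n.+1%:R^-1 :> R.
Proof. by rewrite /mean; case: (t). Qed.
Lemma meanNA : t <> TA -> mean R t n = 0 :> R.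
Proof. by rewrite /mean; case: (t). Qed.
Lemma ambA : t = TA -> amb t n = n.+1.
Proof. by move=> ->. Qed.
Lemma ambNA : t <> TA -> amb t n = n.
Proof. by case: (t). Qed.

Lemma ord_ltNA (j : 'I_(amb t n)) : t <> TA -> (j < n)%N.
Proof. by move=> tA; have := ltn_ord j; move: (j : nat) => k; rewrite ambNA. Qed.

Lemma signed_ind_base i j b : signed_ind (base_letters i : {set L}) (j, b) =
  (if (j <= i)%N then (if b then -1 else 1) else 0) :> R.
Proof. by rewrite /signed_ind !inE /= negbK; case: (j <= i)%N; case: b => /=; lra. Qed.

Lemma in_alphabet_base_letters i : in_alphabet (base_letters i : {set L}).
Proof. by have [] := @weight_set_base t n i. Qed.

Lemma dot_om i l l' : letter_pair l l' ->
  dot (lroot l l') (om i) = root_scale l l' * (weight_coef R t i *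
    (signed_ind (base_letters i) l - signed_ind (base_letters i) l')).
Proof. by move=> lp; rewrite omega_weight dot_weight //; exact: in_alphabet_base_letters. Qed.

(** A root on omega_i is, up to scale, a difference of two coordinates in
    {-1, 0, 1} (or of two coordinates 1/2 or -1/2).  The extremal value 2 needs
    opposite coordinates at two letters and an unscaled root. *)
Lemma omega_bound i (a : V) : roots a ->
  exists k : int, dot a (om i) = k%:~R /\ (`|k| <= num_steps t i)%N.
Proof.
move=> /roots_lroot[l [l' [lp ->]]]; rewrite dot_om //; have [hl hl' ll'] := lp.
case: l l' lp hl hl' ll' => [j b] [j' b'] lp hl hl' ll'.
have nrm (k : int) (e : R) : e = k%:~R -> forall m, (`|k| <= m)%N -> exists k : int, e = k%:~R
  /\ (`|k| <= m)%N.
  by move=> -> m km; exists k.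
case: typeP => tt.
- rewrite root_scaleNC ?tt // weight_coefNB ?tt // num_stepsA // !mul1r.
  rewrite !signed_ind_base; move: hl hl'; rewrite !alphabetA //= => /negPf -> /negPf ->.
  case: (j <= i)%N; case: (j' <= i)%N; [apply: (nrm 0)|apply: (nrm 1)|apply: (nrm (-1))|apply:
    (nrm 0)] => //=; ring.
- rewrite root_scaleNC ?tt // weight_coefB // num_stepsB // mul1r !signed_ind_base.
  have ji : i.+1 = n -> ((j <= i)%N = true) * ((j' <= i)%N = true).
    by move=> e; have h := @ord_ltNA j; have h' := @ord_ltNA j'; have {}h := h
      ltac:(by rewrite tt); have {}h' := h' ltac:(by rewrite tt); split; lia.
  have [e|ne] := eqVneq i.+1 n.
    rewrite !ji //; case: b {lp hl ll'}; case: b' {hl'};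
      [apply: (nrm 0)|apply: (nrm (-1))|apply: (nrm 1)|apply: (nrm 0)] => //=; by field.
  rewrite mul1r; case: (j <= i)%N; case: (j' <= i)%N; case: b {lp hl ll'}; case: b' {hl'}; first
   [by apply: (nrm 0) => //=; ring | by apply: (nrm 1) => //=; ring| by apply: (nrm (-1)) =>
     //=; ring
   | by apply: (nrm 2) => //=; ring| by apply: (nrm (-2)) => //=; ring].
- rewrite root_scaleC // weight_coefNB ?tt // num_stepsC // mul1r !signed_ind_base.
  have [i0|i0] := eqVneq (i : nat) 0%N; last first.
    case: eqP => [[-> ->]|_].
      case: (j <= i)%N; case: b {lp hl hl' ll'} => /=; first
       [by apply: (nrm 0) => //=; field | by apply: (nrm 1) => //=; field| by apply: (nrm (-1))
         => //=; field].
    rewrite mul1r; case: (j <= i)%N; case: (j' <= i)%N; case: b {lp hl ll'}; case: b' {hl'};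
      first
     [by apply: (nrm 0) => //=; ring | by apply: (nrm 1) => //=; ring| by apply: (nrm (-1)) =>
       //=; ring
     | by apply: (nrm 2) => //=; ring| by apply: (nrm (-2)) => //=; ring].
  rewrite i0 !leqn0.
  case: eqP => [[-> ->]|nb].
    case: (_ == _); case: b {lp hl hl' ll'} => /=; first
     [by apply: (nrm 0) => //=; field | by apply: (nrm 1) => //=; field| by apply: (nrm (-1)) =>
       //=; field].
  have : ~~ (((j : nat) == 0%N) && ((j' : nat) == 0%N)).
    apply/negP => /andP[/eqP j0 /eqP j0'].
    have e : j' = j by apply: ord_inj; rewrite j0 j0'.
    by move: ll' nb; rewrite e /bar /= xpair_eqE eqxx /=; clear; case: b; case: b'.
  case: (_ == _); case: (_ == _) => //= _; case: b {lp hl ll' nb}; case: b' {hl'}; first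
     [by apply: (nrm 0) => //=; ring | by apply: (nrm 1) => //=; ring| by apply: (nrm (-1)) =>
       //=; ring].
Qed.

Lemma coweight_om i : coweight (om i).
Proof.
split; first by rewrite omega_weight; apply: apartment_weight; exact: in_alphabet_base_letters.
by move=> a /(omega_bound i)[k [-> _]]; exact: intr_int.
Qed.

Definition first_ord i : 'I_(amb t n) := widen_ord amb_ge
  (Ordinal (leq_ltn_trans (leq0n i) (ltn_ord i))).

(** The partner of the first letter is its bar, or an unbarred letter with
    zero (in type A: minimal) coordinate.  The explicit form is used in
    [line_of_roots]. *)
Lemma root_dot1_explicit i : exists l', [/\ letter_pair (first_ord i, false) l',
  dot (lroot (first_ord i, false) l' : V) (om i) = 1 &
  l' = (first_ord i, true) \/ (i < l'.1)%N && ~~ l'.2].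
Proof.
have i1 := ltn_ord i.
pose j0 := first_ord i; have j0E : (j0 : nat) = 0%N by [].
case: typeP => tt.
- have hn : (n < amb t n)%N by rewrite tt.
  have lp : letter_pair (j0, false) (Ordinal hn, false).
    split; [exact: alphabetF..|rewrite xpair_eqE andbT -val_eqE /= eq_sym; lia].
  exists (Ordinal hn, false); split => //; last by right; rewrite /= andbT; lia.
  rewrite dot_om // root_scaleNC ?tt // weight_coefNB ?tt // !signed_ind_base j0E /=.
  have -> : (n <= i)%N = false by lia.
  by ring.
- have [e|ne] := eqVneq i.+1 n.
    have lp : letter_pair (j0, false) (j0, true).
      by split; [exact: alphabetF|apply: alphabetNA; rewrite tt|rewrite xpair_eqE andbF].
exists (j0, true); split => //; last by left.
  rewrite dot_om // root_scaleNC ?tt // weight_coefB // e eqxx !signed_ind_base j0E /=.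
    by field.
  have hn : (i.+1 < amb t n)%N by rewrite ambNA ?tt // ltn_neqAle ne.
  have lp : letter_pair (j0, false) (Ordinal hn, false).
    by split; [exact: alphabetF..|rewrite xpair_eqE andbT -val_eqE].
exists (Ordinal hn, false); split => //; last by right; rewrite /= andbT; lia.
  rewrite dot_om // root_scaleNC ?tt // weight_coefB // (negPf ne) !signed_ind_base j0E /=.
  by rewrite ltnn; ring.
- have lp : letter_pair (j0, false) (j0, true).
    by split; [exact: alphabetF|apply: alphabetNA; rewrite tt|rewrite xpair_eqE andbF].
exists (j0, true); split => //; last by left.
  rewrite dot_om // root_scaleC // eqxx weight_coefNB ?tt // !signed_ind_base j0E /=.
  by field.
Qed.

Lemma root_dot1 i : exists2 a : V, roots a & dot a (om i) = 1.
Proof. by have [l' [lp h _]] := root_dot1_explicit i; exists (lroot (first_ord i, false) l') =>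
  //; exact: lroot_roots. Qed.

Lemma root_dot_num_steps i : exists2 a : V, roots a & dot a (om i) = (num_steps t i)%:R.
Proof.
have i1 := ltn_ord i.
pose j0 := first_ord i; have j0E : (j0 : nat) = 0%N by [].
have H (a : V) m : roots a -> dot a (om i) = m -> exists2 a : V, roots a & dot a (om i) = m by
  exists a.
have [m1|m2] := num_steps12 (t := t) i; first by rewrite m1; exact: root_dot1.
rewrite m2; have tA : t <> TA by move=> tA; move: m2; rewrite num_stepsA.
have [tB|tC] : t = TB \/ t = TC by case: typeP; tauto.
- have lp : letter_pair (j0, false) (j0, true).
    by split; [exact: alphabetF|apply: alphabetNA; rewrite tB|rewrite xpair_eqE andbF].
  apply: (H _ _ (lroot_roots lp)); move: m2; rewrite num_stepsB // dot_om // root_scaleNC ?tB //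
    weight_coefB //.
  by case: eqP => // _ _; rewrite !signed_ind_base j0E /=; ring.
- have hi : (0 < i)%N by move: m2; rewrite num_stepsC // lt0n; case: eqP.
  have hn : (1 < amb t n)%N by rewrite ambNA //; lia.
  have lp : letter_pair (j0, false) (Ordinal hn, true).
    by split; [exact: alphabetF|exact: alphabetNA|rewrite xpair_eqE andbF].
  have nb : (Ordinal hn, true) != bar (j0, false) :> L by rewrite xpair_eqE andbT -val_eqE.
  apply: (H _ _ (lroot_roots lp)); rewrite dot_om // root_scale_nbar // weight_coefNB ?tC //
    !signed_ind_base j0E /=.
  by rewrite hi; ring.
Qed.

(** With r the value at y of a root that is 1 at omega_i, the vector
    z = y - r omega_i is killed by that root and by all roots that vanish on
    omega_i; these force the first i+1 coordinates of z to be equal.  The other ones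
    vanish in types B and C; in type A they are equal to each other and, by the
    first root, to the first ones, so that all vanish because their sum does. *)
Lemma line_of_roots i (y : V) : apartment y ->
  (forall a : V, roots a -> dot a (om i) = 0 -> dot a y = 0) -> exists r, y = r *: om i.
Proof.
move=> hy hz; have [l' [lp a1o hl']] := root_dot1_explicit i.
move: (first_ord i) (erefl : (first_ord i : nat) = 0%N) lp a1o hl' => j0 j0E lp a1o hl'.
pose r := dot (lroot (j0, false) l') y.
exists r; apply/eqP; rewrite -subr_eq0; set z := y - _; apply/eqP.
have {}hy : apartment z.
  by apply: apartmentD => //; apply: apartmentN; apply: apartmentZ; case: (coweight_om i).
have E k k' : letter_pair k k' -> dot (lroot k k') z = 0 -> coord z k = coord z k'.
  move=> _; rewrite dot_lroot => /eqP; rewrite mulf_eq0 gt_eqF ?root_scale_gt0 //= subr_eq0.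
  by move/eqP.
have z1 : coord z (j0, false) = coord z l'.
  by apply: E => //; rewrite /z dotBr dotZr a1o /r; ring.
have z0 k k' : letter_pair k k' -> signed_ind (base_letters i) k = signed_ind (base_letters i)
  k' :> R -> coord z k = coord z k'.
  move=> kk' e; apply: E => //; have d0 : dot (lroot k k') (om i) = 0 by rewrite dot_om // e;
    ring.
  by rewrite /z dotBr dotZr d0 hz //; [ring|exact: lroot_roots].
have {}z0 (j j' : 'I_(amb t n)) : (j <= i)%N = (j' <= i)%N -> coord z (j, false) = coord z
  (j', false).
  move=> e; have [->//|jj'] := eqVneq j j'; apply: z0; last by rewrite !signed_ind_base e.
  by split; rewrite ?alphabetF // xpair_eqE andbT.
have zb (j : 'I_(amb t n)) : t <> TA -> (i < j)%N -> coord z (j, false) = 0.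
  move=> tA ij; have := E (j, false) (j, true).
  have lpj : letter_pair (j, false) (j, true : bool).
    by split; [exact: alphabetF|exact: alphabetNA|rewrite xpair_eqE andbF].
  have ji : (j <= i)%N = false by lia.
  have d0 : dot (lroot (j, false) (j, true)) (om i) = 0 by rewrite dot_om // !signed_ind_base
    ji; ring.
  move=> /(_ lpj); rewrite /z dotBr dotZr d0 hz //; last exact: lroot_roots.
  by rewrite mulr0 subr0 => /(_ erefl); rewrite /coord /=; lra.
clearbody z; have coordF j : coord z (j, false) = z 0 j by [].
have [tA|tA] := pselect (t = TA).
  case: hl' => [e|]; first by move: lp => []; rewrite e (alphabetA (j0, true)).
  move: z1; case: (l') => [m []] z1 /andP[/= im] // _.
  have zc j : z 0 j = z 0 m.
    rewrite -(coordF j) -(coordF m); have [ji|ij] := leqP j i; last by apply: z0; lia.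
    by rewrite -z1; apply: z0; rewrite ji j0E.
  move: hy => /apartmentE/(_ tA); rewrite /csum (eq_bigr (fun=> z 0 m)) //.
  rewrite sumr_const card_ord => /eqP; rewrite -mulr_natr mulf_eq0 pnatr_eq0 {2}ambA // orbF =>
    /eqP zm.
  by apply/rowP => j; rewrite zc zm mxE.
have z00 : coord z (j0, false) = 0.
  case: hl' => [e|]; first by move: z1; rewrite e /coord /=; lra.
  by rewrite z1; case: (l') => [m []] /andP[/= im] // _; exact: zb.
apply/rowP => j; rewrite mxE -coordF; have [ji|ij] := leqP j i; last exact: zb.
by rewrite -z00; apply: z0; rewrite ji j0E.
Qed.

Lemma half_not_int : (2^-1 : R) \isn't a Num.int.
Proof.
apply/negP => /intrP[m /(congr1 (fun q : R => q * 2))]; rewrite mulVf ?pnatr_eq0 //.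
have -> : (m%:~R * 2 : R) = (m * 2)%:~R by rewrite intrM.
by move=> /eqP; rewrite -[1]/(1%:~R) eqr_int; lia.
Qed.

(** Types A and B: a coordinate is not integral.  Type C: the sum of the
    coordinates is 1, which is odd. *)
Lemma minuscule_not_lattice i : num_steps t i = 1%N -> ~ lattice (om i).
Proof.
have i1 := ltn_ord i.
case: typeP => tt m1 [hint hC].
- have hn : (n < amb t n)%N by rewrite tt.
  have := hint (Ordinal hn); rewrite -[_ 0 _]/(coord (om i) (Ordinal hn, false)).
  rewrite omega_weight coord_weight; [|exact: alphabetF|exact: in_alphabet_base_letters].
  rewrite weight_coefNB ?tt // signed_ind_base /= card_base_letters meanA //.
  have -> : (n <= i)%N = false by lia.
  rewrite mul1r sub0r rpredN => /intrP[k /(congr1 (fun q : R => q * n.+1%:R))].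
  rewrite mulrAC mulVf ?pnatr_eq0 // mul1r.
  have -> : (k%:~R * n.+1%:R : R) = (k * n.+1%:Z)%:~R by rewrite intrM.
  move=> /eqP; rewrite -[_%:R]/((i.+1 : int)%:~R) eqr_int => /eqP; clear -i1; move: (i : nat) i1
    => p pn h.
  by have [k0|k1] := leP k 0; nia.
- have := hint (first_ord i); rewrite -[_ 0 _]/(coord (om i) (first_ord i, false)).
  rewrite omega_weight coord_weight; [|exact: alphabetF|exact: in_alphabet_base_letters].
  move: m1; rewrite num_stepsB // weight_coefB // signed_ind_base /= meanNA ?tt //.
  by case: eqP => // _ _; rewrite mul0r subr0 mulr1; apply/negP; exact: half_not_int.
- move: m1; rewrite num_stepsC //; case: eqP => // i0 _.
  have tA : t <> TA by rewrite tt.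
  have tB : t <> TB by rewrite tt.
  have := hC tt; rewrite omega_weight csumZ weight_coefNB // mul1r.
  have hb (l : L) : (l \in base_letters i) = (l == (first_ord i, false)).
    by case: l => j b; rewrite !inE /= i0 leqn0 xpair_eqE -val_eqE /= andbC eqbF_neg.
  rewrite (eq_bigl _ _ hb) big_pred1_eq eps_unit ?alphabetF // meanNA // scale0r subr0 csum_unit
    /letter_sign /=.
  by rewrite mul1r; apply/negP; exact: half_not_int.
Qed.

Lemma minusculeP i : minuscule (om i) <-> num_steps t i = 1%N.
Proof.
split=> [h|m1 a /(omega_bound i)[k [-> ]]].
  case: (num_steps12 (t := t) i) => // m2; have [a ha ae] := root_dot_num_steps i.
  by have := h _ ha; rewrite ae m2; case => [|[]] h'; exfalso; clear m2 ae; lra.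
rewrite m1 => km; have : k = 0 \/ k = 1 \/ k = -1 by lia.
by case=> [->|[->|->]]; [left|right; left|right; right].
Qed.

Lemma om_neq0 i : om i != 0.
Proof.
apply/eqP => e; have [a _] := root_dot1 i; rewrite e dot0r; lra.
Qed.

End Omega.

(** * Faces on the line through a fundamental coweight *)

Section Line.
Context {R : realType} {t : cartan_type} {n : nat}.
Notation V := 'rV[R]_(amb t n).
Notation L := (letter t n).
Implicit Types (x y v : V) (i : 'I_n).
Notation om i := (omega R t i).

(** One step of the gallery along omega_i: omega_i, or its half if omega_i is not
    minuscule. *)
Definition nu i : V := (num_steps t i)%:R^-1 *: om i.

Lemma num_steps_gt0 i : (0 : R) < (num_steps t i)%:R.
Proof. by rewrite ltr0n; case: (num_steps12 (t := t) i) => ->. Qed.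

Lemma nu_om i : (num_steps t i)%:R *: nu i = om i.
Proof. by rewrite /nu scalerA mulfV ?scale1r // gt_eqF // num_steps_gt0. Qed.

Lemma nu_neq0 i : nu i != 0.
Proof. by rewrite scaler_eq0 negb_or om_neq0 invr_eq0 gt_eqF // num_steps_gt0. Qed.

Lemma nu_inj i (r s : R) : r *: nu i = s *: nu i -> r = s.
Proof.
move/eqP; rewrite -subr_eq0 -scalerBl scaler_eq0 (negPf (nu_neq0 i)) orbF subr_eq0.
by move/eqP.
Qed.

Lemma apartment_nu i r : apartment (r *: nu i).
Proof. by do 2!apply: apartmentZ; case: (coweight_om (R := R) (t := t) i). Qed.

Lemma root_dot_nu i : exists2 a : V, roots a & dot a (nu i) = 1.
Proof.
have [a ha e] := root_dot_num_steps (R := R) (t := t) i; exists a => //.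
by rewrite dotZr e mulVf // gt_eqF // num_steps_gt0.
Qed.

(** By [line_of_roots] the face stays on the line.  On r nu the roots take
    the values r k / N with |k| <= N and N = 1 or 2, and k = N occurs; so exactly
    the integral r are on walls that do not contain the whole line. *)
Lemma face_line i (r : R) :
  face_at (r *: nu i) =
    [set s *: nu i | s in [set s | (Num.floor r)%:~R <= s <= (Num.ceil r)%:~R]].
Proof.
apply/seteqP; split=> [y [hy h]|_ [s /= /andP[fs sc] <-]].
  have [q yq] : exists q, y = q *: om i.
    apply: line_of_roots => // a ha a0.
    have e0 : dot a (r *: nu i) = 0 by rewrite /nu (dotZr r) dotZr a0 !mulr0.
    have h1 := h a 0 ha; have h2 := h (- a) 0 (roots_opp ha).
    move: h1 h2; rewrite !dotNl e0 oppr0 !addr0 lexx => /(_ isT) h1 /(_ isT) h2.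
    by apply/eqP; rewrite eq_le h1 -oppr_ge0 h2.
  have [a ha a1] := root_dot_nu i.
  have {yq} ys : y = (q * (num_steps t i)%:R) *: nu i by rewrite yq -scalerA nu_om.
  exists (q * (num_steps t i)%:R) => //=; set s := q * _ in ys *; rewrite ys in h.
  have h1 := h a (- Num.floor r) ha; have h2 := h (- a) (Num.ceil r) (roots_opp ha).
  move: h1 h2; rewrite !dotNl (dotZr r) (dotZr s) a1 !mulr1 intrN !subr_ge0 floor_le => /(_ isT)
    ->.
  by rewrite addrC subr_ge0 ceil_ge addrC subr_ge0 => ->.
split; first exact: apartment_nu.
move=> a m ha; have [k [ak km]] := omega_bound i ha.
have lo (q : int) : q%:~R <= r -> q%:~R <= s.
  by rewrite -floor_ge_int => qr; apply: le_trans fs; rewrite ler_int.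
have hi (q : int) : r <= q%:~R -> s <= q%:~R.
  by rewrite -ceil_le_int => qr; apply: (le_trans sc); rewrite ler_int.
rewrite (dotZr r) (dotZr s) /nu dotZr ak.
have [M|M] := num_steps12 (t := t) i; move: km; rewrite M => km.
  rewrite invr1 !mul1r.
  have : k = 0 \/ k = 1 \/ k = -1 by lia.
  case=> [->|[->|->]]; rewrite ?mulr0 // ?mulrN1 ?mulr1.
    by have := lo (- m); rewrite intrN; lra.
  by have := hi m; lra.
have : k = 0 \/ k = 1 \/ k = -1 \/ k = 2 \/ k = -2 by lia.
have := lo (- m); have := hi m; have := lo (- (m * 2)); have := hi (m * 2).
rewrite !intrN !intrM => h1 h2 h3 h4.
case=> [->|[->|[->|[->|->]]]]; rewrite ?mulr0 // ?intrN; move: h1 h2 h3 h4; lra.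
Qed.

Lemma vertex_line i (r : R) : is_vertex (r *: nu i) <-> r \is a Num.int.
Proof.
split=> [/is_vertexP[_ h]|rint].
  have : (Num.floor r)%:~R *: nu i = r *: nu i.
    apply: h; rewrite face_line; exists (Num.floor r)%:~R => //=.
    by rewrite lexx /= (le_trans (floor_le r)) // ceil_ge.
  by move/nu_inj => <-; exact: intr_int.
apply/is_vertexP; split; first exact: apartment_nu.
move=> y; rewrite face_line => -[s /=]; rewrite floorK // ceilK // => /andP[h1 h2] <-.
by congr (_ *: _); apply/eqP; rewrite eq_le h1 h2.
Qed.

Definition line_edge i (k : nat) : set V :=
  [set s *: nu i | s in [set s : R | k%:R <= s <= k.+1%:R]].

Lemma line_edge_face i k : line_edge i k = face_at ((k%:R + 2^-1) *: nu i).
Proof.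
(* the midpoint lies in the interior of the edge *)
have fl : Num.floor (k%:R + 2^-1 : R) = k%:Z.
  by apply/eqP; rewrite floor_eq intrD /= -!pmulrn; lra.
have ce : Num.ceil (k%:R + 2^-1 : R) = k.+1%:Z.
  apply/eqP; rewrite ceil_eq intrB /= -!pmulrn -[k.+1]addn1 natrD; lra.
by rewrite face_line fl ce.
Qed.

Lemma line_edge_edge i k : is_edge (line_edge i k).
Proof.
split; first by exists ((k%:R + 2^-1) *: nu i); [exact: apartment_nu|exact: line_edge_face].
have kk : (k%:R : R) < k.+1%:R by rewrite ltr_nat.
have := has_dim_segment 0 (nu_neq0 i) kk.
by rewrite (_ : [set _ | _ in _] = line_edge i k) //; congr (_ @` _); apply/funext => s; rewrite
  add0r.
Qed.

Lemma special_coweightP (x : V) : (0 < n)%N -> coweight x -> special x.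
Proof.
move=> n0 hx; split.
  have h0 : is_vertex (0 : V).
    by rewrite -(scale0r (nu (Ordinal n0))); apply/vertex_line; rewrite rpred0.
  by rewrite -[x]addr0; exact: is_vertex_shift.
by move=> a ha; have [_ /(_ a ha)/intrP[m ->]] := hx; exists (- m); rewrite intrN subrr.
Qed.

(** A root that is 1 at omega_i is 1/N at nu. *)
Lemma coweight_line i (r : R) : coweight (r *: nu i) ->
  exists m : int, r = m%:~R * (num_steps t i)%:R.
Proof.
move=> [_ h]; have [a ha a1] := root_dot1 (R := R) (t := t) i.
have /intrP[m hm] := h a ha; exists m; rewrite -hm (dotZr r) dotZr a1 mulr1 divfK //.
by rewrite gt_eqF // num_steps_gt0.
Qed.

Definition std_step i (k : nat) : set V * V := (line_edge i k, k.+1%:R *: nu i).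
Definition std_gallery i : gallery R t n := (0, [seq std_step i k | k <- iota 0 (num_steps t i)]).

Lemma in_segment_om i y : segment (om i) y <-> exists2 s : R, 0 <= s <= (num_steps t i)%:R & y =
  s *: nu i.
Proof.
have m0 := num_steps_gt0 i; split=> [[s /= /andP[s0 s1] <-]|[s /andP[s0 s1] ->]].
  exists (s * (num_steps t i)%:R); last by rewrite -scalerA nu_om.
  by rewrite mulr_ge0 ?ler0n //= ler_piMl ?ler0n.
exists (s / (num_steps t i)%:R); last by rewrite -scalerA.
by rewrite /= divr_ge0 ?ler0n //= ler_pdivrMr // mul1r.
Qed.

Lemma line_edge_l i k : line_edge i k (k%:R *: nu i).
Proof. by exists k%:R => //=; rewrite lexx ler_nat leqnSn. Qed.
Lemma line_edge_r i k : line_edge i k (k.+1%:R *: nu i).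
Proof. by exists k.+1%:R => //=; rewrite lexx ler_nat leqnSn. Qed.

Lemma last_std_steps i m k x : last x [seq p.2 | p <- [seq std_step i j | j <- iota k m]] =
  if m is 0 then x else (k + m)%:R *: nu i.
Proof.
elim: m k x => // m ih k x; rewrite /= ih; case: m {ih} => [|m]; rewrite ?addn1 //.
by rewrite addSnnS.
Qed.

Lemma is_walk_std_steps i m k : is_walk (k%:R *: nu i) [seq std_step i j | j <- iota k m].
Proof.
elim: m k => //= m ih k; split=> //.
- exact: line_edge_edge.
- exact: line_edge_l.
- exact: line_edge_r.
- by apply/vertex_line; exact: natr_int.
Qed.

Lemma target_std_gallery i : target (std_gallery i) = om i.
Proof.
rewrite /target /std_gallery /= last_std_steps -nu_om add0n.
by case: (num_steps12 (t := t) i) => ->.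
Qed.

Lemma straight_std_gallery i : straight (om i) (std_gallery i).
Proof.
have n0 : (0 < n)%N by apply: leq_ltn_trans (ltn_ord i).
split.
- split; [by []|apply: special_coweightP => //; exact: coweight0|rewrite target_std_gallery;
  apply: special_coweightP => //; exact: coweight_om|].
  by rewrite /= -(scale0r (nu i)); exact: is_walk_std_steps.
- exact: target_std_gallery.
- move=> p /mapP[k]; rewrite mem_iota add0n => /andP[_ km] -> y [s /= /andP[s0 s1] <-].
  apply/in_segment_om; exists s => //; rewrite (le_trans _ s0) ?ler0n //=.
  by rewrite (le_trans s1) // ler_nat.
- exists [seq k%:R / (num_steps t i)%:R | k <- iota 0 (num_steps t i).+1]; split.
    rewrite sorted_map; apply: (@sub_sorted _ ltn); last exact: iota_ltn_sorted.
    by move=> j k jk /=; rewrite ltr_pM2r ?invr_gt0 ?num_steps_gt0 // ltr_nat.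
  rewrite /vertices /= mul0r scale0r; congr (_ :: _).
  rewrite -!map_comp -[iota 1 _]/(iota (1 + 0) _) iotaDl -map_comp; apply: eq_map => k /=.
  by rewrite scalerA mulrC.
Qed.

(** A face that contains k nu and a later vertex of the line is the edge
    from k nu to (k+1) nu, because vertices on the line have integral
    coordinates.  The gallery is determined step by step. *)
Lemma straight_walk i (k : nat) s (ss : seq R) : (k <= num_steps t i)%N ->
  is_walk (k%:R *: nu i) s -> (forall p, p \in s -> p.1 `<=` segment (om i)) ->
  path <%R (k%:R / (num_steps t i)%:R) ss -> [seq p.2 | p <- s] = [seq r *: om i | r <- ss] ->
  last (k%:R *: nu i) [seq p.2 | p <- s] = om i ->
  s = [seq std_step i j | j <- iota k (num_steps t i - k)].
Proof.
have m0 := num_steps_gt0 i.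
elim: s k ss => [|[E y] s ih] k ss km.
  by move=> _ _ _ _ /=; rewrite -nu_om => /nu_inj/eqP; rewrite eqr_nat => /eqP ->; rewrite subnn.
move=> /= [[[z hz Ez] _] hEk hEy hy hw] hseg; case: ss => // r ss /= /andP[kr hp] [yr hs] hl.
have /in_segment_om[x x01 zx] : segment (om i) z.
  apply: (hseg (E, y)); first by rewrite inE eqxx.
  by rewrite Ez; exact: face_refl.
have /in_segment_om[y' y01 yy] : segment (om i) y.
  by apply: (hseg (E, y)); first by rewrite inE eqxx.
have yint : y' \is a Num.int by apply/(vertex_line i); rewrite -yy.
have ry : r = y' / (num_steps t i)%:R.
  have /nu_inj <- : (r * (num_steps t i)%:R) *: nu i = y' *: nu i by rewrite -scalerA nu_om -yr
    yy.
  by rewrite mulfK // gt_eqF.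
move: kr; rewrite ry ltr_pM2r ?invr_gt0 // => ky.
move: Ez; rewrite zx face_line => Ez.
move: hEk; rewrite Ez => -[s1 /andP[fk _] /nu_inj ek]; subst s1.
move: hEy; rewrite Ez yy => -[s1 /andP[_ yc] /nu_inj ey]; subst s1.
have [f [fx cx]] : exists f : int, Num.floor x = f /\ (Num.ceil x = f \/ Num.ceil x = f + 1).
  exists (Num.floor x); split => //; rewrite ceil_floor; case: (x \isn't a Num.int);
    [right|left] => //=.
  by rewrite addr0.
case/intrP: yint => q yq; rewrite yq -[k%:R]/((k : int)%:~R) ltr_int in ky.
rewrite yq ler_int in yc; rewrite fx -[k%:R]/((k : int)%:~R) ler_int in fk.
have [fE [cE qE]] : f = k /\ Num.ceil x = k + 1 /\ q = k + 1 by case: cx => cx; rewrite cx in yc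
  *; lia.
have Ek : (k + 1 : int)%:~R = k.+1%:R :> R by rewrite -[k.+1%:R]/((k.+1 : int)%:~R); congr
  _%:~R; lia.
have km' : (k < num_steps t i)%N.
  by rewrite -(ler_nat R) -Ek -qE -yq; case/andP: y01.
rewrite yy yq qE Ek in hw hl hs hp *.
rewrite -(subnSK km') /=; congr (_ :: _); first by rewrite /std_step /line_edge fx cE Ek fE.
apply: (ih _ ss) => //; last first.
  by rewrite ry yq qE Ek in hp.
by move=> p ps; apply: hseg; rewrite inE ps orbT.
Qed.

Lemma straight_unique i g : straight (om i) g -> g = std_gallery i.
Proof.
case: g => x s [[hx _ _ hw] hl hseg [ss [hss hv]]].
rewrite /source /= in hx; subst x.
case: ss hss hv => // r ss /= hp [r0 hs].
have {}r0 : r = 0.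
  by move/eqP: r0; rewrite eq_sym scaler_eq0 (negPf (om_neq0 i)) orbF => /eqP.
congr (_, _); rewrite -(subn0 (num_steps t i)); apply: (straight_walk _ _ _ _ hs) => //.
- by rewrite scale0r.
- by rewrite mul0r -r0.
- by rewrite scale0r.
Qed.

Lemma gamma_omegaE i : gamma_omega R t i = std_gallery i.
Proof.
rewrite /gamma_omega; apply: xget_unique; first exact: straight_std_gallery.
by move=> g; exact: straight_unique.
Qed.

End Line.

(** * The orbit of the subgroup attached to half a coweight *)

Section Half.
Context {R : realType} {t : cartan_type} {n : nat}.
Notation V := 'rV[R]_(amb t n).
Notation L := (letter t n).
Implicit Types (x y v : V) (i : 'I_n) (c : column t n) (S : {set L}).
Notation om i := (omega R t i).

Lemma lattice_weyl (u : V -> V) x : weyl u -> lattice x -> lattice (u x).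
Proof.
move=> hu hx; elim: hu => //= s v [a ha ->] _ hv.
apply: latticeB => //; apply: latticeZ; last exact: lattice_check.
by rewrite addr0; exact: lattice_dot.
Qed.

Lemma num_steps2_NA i : num_steps t i = 2%N -> t <> TA.
Proof. by move=> + tA; rewrite num_stepsA. Qed.

Lemma num_steps2_coef i : num_steps t i = 2%N -> weight_coef R t i = 1.
Proof.
move=> m2; have [tB|] := pselect (t = TB); last exact: weight_coefNB.
by move: m2; rewrite num_stepsB // weight_coefB //; case: ifP.
Qed.

Lemma half_signed_ind_int i S (x : V) l : num_steps t i = 2%N -> in_alphabet S -> lattice
  (2^-1 *: (weight i S - x)) ->
  exists m : int, (signed_ind S l - coord x l) = (m * 2)%:~R.
Proof.
move=> m2 hS [/int_vecP/(_ l) + _]; rewrite coordZ coordB coord_weight //; last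
  exact/alphabetNA/num_steps2_NA/m2.
rewrite num_steps2_coef // mul1r meanNA; last exact/num_steps2_NA/m2.
rewrite mul0r subr0 => /intrP[m hm]; exists m.
by rewrite intrM -hm mulrC mulVKf // pnatr_eq0.
Qed.

Lemma half_neq (m : int) (r : R) : r = 1 \/ r = -1 -> r <> (m * 2)%:~R.
Proof.
case=> -> /eqP; [rewrite -[1]/(1%:~R)|rewrite -[-1]/((-1)%:~R)]; rewrite eqr_int; lia.
Qed.

(** By induction on the number of barred letters of S.  The lattice
    condition says that S has the same indices as the base letters, up to bars.
    A reflection exchanging l with the bar of l' removes the bars of l and l'.
    Its root is -1 at omega_i/2 provided that it is not scaled: in type B take
    l' = l; in type C another barred letter l' is available by parity. *)
Lemma weyl_half_base i S : num_steps t i = 2%N -> weight_set i S ->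
  lattice (2^-1 *: (weight i S - om i)) ->
  exists2 s : V -> V, weyl_half i s & weight i S = s (om i).
Proof.
move=> m2 hS; have [k] := ubnP #|S :\: base_letters i|; elim: k S hS => // k ih S hS Sk hl.
have [h1 h2 h3] := hS.
have tA := num_steps2_NA m2.
have [sb|] := boolP (S \subset base_letters i).
  exists id; first exact: gen_id.
  by rewrite omega_weight; congr weight; apply/eqP; rewrite eqEcard sb h3 card_base_letters leqnn.
case/fintype.subsetPn => l lS lb.
have coord_om (m : L) : coord (om i) m = signed_ind (base_letters i) m.
  rewrite omega_weight coord_weight; [|exact: alphabetNA|exact: in_alphabet_base_letters].
  by rewrite num_steps2_coef // meanNA // mul0r subr0 mul1r.
have indS m : m \in S -> signed_ind S m = 1 :> R.
  by move=> mS; rewrite /signed_ind mS (negPf (h2 _ mS)) subr0.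
have bb m : m \in S -> m \notin base_letters i -> bar m \in base_letters i.
  case: m => j b mS; rewrite !inE /= negb_and !negbK -ltnNge.
  have [q] := half_signed_ind_int (j, b) m2 h1 hl; rewrite indS // coord_om signed_ind_base.
  case: leqP => [ji|ij]; first by case: b {mS}.
  by rewrite subr0 => /half_neq; case; left.
have indb m : m \in S -> m \notin base_letters i -> signed_ind (base_letters i) m = -1 :> R.
  move=> mS mb; rewrite /signed_ind (negPf mb) bb // sub0r //.
have [l' [l'S l'b hll']] : exists l', [/\ l' \in S, l' \notin base_letters i & root_scale l
  (bar l') = 1 :> R].
  have [tC|tC] := pselect (t = TC); last by exists l; split=> //; exact: root_scaleNC.
  (* If l were the only barred letter, the half difference of the weights
     would be the unit vector of l, whose coordinate sum is odd. *)
  suff [l' [l'S l'b ll']] : exists l', [/\ l' \in S, l' \notin base_letters i & l' != l].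
    by exists l'; split=> //; apply: root_scale_nbar; rewrite (inj_eq bar_inj).
  apply: contrapT => hn.
  have lp : letter_pair l (bar l).
    by split; [exact: alphabetNA|exact: alphabetNA|rewrite neq_bar].
  have [hv hw] := swap_set (R := R) lp hS.
  have S1b : [set m | swap l (bar l) m \in S]%SET = base_letters i.
    apply/eqP; rewrite eqEcard; case: hv => _ _ ->; rewrite card_base_letters leqnn andbT.
    apply/fintype.subsetP => m; rewrite inE /swap.
    have [->|ml] := eqVneq m l; first by rewrite (negPf (h2 _ lS)).
    have [->|mbl] := eqVneq m (bar l); first by rewrite bb.
    rewrite barK (negPf ml); move=> mS; apply: contrapT => /negP mb; apply: hn.
    by exists m.
  move: hw; rewrite S1b -omega_weight /refl addr0 check_lroot // => hw.
  have := hl; rewrite -hw opprB addrCA subrr addr0.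
  rewrite dot_lroot !coord_bar !(coord_weight _ (alphabetNA _ tA) h1) num_steps2_coef // meanNA
    // indS //.
  rewrite mul0r subr0 mulr1 opprK root_scaleC // eqxx /lcoroot.
  case=> _ /(_ tC); rewrite !csumZ csumB !csum_unit.
  case/intrP => q; rewrite /coroot_scale /letter_sign; clear -tC.
  have -> : match t with TB => if bar l == bar l then 2^-1 else 1 | _ => 1 end = 1 :> R.
    by case: (_ == _); case: (t) tC.
  move=> h; have : (1 : R) = (q * 2)%:~R \/ (-1 : R) = (q * 2)%:~R.
    by rewrite intrM -h /=; case: l.2 => /=; [right|left]; field.
  by case=> /half_neq; apply; [left|right].
have tbl' := h2 _ l'S.
have lp : letter_pair l (bar l').
  by split; [exact: alphabetNA|exact: alphabetNA|apply/eqP => e; rewrite e (negPf tbl') in lS].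
have [hv hw] := swap_set (R := R) lp hS.
have dS : dot (lroot l (bar l')) (weight i S : V) = 2.
  rewrite dot_lroot coord_bar !(coord_weight _ (alphabetNA _ tA) h1) num_steps2_coef // meanNA
    // !indS // hll'; ring.
have dom : dot (lroot l (bar l')) (om i) = -2.
  by rewrite dot_lroot coord_bar !coord_om !indb // hll'; ring.
have [s hs es] : exists2 s : V -> V, weyl_half i s & weight i
  [set m | swap l (bar l') m \in S]%SET = s (om i).
  apply: ih => //.
    rewrite ltnS in Sk; apply: leq_trans Sk.
    rewrite [in X in (_ < X)%N](cardsD1 l) inE lS lb /= add1n ltnS.
    apply/subset_leq_card/fintype.subsetP => m; rewrite !inE => /andP[mb].
    rewrite /swap; have [->|ml] := eqVneq m l; first by rewrite (negPf tbl').
    have [e|_] := eqVneq m (bar l').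
      by move: (bb _ l'S l'b); rewrite -e inE (negPf mb).
    have [e|_] := eqVneq m (bar l).
      by move: (bb _ lS lb); rewrite -e inE (negPf mb).
    rewrite barK; case: eqP => [_|_] mS; last by rewrite mb.
    by rewrite (negPf (h2 _ lS)) in mS.
  rewrite -hw /refl addr0 dS check_lroot // addrAC -opprB opprB scalerBr scalerA mulVf
    ?pnatr_eq0 //.
  by rewrite scale1r; apply: latticeB => //; exact: lattice_lcoroot.
exists (refl (lroot l (bar l')) 0 \o s).
  apply: gen_comp => //; exists (lroot l (bar l')); split => //; first exact: lroot_roots.
  by exists (-1); rewrite dotZr dom mulrN mulVf // pnatr_eq0.
by rewrite /= -es -hw (reflK _ (lroot_roots lp)).
Qed.

End Half.

(** * Columns as sets of letters *)

Section Columns.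
Context {t : cartan_type} {n : nat}.
Notation L := (letter t n).
Implicit Types (i : 'I_n) (c : column t n) (S : {set L}).

Lemma letter_lt_trans : transitive (@letter_lt t n).
Proof. by move=> l k m; exact: ltn_trans. Qed.

Lemma letter_lt_irr : irreflexive (@letter_lt t n).
Proof. by move=> l; exact: ltnn. Qed.

Definition is_column i c := [/\ sorted letter_lt c, all alphabet c, size c = i.+1 & no_opposite
  c].
Definition letter_set c : {set L} := [set l in c]%SET.

Lemma column_uniq c : sorted letter_lt c -> uniq c.
Proof. exact: sorted_uniq letter_lt_trans letter_lt_irr c. Qed.

Lemma mem_letter_set c l : (l \in letter_set c) = (l \in c).
Proof. by rewrite inE. Qed.

Lemma card_letter_set c : uniq c -> #|letter_set c| = size c.
Proof. by move/card_uniqP => <-; apply: eq_card => l; rewrite inE. Qed.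

Lemma letter_set_inj c c' : sorted letter_lt c -> sorted letter_lt c' -> letter_set c =
  letter_set c' -> c = c'.
Proof.
move=> hc hc' e; apply: (irr_sorted_eq letter_lt_trans letter_lt_irr) => // l.
by rewrite -!mem_letter_set e.
Qed.

Lemma weight_set_letter_set i c : is_column i c -> weight_set i (letter_set c).
Proof.
move=> [hs /allP ha hz hn]; split=> [l|l|].
- by rewrite mem_letter_set => /ha.
- by rewrite !mem_letter_set => /hn.
- by rewrite card_letter_set // column_uniq.
Qed.

Definition column_of S : column t n := sort (fun l l' => (letter_key l <= letter_key l')%N)
  (enum S).

Lemma letter_set_column_of S : letter_set (column_of S) = S.
Proof. by apply/setP => l; rewrite mem_letter_set mem_sort mem_enum. Qed.

Lemma column_of_sorted S : sorted letter_lt (column_of S).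
Proof.
have su : uniq (column_of S) by rewrite sort_uniq enum_uniq.
have st : sorted (fun l l' => (letter_key l <= letter_key l')%N) (column_of S).
  by apply: sort_sorted => l l'; exact: leq_total.
have tr : transitive (fun l l' : L => (letter_key l <= letter_key l')%N).
  by move=> a b c; exact: leq_trans.
have st' : sorted leq [seq letter_key l | l <- column_of S] by rewrite sorted_map.
have : sorted ltn [seq letter_key l | l <- column_of S].
  by rewrite ltn_sorted_uniq_leq st' andbT (map_inj_uniq (@letter_key_inj t n)).
by rewrite sorted_map.
Qed.

Lemma column_of_column i S : weight_set i S -> is_column i (column_of S).
Proof.
move=> [h1 h2 h3]; have hm l : (l \in column_of S) = (l \in S) by rewrite mem_sort mem_enum.
split; first exact: column_of_sorted.
- by apply/allP => l; rewrite hm => /h1.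
- by rewrite size_sort -cardE.
- by move=> l; rewrite !hm => /h2.
Qed.

End Columns.

Section Encoding.
Context {R : realType} {t : cartan_type} {n : nat}.
Notation V := 'rV[R]_(amb t n).
Notation L := (letter t n).
Implicit Types (x y v : V) (i : 'I_n) (c : column t n) (S : {set L}).
Notation om i := (omega R t i).

Lemma sum_letter_set c : uniq c -> \sum_(l <- c) eps R l = \sum_(l in letter_set c) eps R l.
Proof. by move=> uc; rewrite big_uniq //; apply: eq_bigl => l; rewrite mem_letter_set. Qed.

Lemma encodes_column i c : is_column i c -> encodes i (weight i (letter_set c) : V) c.
Proof. by move=> [h1 h2 h3 h4]; split => //; rewrite sum_letter_set // column_uniq. Qed.

(** Weights of the orbit determine their sets of letters, and a sorted column is
    determined by its set. *)
Lemma encodes_unique i c S : weight_set i S -> encodes i (weight i S : V) c -> c = column_of S.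
Proof.
move=> hS [h1 h2 h3 h4].
apply: letter_set_inj => //; first exact: column_of_sorted.
rewrite letter_set_column_of; apply: (@weight_inj R t n i) => //.
- by move=> l; rewrite mem_letter_set; exact: (allP h2).
- by rewrite card_letter_set // column_uniq.
- by rewrite h4 sum_letter_set // column_uniq.
Qed.

(** The condition on the two columns of a pair in a Young tableau.  In type A
    there are no pairs. *)
Definition related c c' : Prop :=
  match t with
  | TA => False
  | TB => c = c' \/ exchanged c c'
  | TC => c = c' \/ even_exchanged c c'
  end.

Lemma relatedB c c' : t = TB -> related c c' <-> c = c' \/ exchanged c c'.
Proof.
by rewrite /related; move: (c = c') (exchanged c c') (even_exchanged c c') => P Q Q' ->.
Qed.

Lemma relatedC c c' : t = TC -> related c c' <-> c = c' \/ even_exchanged c c'.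
Proof.
by rewrite /related; move: (c = c') (exchanged c c') (even_exchanged c c') => P Q Q' ->.
Qed.

Lemma eps_bar (l : L) : eps R (bar l) = - eps R l.
Proof. by rewrite /eps /=; case: l.2; rewrite //= opprK. Qed.

(** The bar negates the vector of a letter, so exchanging a letter changes
    the sum by twice its vector. *)
Lemma sum_exchange (m : bitseq) c : size m = size c ->
  \sum_(l <- c) eps R l - \sum_(l <- exchange m c) eps R l = 2 *: \sum_(l <- mask m c) eps R l.
Proof.
elim: c m => [|l c ih] [|b m] //=; first by rewrite /exchange !big_nil subrr scaler0.
move=> [sm]; have := ih m sm; rewrite /exchange /= !big_cons.
set A := \sum_(l <- c) _; set B := \sum_(l <- [seq _ | _ <- _]) _; set C := \sum_(l <- mask m c)
  _.
move=> e; have -> : A = 2 *: C + B by rewrite -e subrK.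
by case: b; rewrite ?big_cons ?eps_bar; apply/rowP => j; rewrite !mxE; ring.
Qed.

(** Each letter contributes 1 or -1 to the sum, which are odd. *)
Lemma csum_seq_even c : t <> TA ->
  csum (\sum_(l <- c) eps R l) / 2 \is a Num.int <-> ~~ odd (size c).
Proof.
move=> tA; have [m hm] : exists m : int, csum (\sum_(l <- c) eps R l) = (size c)%:R + (m * 2)%:~R.
  elim: c => [|l c [m hm]]; first by exists 0; rewrite big_nil csum0 /= mul0r addr0.
  rewrite big_cons csumD hm eps_unit ?alphabetNA // meanNA // scale0r subr0 csum_unit
    /letter_sign /=.
  exists (if l.2 then m - 1 else m); rewrite -addn1 natrD !intrM.
  by case: l.2; rewrite ?intrB; ring.
rewrite hm mulrDl intrM mulfK ?pnatr_eq0 // rpredDr ?intr_int //.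
rewrite -[size c]odd_double_half natrD mulrDl -muln2 natrM mulfK ?pnatr_eq0 // rpredDr ?natr_int
  //.
rewrite oddD oddM andbF addbF oddb.
case: (odd _); rewrite /= ?mul0r ?rpred0 // mul1r; split => //.
by move=> h; have := @half_not_int R; rewrite h.
Qed.

(** The half difference of the weights is the sum of the unit vectors of
    the exchanged letters ([sum_exchange]); so it is integral, and its sum has the
    parity of the number of exchanges.  Conversely, integrality of the half
    difference excludes that a coordinate vanishes for one column only. *)
Lemma related_lattice i c c' : num_steps t i = 2%N -> is_column i c -> is_column i c' ->
  related c c' <-> lattice (2^-1 *: (weight i (letter_set c) - weight i (letter_set c')) : V).
Proof.
move=> m2 hc hc'; have tA := num_steps2_NA m2.
have [cs ca cz cn] := hc; have [cs' ca' cz' cn'] := hc'.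
have cu := column_uniq cs; have cu' := column_uniq cs'.
have key m : size m = size c -> perm_eq c' (exchange m c) ->
    2^-1 *: (weight i (letter_set c) - weight i (letter_set c')) = \sum_(l <- mask m c) eps R l.
  move=> sm pm; rewrite /weight -!sum_letter_set // num_steps2_coef // !scale1r (perm_big _ pm)
    /=.
  by rewrite sum_exchange // scalerA mulVf ?scale1r // pnatr_eq0.
have hint (s : seq L) : int_vec (\sum_(l <- s) eps R l).
  elim/big_ind: _ => [j|x y|l _]; [by rewrite mxE rpred0|exact: int_vecD|].
  by rewrite eps_unit ?alphabetNA // meanNA // scale0r subr0; exact: int_vec_unit.
have lat m : size m = size c -> perm_eq c' (exchange m c) ->
    lattice (2^-1 *: (weight i (letter_set c) - weight i (letter_set c')) : V) <->
      (t = TC -> ~~ odd (count id m)).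
  move=> sm pm; rewrite (key m sm pm) /lattice -(size_mask sm).
  by split => [[_ h] /h /(csum_seq_even _ tA)//|h]; split => // /h /(csum_seq_even _ tA).
split.
  have [e|ne] := pselect (c = c').
    by move=> _; rewrite e subrr scaler0; exact: lattice0.
  move=> hr; have [m [sm pm hm]] : exists m, [/\ size m = size c, perm_eq c' (exchange m c) & t
    = TC -> ~~ odd (count id m)].
    case: (@typeP t) => tt //.
    - have [//|[m [sm pm]]] := (relatedB c c' tt).1 hr.
      by exists m; split => //; rewrite tt.
    - have [//|[m [sm hm pm]]] := (relatedC c c' tt).1 hr.
      by exists m; split.
  by apply/(lat m).
move=> hl.
(* exchange the letters of c that are missing in c' *)
pose m := [seq l \notin c' | l <- c].
have sm : size m = size c by rewrite size_map.
have mE : exchange m c = [seq if l \notin c' then bar l else l | l <- c].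
  by rewrite /exchange /m; elim: (c) => //= l s ->.
have hV : in_alphabet (letter_set c) by case: (weight_set_letter_set hc).
have hV' : in_alphabet (letter_set c') by case: (weight_set_letter_set hc').
have mem (l : L) : l \in c -> l \notin c' -> bar l \in c'.
  move=> lc lc'; have [q] := half_signed_ind_int l m2 hV hl.
  rewrite coord_weight //; last exact: alphabetNA.
  rewrite num_steps2_coef // meanNA // /signed_ind !mem_letter_set lc (negPf lc')
    (negPf (cn _ lc)).
  case: (bar l \in c') => //= h; have e1 : (1 : R) = (q * 2)%:~R by rewrite -h; ring.
  by case: (half_neq _ e1); left.
have pm : perm_eq c' (exchange m c).
  have ue : uniq (exchange m c).
    rewrite mE map_inj_in_uniq // => k k' kc kc'.
    case: ifP => _; case: ifP => _ //; first exact: bar_inj.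
    - by move=> e; move: kc'; rewrite -e (negPf (cn _ kc)).
    - by move=> e; move: kc; rewrite e (negPf (cn _ kc')).
  have sub : {subset exchange m c <= c'}.
    by move=> l; rewrite mE => /mapP[k kc ->]; case: ifP => [/(mem _ kc)//|/negbFE].
  have sz : (size c' <= size (exchange m c))%N by rewrite mE size_map cz cz'.
  by apply: uniq_perm => // l; have [_ ->] := uniq_min_size ue sub sz.
have hpar := (lat m sm pm).1 hl.
case: (@typeP t) => tt //.
- by apply/(relatedB c c' tt); right; exists m.
- by apply/(relatedC c c' tt); right; exists m; split => //; exact: hpar.
Qed.

End Encoding.

(** * Galleries of the same type and concatenation *)

Section All2P.
Context {A B : Type} (P : A -> B -> Prop).

Fixpoint all2P (s : seq A) (s' : seq B) : Prop :=
  match s, s' with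
  | [::], [::] => True
  | x :: s, y :: s' => P x y /\ all2P s s'
  | _, _ => False
  end.

Lemma all2P_size s s' : all2P s s' -> size s = size s'.
Proof. by elim: s s' => [|x s ih] [|y s'] //= [_ /ih ->]. Qed.

Lemma all2P_cat s1 s2 s1' s2' : size s1 = size s1' ->
  all2P (s1 ++ s2) (s1' ++ s2') <-> all2P s1 s1' /\ all2P s2 s2'.
Proof.
elim: s1 s1' => [|x s1 ih] [|y s1'] //= => [_|[/ih e]]; first by tauto.
by rewrite e; tauto.
Qed.

End All2P.

Section Galleries.
Context {R : realType} {t : cartan_type} {n : nat}.
Notation V := 'rV[R]_(amb t n).
Notation L := (letter t n).
Notation step := (set V * V)%type.
Implicit Types (x y v p q : V) (i : 'I_n) (g h : gallery R t n) (s : seq step).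
Notation om i := (omega R t i).

Definition share_type (F H : set V) := exists D, face_type F D /\ face_type H D.

(** The list of types of a gallery can be chosen face by face. *)
Lemma common_types (fs hs : seq (set V)) :
  (exists ds : seq (set V),
     (size ds = size fs /\ forall k, (k < size ds)%N ->
        face_type (nth set0 fs k) (nth set0 ds k)) /\
     (size ds = size hs /\ forall k, (k < size ds)%N ->
        face_type (nth set0 hs k) (nth set0 ds k)))
  <-> all2P share_type fs hs.
Proof.
elim: fs hs => [|F fs ih] [|H hs] /=.
- by split => // _; exists [::].
- by split => // -[ds [[-> _] []]].
- by split => // -[ds [[-> _] []]].
rewrite -ih; split.
  move=> [[|D ds] /= [[] // [sf hf] [[sh] hh]]].
  split; first by exists D; split; [exact: (hf 0%N)|exact: (hh 0%N)].
  by exists ds; split; split=> // k kd; [exact: (hf k.+1)|exact: (hh k.+1)].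
move=> [[D [hF hH]] [ds [[sf hf] [sh hh]]]].
by exists (D :: ds); split; split=> /=; [rewrite sf|case=> [|k] //; exact: hf|rewrite sh|case=>
  [|k] //; exact: hh].
Qed.

Definition conj_step (p q : step) := conjugate p.1 q.1 /\ conjugate [set p.2] [set q.2].

Lemma same_typeP g h :
  same_type g h <-> share_type [set g.1] [set h.1] /\
    all2P (fun p q : step => share_type p.1 q.1 /\ share_type [set p.2] [set q.2]) g.2 h.2.
Proof.
rewrite /same_type /gallery_type common_types /faces /=.
apply: and_iff_compat_l.
elim: g.2 h.2 => [|[E y] s ih] [|[E' y'] s'] //=.
by rewrite ih; tauto.
Qed.

Definition typed_gallery h := forall q : step, q \in h.2 -> typed q.1 /\ typed [set q.2].

(** The start at the origin makes the conditions on the source trivial, and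
    typed faces have the same type exactly if they are conjugate. *)
Lemma galleries_of_typeP g h : (0 < n)%N -> h.1 = 0 -> typed_gallery h ->
  galleries_of_type h g <->
  [/\ g.1 = 0, special (target g), is_walk 0 g.2 & all2P conj_step g.2 h.2].
Proof.
move=> n0 h0 th.
have sp0 : special (0 : V) by apply: special_coweightP => //; exact: coweight0.
have hst : all2P (fun p q : step => share_type p.1 q.1 /\ share_type [set p.2] [set q.2]) g.2
  h.2 <-> all2P conj_step g.2 h.2.
  move: th; rewrite /typed_gallery; move: g.2 h.2; elim=> [|p s ih] [|q s'] //= th.
  rewrite ih; last by move=> r rs; apply: th; rewrite inE rs orbT.
  have [t1 t2] := th q (mem_head _ _).
  rewrite /share_type !same_face_type /conj_step; tauto.
rewrite /galleries_of_type /= /is_gallery same_typeP hst /source h0.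
split=> [[[g0 _ sp hw] [_ hc]]|[g0 sp hw hc]]; first by split=> //; rewrite -g0.
rewrite g0; split => //; split => //.
apply/same_face_type; split; last exact: conjugate_refl.
have -> : [set (0 : V)] = face_at 0.
  by case: sp0 => /is_vertexP[_ h0'] _; apply/seteqP; split => [_ ->|y /h0' ->//];
    exact/face_refl/apartment0.
apply: typed_face; first exact: apartment0.
by exists 1%N => // j; rewrite !mxE mulr0 rpred0.
Qed.

Definition shift_steps v s : seq step := [seq (shift v e.1, v + e.2) | e <- s].

Lemma shift_steps_add v v' s : shift_steps v (shift_steps v' s) = shift_steps (v + v') s.
Proof.
rewrite /shift_steps -map_comp; apply: eq_map => p /=.
by rewrite shift_shift addrA.
Qed.

Lemma shift_steps0 s : shift_steps 0 s = s.
Proof.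
rewrite /shift_steps -[RHS]map_id; apply: eq_map => -[E y] /=.
by rewrite shift0 add0r.
Qed.

Lemma conj_steps_shift p q s s' : congr_lat p q -> all2P conj_step s s' ->
  all2P conj_step (shift_steps p s) (shift_steps q s').
Proof.
move=> pq; elim: s s' => [|[E y] s ih] [|[E' y'] s'] //= [[h1 h2] /ih h3].
split=> //; split=> /=; first exact: conjugate_shift.
by rewrite -!shift1; exact: conjugate_shift.
Qed.

Definition walk_end x s : V := last x [seq e.2 | e <- s].

Lemma walk_end_cat x s s' : walk_end x (s ++ s') = walk_end (walk_end x s) s'.
Proof. by rewrite /walk_end map_cat last_cat. Qed.

Lemma walk_end_shift v x s : walk_end (v + x) (shift_steps v s) = v + walk_end x s.
Proof. by elim: s x => //= p s ih x; exact: ih. Qed.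

Lemma walk_end_conj x y s s' : conjugate [set x] [set y] -> all2P conj_step s s' ->
  conjugate [set walk_end x s] [set walk_end y s'].
Proof.
by elim: s s' x y => [|p s ih] [|q s'] x y //= xy [[_ pq] /ih]; exact.
Qed.

Lemma is_walk_cat x s s' : is_walk x (s ++ s') <-> is_walk x s /\ is_walk (walk_end x s) s'.
Proof.
elim: s x => [|[E y] s ih] x /=; first by tauto.
split=> [[h1 h2 h3 h4 /ih[h5 h6]]|[[h1 h2 h3 h4 h5] h6]]; split=> //; exact/ih.
Qed.

Lemma is_walk_shift v x s : coweight v -> is_walk x s -> is_walk (v + x) (shift_steps v s).
Proof.
move=> hv; elim: s x => [|[E y] s ih] x //= [h1 h2 h3 h4 h5]; split.
- exact: is_edge_shift.
- by exists x.
- by exists y.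
- exact: is_vertex_shift.
- exact: ih.
Qed.

Lemma gcatE g h : h.1 = 0 -> gcat g h = (g.1, g.2 ++ shift_steps (target g) h.2).
Proof. by move=> h0; rewrite /gcat /source h0 subr0. Qed.

Lemma special_shift v x : coweight v -> special x -> special (v + x).
Proof. by move=> hv; exact: (special_ext (ext_affine_translation hv)). Qed.

(** The vertex where a gallery has to be cut is conjugate to the coweight where
    the reference gallery is cut, so they are congruent modulo the coroot lattice
    and translation by their negatives preserves conjugacy of the remaining faces. *)
Lemma type_gcat g h1 h2 : (0 < n)%N -> h1.1 = 0 -> h2.1 = 0 -> coweight (target h1) ->
  typed_gallery h1 -> typed_gallery h2 -> typed_gallery (gcat h1 h2) ->
  galleries_of_type (gcat h1 h2) g <->
  exists g1 g2, [/\ g = gcat g1 g2, galleries_of_type h1 g1 & galleries_of_type h2 g2].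
Proof.
move=> n0 h10 h20 cw th1 th2 th; split.
  move/(galleries_of_typeP _ n0); rewrite gcatE //= => /(_ h10).
  rewrite gcatE // in th; move=> /(_ th); case: g => g0 s /= [-> sp hw hc].
  set p := target h1 in cw hc *.
  pose s1 := take (size h1.2) s; pose s2 := drop (size h1.2) s.
  have ss : s = s1 ++ s2 by rewrite cat_take_drop.
  have sz1 : size s1 = size h1.2.
    by rewrite size_takel // (all2P_size hc) size_cat leq_addr.
  rewrite ss in hc hw sp; move/(all2P_cat _ _ _ sz1): hc => [hc1 hc2].
  move/is_walk_cat: hw => [hw1 hw2].
  have ce : conjugate [set p] [set walk_end 0 s1].
    apply: conjugate_sym; rewrite /p /target h10; apply: walk_end_conj hc1; exact: conjugate_refl.
  set v := walk_end 0 s1 in hw2 ce.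
  have pv := congr_lat_conj cw ce; have [_ cv _ _] := pv.
  exists (0, s1), (0, shift_steps (- v) s2); split.
  - by rewrite gcatE //= shift_steps_add /target /= -/(walk_end 0 s1) subrr shift_steps0 -ss.
  - apply/galleries_of_typeP => //; split => //; exact: special_coweightP.
  - apply/galleries_of_typeP => //; split => //=.
    + have := special_shift (coweightN cv) sp.
      rewrite {1}/target /= -/(walk_end 0 _) walk_end_cat -walk_end_shift -/v addNr.
      by [].
    + by have := is_walk_shift (coweightN cv) hw2; rewrite addNr.
    + have := conj_steps_shift (congr_latN (congr_latC pv)) hc2.
      by rewrite shift_steps_add addNr shift_steps0.
move=> [g1 [g2 [-> /(galleries_of_typeP _ n0 h10 th1)[g10 sp1 hw1 hc1]
  /(galleries_of_typeP _ n0 h20 th2)[g20 sp2 hw2 hc2]]]].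
apply/(galleries_of_typeP _ n0) => //.
have cv := special_coweight sp1.
have pv : congr_lat (target g1) (target h1).
  apply: congr_lat_conj => //; rewrite /target g10 h10; apply: walk_end_conj hc1; exact:
    conjugate_refl.
rewrite !gcatE // /target /= -!/(walk_end _ _) g10 walk_end_cat; split => //.
- have := special_shift cv sp2; rewrite {1}/target g10 -/(walk_end _ _).
  by rewrite -[target g2]/(walk_end g2.1 g2.2) g20 -walk_end_shift addr0.
- apply/is_walk_cat; split => //.
  by have := is_walk_shift cv hw2; rewrite addr0 /target g10 -/(walk_end _ _).
- apply/all2P_cat; first exact: all2P_size hc1.
  split => //; rewrite h10; have := conj_steps_shift pv hc2.
  by rewrite /target g10 h10.
Qed.

End Galleries.

(** * Galleries of the type of one fundamental coweight *)

Section Elementary.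
Context {R : realType} {t : cartan_type} {n : nat}.
Notation V := 'rV[R]_(amb t n).
Notation L := (letter t n).
Notation step := (set V * V)%type.
Implicit Types (x y v p q : V) (i : 'I_n) (g h : gallery R t n).
Notation om i := (omega R t i).

(** Twice a coordinate is an integral combination of values of roots in types
    B and C, and so is n+1 times a coordinate in type A, where the sum is 0. *)
Lemma coweight_rational x : coweight x -> rational x.
Proof.
move=> [hx h]; have [tA|tA] := pselect (t = TA).
  exists (amb t n); first by rewrite tA.
  move=> j; rewrite mxE.
  have -> : (amb t n)%:R * x 0 j = \sum_k (x 0 j - x 0 k).
    have := (apartmentE x).1 hx tA; rewrite /csum sumrB => ->.
    by rewrite subr0 sumr_const card_ord mulr_natl.
  apply: rpred_sum => k _; have [->|jk] := eqVneq j k; first by rewrite subrr rpred0.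
  have lp : letter_pair (j, false) (k, false).
    by split; [exact: alphabetF..|rewrite xpair_eqE andbT].
  have := h _ (lroot_roots lp); rewrite dot_lroot root_scale_nbar ?mul1r //.
  by rewrite xpair_eqE andbF.
exists 2%N => // j; rewrite mxE.
have lp : letter_pair (j, false) (j, true).
  by split; [exact: alphabetF|exact: alphabetNA|rewrite xpair_eqE andbF].
have := h _ (lroot_roots lp); rewrite dot_lroot /coord /= opprK.
case: (root_scale_cases (R := R) (j, false) (j, true)) => [->|[-> _]].
  by rewrite mul1r mulr_natl -mulr2n.
have -> : 2^-1 * (x 0 j + x 0 j) = x 0 j by field.
move=> hj.
by rewrite rpredM // natr_int.
Qed.

(** Enough to have a type, and visibly stable under translation by coweights. *)
Definition rational_face (F : set V) := exists x, [/\ apartment x, rational x & F = face_at x].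

Lemma rational_face_typed F : rational_face F -> typed F.
Proof. by move=> [x [hx hr ->]]; exact: typed_face. Qed.

Lemma rational_face_shift v F : coweight v -> rational_face F -> rational_face (shift v F).
Proof.
move=> hv [x [hx hr ->]]; exists (v + x); split.
- by apply: apartmentD => //; case: hv.
- by apply: rationalD => //; exact: coweight_rational.
- by rewrite shiftE -(face_ext _ (ext_affine_translation hv)).
Qed.

Definition rational_gallery g := forall q : step, q \in g.2 -> rational_face q.1 /\
  rational_face [set q.2].

Lemma rational_gallery_typed g : rational_gallery g -> typed_gallery g.
Proof. by move=> h q /h[h1 h2]; split; exact: rational_face_typed. Qed.

Lemma rational_std_gallery i : rational_gallery (std_gallery i).
Proof.
have rn : rational (nu i : V) by apply: rationalV (coweight_rational (coweight_om i)); case: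
  (num_steps12 (t := t) i) => ->.
have h2 k : rational ((k%:R + 2^-1) *: nu i : V).
  rewrite scalerDl; apply: rationalD; first by apply: rationalZ => //; exact: natr_int.
  exact: rationalV.
move=> q /mapP[k _ ->]; split.
  by exists ((k%:R + 2^-1) *: nu i); split => //; [exact: apartment_nu|exact: line_edge_face].
exists (k.+1%:R *: nu i); split; [exact: apartment_nu|by apply: rationalZ => //; exact:
  natr_int|].
have /is_vertexP[hk hk'] : is_vertex (k.+1%:R *: nu i : V) by apply/vertex_line; exact: natr_int.
by apply/seteqP; split => [_ ->|y /hk' ->//]; exact: face_refl.
Qed.

Definition gamma_word (w : seq 'I_n) : gallery R t n :=
  foldr (@gcat R t n) (trivial_gallery R t n) [seq gamma_omega R t i | i <- w].

Lemma gamma_word_cons i w : gamma_word (i :: w) = gcat (std_gallery i) (gamma_word w).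
Proof. by rewrite /gamma_word /= gamma_omegaE. Qed.

Lemma gamma_word_source w : (gamma_word w).1 = 0.
Proof. by case: w => // i w; rewrite gamma_word_cons. Qed.

Lemma rational_gallery_gcat g h : h.1 = 0 -> coweight (target g) -> rational_gallery g ->
  rational_gallery h ->
  rational_gallery (gcat g h).
Proof.
move=> h0 cg hg hh q; rewrite gcatE //= mem_cat => /orP[/hg//|/mapP[e /hh[h1 h2] ->]].
by split; rewrite /= -?shift1; exact: rational_face_shift.
Qed.

Lemma rational_gamma_word w : rational_gallery (gamma_word w).
Proof.
elim: w => [|i w ih]; first by [].
rewrite gamma_word_cons; apply: rational_gallery_gcat => //.
- exact: gamma_word_source.
- by rewrite target_std_gallery; exact: coweight_om.
- exact: rational_std_gallery.
Qed.

Lemma type_gamma_word i w g :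
  galleries_of_type (gamma_word (i :: w)) g <->
  exists g1 g2, [/\ g = gcat g1 g2, galleries_of_type (std_gallery i) g1 & galleries_of_type
    (gamma_word w) g2].
Proof.
have n0 : (0 < n)%N by apply: leq_ltn_trans (ltn_ord i).
rewrite gamma_word_cons; apply: type_gcat => //.
- exact: gamma_word_source.
- by rewrite target_std_gallery; exact: coweight_om.
- exact/rational_gallery_typed/rational_std_gallery.
- exact/rational_gallery_typed/rational_gamma_word.
- by rewrite -gamma_word_cons; exact/rational_gallery_typed/rational_gamma_word.
Qed.

Lemma type_trivial g : (0 < n)%N -> galleries_of_type (trivial_gallery R t n) g <-> g =
  trivial_gallery R t n.
Proof.
move=> n0; rewrite (galleries_of_typeP g n0) //; case: g => x s /=; split.
  by move=> [-> _ _]; case: s.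
by move=> [-> ->]; split => //; apply: special_coweightP => //; exact: coweight0.
Qed.

(** The origin lies on the edge and is a special vertex, so it is the image
    under w of 0 or, if N = 1, possibly of omega_i.  The latter is impossible
    because w^-1 0 is in the coroot lattice.  In the same way y is not the origin,
    being conjugate to nu. *)
Lemma first_step i (w : V -> V) y : affine_weyl w ->
  (w @` line_edge i 0) 0 -> (w @` line_edge i 0) y -> is_vertex y ->
  conjugate [set y] [set 1 *: nu i] ->
  exists2 u, weyl u & (forall x, w x = u x) /\ y = u (nu i).
Proof.
move=> hw [_ [s /= /andP[s0 s1] <-] ws] [_ [r /= /andP[r0 r1] <-] wr] hy hc.
have [w' [hw' ww' w'w]] := affine_inv hw.
have w'0 : w' 0 = s *: nu i by rewrite -ws ww'.
have [m sm] : exists m : int, s = m%:~R * (num_steps t i)%:R.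
  by apply: (@coweight_line R t n i); rewrite -w'0; exact: affine_coweight0.
have s0' : s = 0.
  have [m0|m0] := eqVneq m 0; first by rewrite sm m0 mul0r.
  have := num_steps12 (t := t) i => -[] M; rewrite M in sm.
    have m1 : m = 1.
      by move: s0 s1; rewrite sm mulr1 -[0%:R]/(0%:~R) -[1%:R]/(1%:~R) !ler_int; lia.
    case: (minuscule_not_lattice (R := R) M); rewrite -nu_om M -(_ : w' 0 = 1%:R *: nu i).
      exact: affine_lattice.
    by rewrite w'0 sm m1 mulr1.
  exfalso; move: s0 s1; rewrite sm -[2%:R]/(2%:~R) -intrM -[0%:R]/(0%:~R) -[1%:R]/(1%:~R)
    !ler_int; lia.
have [u hu uE] := affine_linear hw.
have w0 : w 0 = 0 by move: ws; rewrite s0' scale0r.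
exists u => //; split=> [x|]; first by rewrite uE w0 addr0.
have rint : r \is a Num.int.
  apply/(@vertex_line R t n i); rewrite -(ww' (r *: nu i)) wr.
  exact: is_vertex_ext (affine_ext_affine hw') hy.
have r01 : r = 0 \/ r = 1.
  case/intrP: rint => q qr; move: r0 r1; rewrite qr -[0%:R]/(0%:~R) -[1%:R]/(1%:~R) !ler_int =>
    q0 q1.
  have : q = 0 \/ q = 1 by lia.
  by case=> ->; [left|right].
case: r01 => re; last by rewrite -wr re scale1r uE w0 addr0.
exfalso; move: wr; rewrite re scale0r w0 => y0; subst y.
have [w2 hw2] := hc; rewrite image_set1 scale1r => e.
have {}e : w2 0 = nu i by have : [set nu i] (w2 0) by rewrite -e.
case: (num_steps12 (t := t) i) => M.
  case: (minuscule_not_lattice (R := R) M); rewrite -nu_om M scale1r -e.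
  exact: affine_lattice.
have [q] : exists q : int, (1 : R) = q%:~R * (num_steps t i)%:R.
  by apply: (@coweight_line R t n i); rewrite scale1r -e; exact: affine_coweight0.
by rewrite M -[2%:R]/(2%:~R) -[1]/(1%:~R) -intrM => /eqP; rewrite eqr_int; lia.
Qed.

(** The points u nu and z are vertices on w [nu, 2 nu], hence ends of it;
    as nu is not a coweight but 2 nu is, w nu = u nu and w (2 nu) = z.  So u^-1 w
    fixes nu and the lattice condition of [weyl_half_base] holds for its linear
    part l.  Only the value of l on omega_i matters for the edge, so l may be
    replaced by an element of the subgroup [weyl_half]. *)
Lemma second_step i (u w : V -> V) z : num_steps t i = 2%N -> weyl u -> affine_weyl w ->
  (w @` line_edge i 1) (u (nu i)) -> (w @` line_edge i 1) z -> is_vertex z ->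
  conjugate [set z] [set 2%:R *: nu i] ->
  exists2 s, weyl_half i s &
    (forall r : R, w (r *: nu i) = u (nu i) + (r - 1) *: u (s (nu i))) /\ z = u (nu i) + u
      (s (nu i)).
Proof.
move=> m2 hu hw [_ [r /= /andP[r1 r2] <-] wr] [_ [q /= /andP[q1 q2] <-] wq] hz hc.
have [w' [hw' ww' w'w]] := affine_inv hw.
have [u' [hu' uu' u'u]] := weyl_inv hu.
have eu := affine_ext_affine (weyl_affine hu); have ew := affine_ext_affine hw; have ew' :=
  affine_ext_affine hw'.
have int12 (s : R) : s \is a Num.int -> 1%:R <= s <= 2%:R -> s = 1 \/ s = 2.
  case/intrP=> m -> /andP[]; rewrite -[1%:R]/(1%:~R) -[2%:R]/(2%:~R) !ler_int => m1' m2'.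
  have : m = 1 \/ m = 2 by lia.
  by case=> ->; [left|right].
have vnu : is_vertex (nu i : V).
  by rewrite -[nu i]scale1r; apply/vertex_line; exact: rpred1.
have cnu : ~ coweight (nu i : V).
  move=> h; have [k] : exists k : int, (1 : R) = k%:~R * (num_steps t i)%:R.
    by apply: (@coweight_line R t n i); rewrite scale1r.
  by rewrite m2 -[2%:R]/(2%:~R) -[1]/(1%:~R) -intrM => /eqP; rewrite eqr_int; lia.
have c2nu : coweight (2 *: nu i : V) by rewrite -[2]/(2%:R) -m2 nu_om; exact: coweight_om.
have re : r = 1.
  have : r \is a Num.int.
    apply/(@vertex_line R t n i); rewrite -(ww' (r *: nu i)) wr.
    by apply: is_vertex_ext => //; exact: is_vertex_ext.
  move=> rint; case: (int12 r rint); rewrite ?r1 ?r2 // => r2'; exfalso; apply: cnu.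
  rewrite -(uu' (nu i)); apply: (weyl_coweight hu'); rewrite -wr r2'.
  exact: ext_affine_coweight.
have qe : q = 2.
  have : q \is a Num.int.
    apply/(@vertex_line R t n i); rewrite -(ww' (q *: nu i)) wq.
    exact: is_vertex_ext.
  move=> qint; case: (int12 q qint); rewrite ?q1 ?q2 // => q1'; exfalso; apply: cnu.
  rewrite -[nu i]scale1r -(ww' (1 *: nu i)) -q1' wq.
  apply: (ext_affine_coweight ew').
  have [w2 hw2] := hc; rewrite image_set1 => e.
  have {}e : w2 z = 2 *: nu i by have : [set 2 *: nu i] (w2 z) by rewrite -e.
  have [w2' [hw2' ww2 _]] := affine_inv hw2.
  by rewrite -(ww2 z) e; apply: ext_affine_coweight => //; exact: affine_ext_affine.
subst r q; rewrite scale1r in wr.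
(* h is in W^a and fixes nu *)
pose h := u' \o w; have hh : affine_weyl h by apply: generated_comp => //; exact: weyl_affine.
have hnu : h (nu i) = nu i by rewrite /h /= wr uu'.
have [l hl lE] := affine_linear hh.
have lat := affine_lattice hh.
have h0 : h 0 = nu i - l (nu i) by rewrite -{1}hnu (lE (nu i)) addrC addKr.
have [S hS lS] := weyl_weight hl (weight_set_base (t := t) i); rewrite -omega_weight in lS.
have half : 2^-1 *: l (om i) = l (nu i) by rewrite /nu m2 (weylZ _ (om i) hl).
have [s hs es] : exists2 s : V -> V, weyl_half i s & weight i S = s (om i).
  apply: weyl_half_base => //; rewrite -lS scalerBr half.
  have -> : 2^-1 *: om i = nu i by rewrite /nu m2.
  by rewrite -opprB -h0; exact: latticeN.
have ws : weyl s by move: hs; apply: generated_sub => f [a [ha _ ->]]; exists a.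
have lnu : l (nu i) = s (nu i) by rewrite /nu (weylZ _ (om i) hl) (weylZ _ (om i) ws) lS es.
have wE r : w (r *: nu i) = u (nu i) + (r - 1) *: u (s (nu i)).
  have -> : w (r *: nu i) = u (h (r *: nu i)) by rewrite /h /= u'u.
  rewrite lE h0 lnu (weylZ _ (nu i) hl) lnu !(weylD _ _ hu) (weylN _ hu) (weylZ _ (s (nu i)) hu).
  by apply/rowP => j; rewrite !mxE; ring.
exists s => //; split=> //.
by rewrite -wq wE; congr (_ + _); rewrite -[RHS]scale1r; congr (_ *: _); ring.
Qed.

End Elementary.

(** * Elementary galleries and their columns *)

Section Blocks.
Context {R : realType} {t : cartan_type} {n : nat}.
Notation V := 'rV[R]_(amb t n).
Notation L := (letter t n).
Notation step := (set V * V)%type.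
Implicit Types (x y v p q : V) (i : 'I_n) (g h : gallery R t n) (c : column t n).
Notation om i := (omega R t i).

Lemma line_edge0 i : line_edge i 0 = segment (nu i) :> set V.
Proof. by []. Qed.

Lemma omega_nu1 i : num_steps t i = 1%N -> om i = nu i.
Proof. by move=> m1; rewrite -nu_om m1 scale1r. Qed.

Lemma half_omega_nu i : num_steps t i = 2%N -> 2^-1 *: om i = nu i.
Proof. by move=> m2; rewrite /nu m2. Qed.

Lemma omega_nu2 i : num_steps t i = 2%N -> om i = 2 *: nu i.
Proof. by move=> m2; rewrite -[in LHS]nu_om m2. Qed.

Lemma is_edge_image i k (w : V -> V) : ext_affine w -> is_edge (w @` line_edge i k).
Proof.
move=> hw; split; first by apply: is_face_ext => //; have [] := @line_edge_edge R t n i k.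
have [u [p [hu _ wE]]] := hw.
have kk : (k%:R : R) < k.+1%:R by rewrite ltr_nat.
have u0 : u (nu i) != 0.
  have [u' [hu' uu' _]] := weyl_inv hu.
  apply/eqP => e; have := uu' (nu i); rewrite e weyl0 // => /esym/eqP.
  by rewrite (negPf (nu_neq0 i)).
have := has_dim_segment p u0 kk.
rewrite (_ : [set _ | _ in _] = w @` line_edge i k) //.
rewrite /line_edge image_comp; apply: eq_imagel => s _ /=.
by rewrite wE (weylZ _ (nu i) hu) addrC.
Qed.

Lemma encode_orbit i (u : V -> V) : weyl u ->
  exists c, is_column i c /\ encodes i (u (om i)) c.
Proof.
move=> hu; have [S hS uS] := weyl_weight hu (weight_set_base (t := t) i); rewrite -omega_weight
  in uS.
exists (column_of S); have hc := column_of_column hS; split=> //.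
by have := encodes_column (R := R) hc; rewrite letter_set_column_of uS.
Qed.

(** Opposite letters in c would cancel, leaving fewer than i+1 nonzero
    coordinates; but vectors in the orbit of omega_i have i+1 of them.  Type A has
    no opposite letters. *)
Lemma encode_orbit_column i (u : V -> V) c : weyl u -> encodes i (u (om i)) c ->
  is_column i c /\ u (om i) = weight i (letter_set c).
Proof.
move=> hu; have [S hS uS] := weyl_weight hu (weight_set_base (t := t) i); rewrite -omega_weight
  in uS.
rewrite uS => /(encodes_unique hS) ->; rewrite letter_set_column_of; split=> //.
exact: column_of_column.
Qed.

Lemma encodes_fun i (u u' : V -> V) c c' : weyl u -> weyl u' ->
  u (om i) = u' (om i) -> encodes i (u (om i)) c -> encodes i (u' (om i)) c' -> c = c'.
Proof.
move=> hu hu' e; have [S hS uS] := weyl_weight hu (weight_set_base (t := t) i); rewrite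
  -omega_weight in uS.
by rewrite -e uS => /(encodes_unique hS) -> /(encodes_unique hS) ->.
Qed.

Lemma weyl_half_weyl i (s : V -> V) : weyl_half i s -> weyl s.
Proof. by apply: generated_sub => f [a [ha _ ->]]; exists a. Qed.

(** The affine map w sends nu to u nu and nu + r nu to u nu + r u s nu. *)
Lemma second_edge i (u s w : V -> V) : num_steps t i = 2%N -> weyl u -> weyl s ->
  (forall r : R, w (r *: nu i) = u (nu i) + (r - 1) *: u (s (nu i))) ->
  w @` line_edge i 1 = shift (2^-1 *: u (om i)) ((u \o s) @` segment (2^-1 *: om i)).
Proof.
move=> m2 hu hs wE; rewrite /line_edge /segment shiftE !image_comp half_omega_nu //
  -(weylZ _ (om i) hu) half_omega_nu //.
apply/seteqP; split => _ [r /= /andP[r1 r2] <-] /=.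
  exists (r - 1) => /=; first by rewrite -[1%:R]/(1 : R) -[2%:R]/(2 : R) in r1 r2; apply/andP;
    split; lra.
  by rewrite wE (weylZ _ (nu i) hs) (weylZ _ (s (nu i)) hu).
exists (r + 1) => /=; first by rewrite -[1%:R]/(1 : R) -[2%:R]/(2 : R); apply/andP; split; lra.
by rewrite wE addrK (weylZ _ (nu i) hs) (weylZ _ (s (nu i)) hu).
Qed.

Lemma elementary_exists i g : galleries_of_type (std_gallery i) g -> exists T, elementary i g T.
Proof.
have n0 : (0 < n)%N by apply: leq_ltn_trans (ltn_ord i).
have th := rational_gallery_typed (@rational_std_gallery R t n i).
move/(galleries_of_typeP _ n0 (erefl : (std_gallery i).1 = 0) th).
case: g => x s /= [-> _].
have [M|M] := num_steps12 (t := t) i; rewrite M /=.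
  move=> sw sc; have := all2P_size sc; case: s sw sc => [|[E y] [|? ?]] //= [_ E0 Ey hy _]
    [[/= hE hc] _] _.
  have [w hw wE] := conjugate_sym hE; rewrite -wE in E0 Ey.
  have [u hu [uw yE]] := first_step hw E0 Ey hy hc.
  have [c [_ ec]] := encode_orbit i hu.
  exists [:: c]; left; split; first exact/minusculeP.
  exists u, c; split=> //; first by rewrite -wE yE line_edge0 -omega_nu1 // (funext uw).
move=> sw sc; have := all2P_size sc; case: s sw sc => [|[E y] [|[E' z] [|? ?]]] //=
  [_ E0 Ey hy [_ E'y E'z hz _]] [[/= hE hc] [[/= hE' hc'] _]] _.
have [w hw wE] := conjugate_sym hE; rewrite -wE in E0 Ey.
have [u hu [uw yE]] := first_step hw E0 Ey hy hc.
have [w2 hw2 wE2] := conjugate_sym hE'; rewrite -wE2 yE in E'y E'z.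
have [s hs [sw zE]] := second_step M hu hw2 E'y E'z hz hc'.
have ws := weyl_half_weyl hs.
have [c1 [_ ec1]] := encode_orbit i hu.
have [c2 [_ ec2]] := encode_orbit i (generated_comp hu ws).
exists [:: c1; c2]; right; split; first by move/minusculeP; rewrite M.
exists u, s, c1, c2; split=> //.
rewrite -wE -wE2 yE zE line_edge0 (second_edge M hu ws sw) (funext uw).
rewrite -(weylZ _ (om i) hu) half_omega_nu //; congr (_, [:: _; (_, _)]).
by rewrite scalerDr -(weylZ _ (om i) hu) -(weylZ _ (s (om i)) hu) -(weylZ _ (om i) ws)
  half_omega_nu.
Qed.

(** An element of W^a because omega_i/2 is on a wall parallel to the mirror of
    each generator; it fixes omega_i/2 and has linear part s. *)
Lemma weyl_half_affine i (s : V -> V) : weyl_half i s ->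
  affine_weyl (fun x => 2^-1 *: om i + s (- (2^-1 *: om i) + x)).
Proof.
elim=> [|r v [a [ha [m am] ->]] _ ih].
  rewrite (_ : (fun _ => _) = id); first exact: gen_id.
  by apply/funext => x; rewrite addrA subrr add0r.
rewrite (_ : (fun _ => _) = refl a (- m) \o (fun x => 2^-1 *: om i + v (- (2^-1 *: om i) + x))).
  by apply: gen_comp => //; exists a, (- m).
apply/funext => x /=; rewrite /refl addrA; congr (_ - _ *: _).
by rewrite (dotDr a) am intrN; ring.
Qed.

(** The conjugating elements are u for the first step and, for the second
    one, u composed with the element of [weyl_half_affine]. *)
Lemma elementary_type i g T : elementary i g T -> galleries_of_type (std_gallery i) g.
Proof.
have n0 : (0 < n)%N by apply: leq_ltn_trans (ltn_ord i).
have th := rational_gallery_typed (@rational_std_gallery R t n i).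
have cL (u : V -> V) F : affine_weyl u -> conjugate (u @` F) F.
  by move=> hu; apply: conjugate_sym; exists u.
have cp (u : V -> V) y : affine_weyl u -> conjugate [set u y] [set y].
  by move=> hu; rewrite -image_set1; exact: cL.
have img (w : V -> V) k : (w @` line_edge i k) (w (k%:R *: nu i)) /\ (w @` line_edge i k)
  (w (k.+1%:R *: nu i)).
  by split; eexists; [exact: line_edge_l|by []|exact: line_edge_r|by []].
have vtx (w : V -> V) (k : nat) : affine_weyl w -> is_vertex (w (k%:R *: nu i)).
  by move=> hw; apply: (is_vertex_ext (affine_ext_affine hw)); apply/vertex_line; exact: natr_int.
case=> [[/minusculeP m1 [u [c [hu -> _ _]]]]|[nm [u [s [c1 [c2 [[hu hs] -> _ _ _]]]]]]].
  apply/(galleries_of_typeP _ n0 (erefl : (std_gallery i).1 = 0) th).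
  have au := weyl_affine hu; have uE := weyl0 hu.
  rewrite /std_gallery m1 /= omega_nu1 //; split=> //.
  - by apply: special_coweightP => //; rewrite /target /= -omega_nu1 //; exact: weyl_coweight
    (coweight_om i).
  - have [h0 h1] := img u 0%N; split => //.
    + exact: (is_edge_image i 0 (affine_ext_affine au)).
    + by move: h0; rewrite scale0r uE.
    + by move: h1; rewrite scale1r.
    + by have := vtx u 1%N au; rewrite scale1r.
  - by split=> //; split=> /=; [exact: cL|rewrite scale1r; exact: cp].
have m2 : num_steps t i = 2%N by case: (num_steps12 (t := t) i) => // m1; case: nm;
  exact/minusculeP.
have au := weyl_affine hu; have uE := weyl0 hu; have ws := weyl_half_weyl hs.
pose w := u \o (fun x => 2^-1 *: om i + s (- (2^-1 *: om i) + x)).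
have aw : affine_weyl w by apply: generated_comp => //; exact: weyl_half_affine.
have wE r : w (r *: nu i) = u (nu i) + (r - 1) *: u (s (nu i)).
  rewrite /w /= half_omega_nu //.
  have -> : - nu i + r *: nu i = (r - 1) *: (nu i : V) by rewrite scalerBl scale1r addrC.
  by rewrite (weylD _ _ hu) (weylZ _ (nu i) ws) (weylZ _ (s (nu i)) hu).
have w1 : w (1%:R *: nu i) = u (nu i) by rewrite wE subrr scale0r addr0.
have w2 : w (2%:R *: nu i) = u (nu i) + u (s (nu i)).
  by rewrite wE; congr (_ + _); rewrite -[RHS]scale1r; congr (_ *: _); ring.
apply/(galleries_of_typeP _ n0 (erefl : (std_gallery i).1 = 0) th).
rewrite /std_gallery -(second_edge m2 hu ws wE) m2 /= scalerDr.
rewrite -(weylZ _ (om i) hu) -(weylZ _ (s (om i)) hu) -(weylZ _ (om i) ws) half_omega_nu // -w2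
  /target /=.
split=> //.
- apply: special_coweightP => //; apply: (ext_affine_coweight (affine_ext_affine aw)).
  by rewrite -omega_nu2 //; exact: coweight_om.
- have [h0 h1] := img u 0%N; have [h2 h3] := img w 1%N; split => //.
  + exact: (is_edge_image i 0 (affine_ext_affine au)).
  + by move: h0; rewrite scale0r uE.
  + by move: h1; rewrite scale1r.
  + by have := vtx u 1%N au; rewrite scale1r.
  + split=> //; [exact: (is_edge_image i 1 (affine_ext_affine aw))|by move: h2; rewrite
    w1|exact: vtx].
- split; [split=> /=|split=> //; split=> /=].
  + exact: cL.
  + by rewrite scale1r; exact: cp.
  + exact: cL.
  + exact: cp.
Qed.

Definition block i (T : tableau t n) :=
  (num_steps t i = 1%N /\ exists c, is_column i c /\ T = [:: c]) \/
  (num_steps t i = 2%N /\ exists c1 c2, [/\ is_column i c1, is_column i c2, related c1 c2 & T =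
    [:: c1; c2]]).

Lemma elementary_block i g T : elementary i g T -> block i T.
Proof.
case=> [[/minusculeP m1 [u [c [hu _ ec ->]]]]|[nm [u [s [c1 [c2 [[hu hs] _ e1 e2 ->]]]]]]].
  by left; split=> //; exists c; split=> //; case: (encode_orbit_column hu ec).
have m2 : num_steps t i = 2%N by case: (num_steps12 (t := t) i) => // m1; case: nm;
  exact/minusculeP.
have ws := weyl_half_weyl hs.
have [h1 u1] := encode_orbit_column hu e1.
have [h2 u2] := encode_orbit_column (generated_comp hu ws) e2.
right; split=> //; exists c1, c2; split=> //.
apply/(related_lattice (R := R) m2 h1 h2); rewrite -u1 -u2 /= -(weylB _ _ hu) -(weylZ _ _ hu).
apply: lattice_weyl => //.
have := affine_lattice (weyl_half_affine hs).
by rewrite addr0 (weylN _ ws) (weylZ _ (om i) ws) -scalerBr.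
Qed.

Lemma block_elementary i T : block i T -> exists g, elementary i g T.
Proof.
case=> [[m1 [c [hc ->]]]|[m2 [c1 [c2 [h1 h2 hr ->]]]]].
  have [u hu uE] := weyl_transitive (R := R) (weight_set_base i) (weight_set_letter_set hc);
    rewrite -omega_weight in uE.
  eexists; left; split; first exact/minusculeP.
  by exists u, c; split=> //; rewrite uE; exact: encodes_column.
have [u hu uE] := weyl_transitive (R := R) (weight_set_base i) (weight_set_letter_set h1);
  rewrite -omega_weight in uE.
have [u' [hu' uu' u'u]] := weyl_inv hu.
have [S hS uS] := weyl_weight (R := R) hu' (weight_set_letter_set h2).
have [s hs sE] : exists2 s : V -> V, weyl_half i s & weight i S = s (om i).
  apply: weyl_half_base => //.
  have /latticeN := lattice_weyl hu' ((related_lattice (R := R) m2 h1 h2).1 hr).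
  by rewrite (weylZ _ _ hu') (weylB _ _ hu') -uE uu' uS -scalerN opprB.
eexists; right; split; first by move/minusculeP; rewrite m2.
exists u, s, c1, c2; split=> //.
  by rewrite uE; exact: encodes_column.
by rewrite -sE -uS u'u; exact: encodes_column.
Qed.

Lemma elementary_fun i g T T' : elementary i g T -> elementary i g T' -> T = T'.
Proof.
case=> [[h1 [u [c [hu -> ec ->]]]]|[h1 [u [s [c1 [c2 [[hu hs] -> e1 e2 ->]]]]]]];
  case=> [[h1' [u' [c' [hu' e ec' ->]]]]|[h1' [u' [s' [c1' [c2' [[hu' hs'] e e1' e2' ->]]]]]]] //.
  by case: e => _ e; rewrite (encodes_fun hu hu' e ec ec').
have ws := weyl_half_weyl hs; have ws' := weyl_half_weyl hs'.
case: e => _ eu _ es.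
have half : (2^-1 : R) != 0 by rewrite invr_eq0 pnatr_eq0.
have eu' := scalerI half eu.
have es' := scalerI half es; rewrite eu' in es'; move/addrI: es' => es'.
by rewrite (encodes_fun hu hu' eu' e1 e1') (encodes_fun (generated_comp hu ws)
  (generated_comp hu' ws') es' e2 e2').
Qed.

Lemma image_segment (u : V -> V) x : weyl u -> u @` segment x = segment (u x).
Proof. by move=> hu; rewrite /segment image_comp; apply: eq_imagel => r _ /=; rewrite
  (weylZ _ x hu). Qed.

Lemma elementary_inj i g g' T : elementary i g T -> elementary i g' T -> g = g'.
Proof.
case=> [[h1 [u [c [hu -> ec ->]]]]|[h1 [u [s [c1 [c2 [[hu hs] -> e1 e2 ->]]]]]]];
  case=> [[h1' [u' [c' [hu' -> ec' e]]]]|[h1' [u' [s' [c1' [c2' [[hu' hs'] -> e1' e2' e]]]]]]] //.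
  case: e => e; rewrite -e in ec'; have ue : u (om i) = u' (om i).
    by case: ec => _ _ _ ->; case: ec' => _ _ _ ->.
  by rewrite !image_segment // ue.
have ws := weyl_half_weyl hs; have ws' := weyl_half_weyl hs'.
case: e => d1 d2; rewrite -d1 in e1'; rewrite -d2 in e2'.
have ue : u (om i) = u' (om i) by case: e1 => _ _ _ ->; case: e1' => _ _ _ ->.
have se : u (s (om i)) = u' (s' (om i)) by case: e2 => _ _ _ ->; case: e2' => _ _ _ ->.
rewrite !image_segment //; try exact: generated_comp.
rewrite (weylZ _ (om i) hu) (weylZ _ (om i) hu') ue se.
rewrite (weylZ _ (om i) (generated_comp hu ws)) (weylZ _ (om i) (generated_comp hu' ws')) /=.
by rewrite se.
Qed.

Lemma elementary_size i g T : elementary i g T -> [/\ g.1 = 0, size g.2 = num_steps t i & size T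
  = num_steps t i].
Proof.
case=> [[/minusculeP m1 [u [c [hu -> ec ->]]]]|[nm [u [s [c1 [c2 [[hu hs] -> e1 e2 ->]]]]]]];
  first by rewrite m1.
by have -> : num_steps t i = 2%N by case: (num_steps12 (t := t) i) => // m1; case: nm;
  exact/minusculeP.
Qed.

End Blocks.

(** * Concatenations and their tableaux *)

Section Words.
Context {R : realType} {t : cartan_type} {n : nat}.
Notation V := 'rV[R]_(amb t n).
Notation step := (set V * V)%type.
Implicit Types (i : 'I_n) (g h : gallery R t n) (w : seq 'I_n) (T : tableau t n).

Lemma tableau_nilP g T : tableau_of_word [::] g T <-> g = trivial_gallery R t n /\ T = [::].
Proof.
split=> [h|[-> ->]]; last exact: tableau_nil.
by inversion h.
Qed.

Lemma tableau_consP i w g T : tableau_of_word (i :: w) g T <->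
  exists g1 g2 T1 T2, [/\ g = gcat g1 g2, T = T1 ++ T2, elementary i g1 T1 & tableau_of_word w
    g2 T2].
Proof.
split=> [h|[g1 [g2 [T1 [T2 [-> -> he hw]]]]]].
  by inversion h; subst; do 4!eexists; split; eauto.
by apply: tableau_cons => //; rewrite gamma_omegaE; exact: elementary_type he.
Qed.

Lemma tableau_source w g T : tableau_of_word w g T -> g.1 = 0.
Proof.
case: w => [|i w]; first by move/tableau_nilP => [-> _].
by move/tableau_consP => [g1 [g2 [T1 [T2 [-> _ /elementary_size[h _ _] _]]]]].
Qed.

Lemma shift_steps_inj v : injective (@shift_steps R t n v).
Proof.
move=> s s' e; rewrite -(shift_steps0 s) -(shift_steps0 s') -(addNr v).
by rewrite -!shift_steps_add e.
Qed.

(** Pieces of known lengths can be recovered from a concatenation. *)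
Lemma gcat_inj g1 g2 h1 h2 : g2.1 = 0 -> h2.1 = 0 -> size g1.2 = size h1.2 ->
  gcat g1 g2 = gcat h1 h2 -> g1 = h1 /\ g2 = h2.
Proof.
case: g1 g2 h1 h2 => [x1 s1] [x2 s2] [y1 r1] [y2 r2] /= -> -> sz.
rewrite !gcatE //= => -[xy].
move/eqP; rewrite eqseq_cat // => /andP[/eqP e1 /eqP].
by subst y1; subst r1 => /shift_steps_inj ->.
Qed.

Lemma tableau_exists w g : (0 < n)%N -> galleries_of_type (gamma_word w) g ->
  exists T, tableau_of_word w g T.
Proof.
move=> n0; elim: w g => [|i w ih] g.
  by move/(type_trivial _ n0) => ->; exists [::]; exact: tableau_nil.
move/type_gamma_word => [g1 [g2 [-> /elementary_exists[T1 h1] /ih[T2 h2]]]].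
by exists (T1 ++ T2); apply/tableau_consP; exists g1, g2, T1, T2.
Qed.

Lemma tableau_type w g T : (0 < n)%N -> tableau_of_word w g T -> galleries_of_type
  (gamma_word w) g.
Proof.
move=> n0; elim: w g T => [|i w ih] g T.
  by move/tableau_nilP => [-> _]; exact/type_trivial.
move/tableau_consP => [g1 [g2 [T1 [T2 [-> _ h1 h2]]]]].
by apply/type_gamma_word; exists g1, g2; split => //; [exact: elementary_type h1|exact: ih h2].
Qed.

Lemma tableau_fun w g T T' : tableau_of_word w g T -> tableau_of_word w g T' -> T = T'.
Proof.
elim: w g T T' => [|i w ih] g T T'.
  by move=> /tableau_nilP[_ ->] /tableau_nilP[_ ->].
move=> /tableau_consP[g1 [g2 [T1 [T2 [-> -> h1 h2]]]]] /tableau_consP[g1'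
  [g2' [T1' [T2' [e -> h1' h2']]]]].
have [_ s1 _] := elementary_size h1; have [_ s1' _] := elementary_size h1'.
have [e1 e2] := gcat_inj (tableau_source h2) (tableau_source h2') (etrans s1 (esym s1')) e.
by subst; rewrite (elementary_fun h1 h1') (ih _ _ _ h2 h2').
Qed.

Lemma tableau_inj w g g' T : tableau_of_word w g T -> tableau_of_word w g' T -> g = g'.
Proof.
elim: w g g' T => [|i w ih] g g' T.
  by move=> /tableau_nilP[-> _] /tableau_nilP[-> _].
move=> /tableau_consP[g1 [g2 [T1 [T2 [-> -> h1 h2]]]]] /tableau_consP[g1'
  [g2' [T1' [T2' [-> e h1' h2']]]]].
have [_ _ s1] := elementary_size h1; have [_ _ s1'] := elementary_size h1'.
move/eqP: e; rewrite eqseq_cat ?s1 ?s1' // => /andP[/eqP e1 /eqP e2]; subst.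
by rewrite (elementary_inj h1 h1') (ih _ _ _ h2 h2').
Qed.

Fixpoint blocks w T : Prop :=
  match w with
  | [::] => T = [::]
  | i :: w => exists T1 T2, [/\ T = T1 ++ T2, block i T1 & blocks w T2]
  end.

Lemma tableau_blocks w g T : tableau_of_word w g T -> blocks w T.
Proof.
elim: w g T => [|i w ih] g T; first by move/tableau_nilP => [].
move/tableau_consP => [g1 [g2 [T1 [T2 [_ -> h1 h2]]]]].
by exists T1, T2; split => //; [exact: elementary_block h1|exact: ih h2].
Qed.

Lemma blocks_tableau w T : blocks w T -> exists g, tableau_of_word w g T.
Proof.
elim: w T => [|i w ih] T /=; first by move=> ->; exists (trivial_gallery R t n);
  exact/tableau_nilP.
move=> [T1 [T2 [-> /(block_elementary (R := R))[g1 h1] /ih[g2 h2]]]].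
by exists (gcat g1 g2); apply/tableau_consP; exists g1, g2, T1, T2.
Qed.

End Words.

Arguments blocks : simpl never.

(** * Young tableaux as concatenations of blocks *)

Section Shape.
Context {t : cartan_type} {n : nat}.
Implicit Types (i : 'I_n) (w : seq 'I_n) (T : tableau t n) (a : 'I_n -> nat) (c : column t n).

Definition repeat (f : 'I_n -> nat) w : seq 'I_n := flatten [seq nseq (f i) i | i <- w].
(** The column heights (less one), from right to left: a coweight that is not
    minuscule gives two columns. *)
Definition heights w : seq 'I_n := repeat (num_steps t) w.
Definition good_column c := [/\ sorted letter_lt c, all alphabet c & no_opposite c].
Definition good_tableau T := forall c, c \in T -> good_column c.

Lemma good_cons c T : good_tableau (c :: T) <-> good_column c /\ good_tableau T.
Proof.
split=> [h|[hc h] c']; last by rewrite inE => /predU1P[->//|]; exact: h.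
by split=> [|c' hc']; apply: h; rewrite inE ?eqxx // hc' orbT.
Qed.

Lemma is_columnE i c : is_column i c <-> good_column c /\ size c = i.+1.
Proof. by split=> [[]|[[]]]; split. Qed.

Definition shaped w T := [seq size c | c <- T] = [seq (i : nat).+1 | i <- heights w].

Lemma heights1 i w : num_steps t i = 1%N -> heights (i :: w) = i :: heights w.
Proof. by rewrite /heights /repeat /= => ->. Qed.
Lemma heights2 i w : num_steps t i = 2%N -> heights (i :: w) = i :: i :: heights w.
Proof. by rewrite /heights /repeat /= => ->. Qed.

Lemma blocks1 i w T : num_steps t i = 1%N ->
  blocks (i :: w) T <-> exists c T', [/\ T = c :: T', is_column i c & blocks w T'].
Proof.
move=> m1; rewrite {1}/blocks -/blocks; split.
  move=> [T1 [T2 [-> [[_ [c [hc ->]]]|[m2 _]] hw]]]; last by rewrite m1 in m2.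
  by exists c, T2.
move=> [c [T' [-> hc hw]]]; exists [:: c], T'; split => //.
by left; split => //; exists c.
Qed.

Lemma blocks2 i w T : num_steps t i = 2%N ->
  blocks (i :: w) T <-> exists c c' T', [/\ T = c :: c' :: T', is_column i c /\ is_column i c',
    related c c' & blocks w T'].
Proof.
move=> m2; rewrite {1}/blocks -/blocks; split.
  move=> [T1 [T2 [-> [[m1 _]|[_ [c [c' [hc hc' hr ->]]]]] hw]]]; first by rewrite m2 in m1.
  by exists c, c', T2.
move=> [c [c' [T' [-> [hc hc'] hr hw]]]]; exists [:: c; c'], T'; split => //.
by right; split => //; exists c, c'.
Qed.

Lemma blocks_ones w T : all (fun i => num_steps t i == 1%N) w ->
  blocks w T <-> shaped w T /\ good_tableau T.
Proof.
elim: w T => [|i w ih] T /= => [_|/andP[/eqP m1 hw]].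
  by rewrite /shaped; split=> [->//|[+ _]]; case: T.
rewrite blocks1 // /shaped heights1 //=; split.
  move=> [c [T' [-> /is_columnE[gc sc] /(ih _ hw)[sh gT]]]].
  by split; [rewrite /= sc sh|exact/good_cons].
case: T => [[]//|c T' /= [[sc sh] /good_cons[gc gT]]].
exists c, T'; split=> //; first exact/is_columnE.
exact/(ih _ hw).
Qed.

Lemma blocks_twos w w' T : all (fun i => num_steps t i == 2%N) w -> all
  (fun i => num_steps t i == 1%N) w' ->
  blocks (w ++ w') T <-> [/\ shaped (w ++ w') T, good_tableau T &
    forall j, (j < size w)%N -> related (nth [::] T (2 * j)) (nth [::] T (2 * j).+1)].
Proof.
move=> + hw'; elim: w T => [|i w ih] T => [_|].
  by rewrite blocks_ones //=; split=> [[]|[]]; split.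
rewrite cat_cons => /= /andP[/eqP m2 hw].
rewrite blocks2 // /shaped heights2 //=; split.
  move=> [c [c' [T' [-> [/is_columnE[gc sc] /is_columnE[gc' sc']] hr /(ih _ hw)[sh gT hj]]]]].
  split; [by rewrite /= sc sc' sh|by apply/good_cons; split => //; exact/good_cons|].
  by case=> [|j] //; rewrite ltnS => /hj; rewrite mulnS.
case: T => [[]//|c [[]//|c' T'] [/= [sc sc' sh] /good_cons[gc /good_cons[gc' gT]] hj]].
exists c, c', T'; split=> //; [by split; exact/is_columnE|exact: (hj 0%N)|].
by apply/(ih _ hw); split=> // j jw; have := hj j.+1 jw; rewrite mulnS.
Qed.

(** The three parts cover all types: only the first is used in type A, the
    first is empty in type B, and the last is empty in type C. *)
Lemma blocks_index w1 w2 w3 T : all (fun i => num_steps t i == 1%N) w1 ->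
  all (fun i => num_steps t i == 2%N) w2 -> all (fun i => num_steps t i == 1%N) w3 ->
  blocks (w1 ++ w2 ++ w3) T <-> [/\ shaped (w1 ++ w2 ++ w3) T, good_tableau T &
    forall j, (j < size w2)%N ->
      related (nth [::] T (size w1 + 2 * j)) (nth [::] T (size w1 + 2 * j).+1)].
Proof.
move=> + h2 h3; elim: w1 T => [|i w ih] T => [_|]; first exact: (blocks_twos T h2 h3).
rewrite cat_cons => /= /andP[/eqP m1 hw].
rewrite blocks1 // /shaped heights1 //=; split.
  move=> [c [T' [-> /is_columnE[gc sc] /(ih _ hw)[sh gT hj]]]].
  by split; [rewrite /= sc sh|exact/good_cons|].
case: T => [[]//|c T' [/= [sc sh] /good_cons[gc gT] hj]].
exists c, T'; split=> //; first exact/is_columnE.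
exact/(ih _ hw).
Qed.

Lemma count_repeat (f : 'I_n -> nat) (P : pred 'I_n) w :
  count P (repeat f w) = (\sum_(i <- w | P i) f i)%N.
Proof.
elim: w => [|i w ih]; first by rewrite big_nil.
rewrite /repeat /= count_cat -/(repeat f w) ih count_nseq big_cons.
by case: (P i); rewrite ?mul1n ?mul0n.
Qed.

Lemma sum_repeat (f m : 'I_n -> nat) (P : pred 'I_n) w :
  (\sum_(i <- repeat f w | P i) m i = \sum_(i <- w | P i) f i * m i)%N.
Proof.
elim: w => [|i w ih]; first by rewrite !big_nil.
rewrite /repeat /= big_cat /= -/(repeat f w) ih big_cons.
have -> : (\sum_(j <- nseq (f i) i | P j) m j = if P i then f i * m i else 0)%N.
  elim: (f i) => [|k ihk] /=; first by rewrite big_nil if_same.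
  by rewrite big_cons ihk; case: (P i) => //; rewrite mulSn.
by case: (P i).
Qed.

Lemma coweight_wordE a : coweight_word a = repeat a (enum 'I_n).
Proof. by []. Qed.

Lemma count_word a (P : pred 'I_n) : count P (coweight_word a) = (\sum_(i < n | P i) a i)%N.
Proof. by rewrite coweight_wordE count_repeat big_enum_cond; apply: eq_bigl => i; rewrite inE.
  Qed.

Lemma count_heights a (P : pred 'I_n) :
  count P (heights (coweight_word a)) = (\sum_(i < n | P i) a i * num_steps t i)%N.
Proof.
by rewrite /heights count_repeat coweight_wordE sum_repeat big_enum_cond; apply: eq_bigl => i;
  rewrite inE.
Qed.

Lemma row_lenE a r : row_len t a r = count (fun i : 'I_n => (r <= i)%N)
  (heights (coweight_word a)).
Proof.
rewrite count_heights /row_len /num_steps; case: (t); apply: eq_bigr => i _.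
- by rewrite muln1.
- by case: ifP => _; rewrite ?muln1 // mulnC.
- by case: ifP => _; rewrite ?muln1 // mulnC.
Qed.

Definition ord_leq : rel 'I_n := fun i j => (i <= j)%N.

Lemma pairwise_repeat (f : 'I_n -> nat) w : pairwise ord_leq w -> pairwise ord_leq (repeat f w).
Proof.
elim: w => //= i w ih /andP[/allP iw /ih hw].
rewrite /repeat /= -/(repeat f w) pairwise_cat hw andbT; apply/andP; split.
  apply/allrelP => j k; rewrite mem_nseq => /andP[_ /eqP ->] /flattenP[s /mapP[l lw ->]].
  by rewrite mem_nseq => /andP[_ /eqP ->]; exact: iw.
elim: (f i) => //= k ->; rewrite andbT; apply/allP => j; rewrite mem_nseq => /andP[_ /eqP ->].
exact: leqnn.
Qed.

Lemma pairwise_word a : pairwise ord_leq (coweight_word a).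
Proof.
rewrite coweight_wordE; apply: pairwise_repeat.
have := iota_sorted 0 n; rewrite (sorted_pairwise leq_trans) -val_enum_ord pairwise_map.
by [].
Qed.

Lemma pairwise_heights a : pairwise ord_leq (heights (coweight_word a)).
Proof. exact/pairwise_repeat/pairwise_word. Qed.

Lemma count_iota q m : (q < m)%N -> count (fun r => r <= q)%N (iota 0 m) = q.+1.
Proof.
move=> qm; have -> : m = (q.+1 + (m - q.+1))%N by rewrite subnKC.
rewrite iotaD count_cat add0n.
have -> : count (fun r => r <= q)%N (iota 0 q.+1) = size (iota 0 q.+1).
  by apply/eqP; rewrite -all_count; apply/allP => r; rewrite mem_iota add0n ltnS => /andP[].
have -> : count (fun r => r <= q)%N (iota q.+1 (m - q.+1)) = 0%N.
  apply/eqP; rewrite -leqn0 leqNgt -has_count; apply/hasPn => r.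
  by rewrite mem_iota -ltnNge => /andP[].
by rewrite size_iota addn0.
Qed.

(** In an increasing sequence e the entries that are at least r form a
    final segment, which contains the k-th entry if it is longer than the part
    after k. *)
Lemma count_tail (e : seq 'I_n) (x0 : 'I_n) r k : pairwise ord_leq e -> (k < size e)%N ->
  (size e - k.+1 < count (fun i : 'I_n => r <= i) e)%N = (r <= nth x0 e k)%N.
Proof.
move=> pe ke.
have tr : transitive ord_leq by move=> x y z; exact: leq_trans.
have rf : reflexive ord_leq by move=> x; exact: leqnn.
have le (l m : nat) : (l <= m)%N -> (m < size e)%N -> (nth x0 e l <= nth x0 e m)%N.
  move=> ij je; apply: (@sorted_leq_nth _ ord_leq tr rf x0 e) => //; rewrite ?inE //.
    by rewrite sorted_pairwise.
  exact: leq_ltn_trans je.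
case: (leqP r (nth x0 e k)) => h.
  rewrite -[in X in count _ X](cat_take_drop k e) count_cat.
  have -> : count (fun i : 'I_n => r <= i)%N (drop k e) = size (drop k e).
    apply/eqP; rewrite -all_count; apply/(all_nthP x0) => j; rewrite size_drop nth_drop => jk.
    by rewrite /=; apply: (leq_trans h); apply: (le k (k + j)%N); lia.
  by rewrite size_drop; lia.
apply/negbTE; rewrite -leqNgt -[in X in count _ X](cat_take_drop k.+1 e) count_cat.
have -> : count (fun i : 'I_n => r <= i)%N (take k.+1 e) = 0%N.
  apply/eqP; rewrite -leqn0 leqNgt -has_count; apply/hasPn => i /(nthP x0)[j].
  rewrite size_takel // => jk; rewrite nth_take // => <-.
  by rewrite -ltnNge; apply: leq_ltn_trans h; exact: le.
by rewrite add0n (leq_trans (count_size _ _)) // size_drop.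
Qed.

(** Counting the rows that reach column k amounts to counting the r at most equal
    to the k-th letter of the word of heights. *)
Lemma has_shapeE a T : has_shape a T <-> shaped (coweight_word a) T.
Proof.
set e := heights (coweight_word a).
have sz : row_len t a 0 = size e by rewrite row_lenE count_predT.
have pe : pairwise ord_leq e := pairwise_heights a.
have ht (x0 : 'I_n) k : (k < size e)%N -> column_height t a k = (nth x0 e k).+1.
  move=> ke; rewrite /column_height sz -(count_iota (ltn_ord (nth x0 e k))).
  by apply: eq_count => r; rewrite row_lenE (count_tail x0).
split=> [[h1 h2]|h].
  apply: (@eq_from_nth _ 0%N); rewrite !size_map ?h1 ?sz // => k ke.
  have x0 : 'I_n by case: (e) ke => // x *; exact: x.
  by rewrite (nth_map [::]) ?h1 ?sz // (nth_map x0) // h2 ?h1 ?sz // (ht x0).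
have hs : size T = size e by have := congr1 size h; rewrite !size_map.
split=> [|k]; first by rewrite hs sz.
rewrite hs => ke; have x0 : 'I_n by case: (e) ke => // x *; exact: x.
rewrite (ht x0) //; have := congr1 (fun s => nth 0%N s k) h.
by rewrite (nth_map [::]) ?hs // (nth_map x0).
Qed.

(** In an increasing word the letters that satisfy a downward closed condition
    come first. *)
Lemma filter_split (P : pred 'I_n) w : pairwise ord_leq w ->
  (forall i j, ord_leq i j -> P j -> P i) -> w = filter P w ++ filter (predC P) w.
Proof.
move=> + hP; elim: w => //= i w ih /andP[/allP iw /ih hw].
case: ifP => Pi /=; first by rewrite -hw.
have nP j : j \in w -> ~~ P j by move=> /iw ij; apply/negP => /(hP _ _ ij); rewrite Pi.
rewrite (_ : filter P w = [::]) /=; last by apply/eqP; rewrite -[_ == _]negbK -has_filter;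
  apply/hasPn.
congr (_ :: _); apply/esym/all_filterP/allP => j /nP //.
Qed.

Lemma good_tableau_cond T : good_tableau T <->
  (forall c, c \in T -> all alphabet c /\ sorted letter_lt c) /\
    (forall c, c \in T -> no_opposite c).
Proof.
split=> [h|[h h'] c cT]; last by case: (h c cT) => ha hs; split => //; exact: h'.
by split=> c /h[].
Qed.

Lemma all_filter_eq (P Q : pred 'I_n) w : (forall i, P i -> Q i) -> all Q (filter P w).
Proof. by move=> PQ; apply/allP => i; rewrite mem_filter => /andP[/PQ]. Qed.

End Shape.

Lemma blocks_young t n (a : 'I_n -> nat) (T : tableau t n) :
  blocks (coweight_word a) T <-> young_tableau a T.
Proof.
have pw := pairwise_word a.
have and3_iff (A A' B C : Prop) : (A <-> A') -> [/\ A', B & C] <-> [/\ A, B & C].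
  by move=> e; split=> -[h hB hC]; split=> //; exact/e.
apply: iff_trans (and3_iff _ _ _ _ (has_shapeE a T)); case: t T => T.
- rewrite blocks_ones; last by apply/allP.
  rewrite good_tableau_cond; split=> [[h1 [h2 _]]|[h1 h2 _]]; split=> //; split=> // c cT l lc.
  have [/allP h _] := h2 c cT; apply/negP => /h.
  by move: (h _ lc); rewrite /alphabet /= => /negPf ->.
- pose P : pred 'I_n := fun i => i.+1 != n.
  have sz : size (filter P (coweight_word a)) = (\sum_(i < n | i.+1 != n) a i)%N by rewrite
    size_filter count_word.
  have w2 : all (fun i => num_steps TB i == 2%N) (filter P (coweight_word a)).
    by apply: all_filter_eq => i; rewrite /P /num_steps => /negPf ->.
  have w1 : all (fun i => num_steps TB i == 1%N) (filter (predC P) (coweight_word a)).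
    by apply: all_filter_eq => i; rewrite /P /num_steps /= negbK => /eqP ->; rewrite eqxx.
  have e : coweight_word a = filter P (coweight_word a) ++ filter (predC P) (coweight_word a).
    by rewrite -filter_split // /ord_leq /P => i j ij; have := ltn_ord j; lia.
  have := blocks_twos T w2 w1; rewrite -e sz => ->.
  by split=> [[h1 /good_tableau_cond[h2 h3] h4]|[h1 h2 [h3 h4]]]; split=> //;
    apply/good_tableau_cond.
- pose P : pred 'I_n := fun i => i == 0 :> nat.
  have sz1 : size (filter P (coweight_word a)) = (\sum_(i < n | i == 0 :> nat) a i)%N by rewrite
    size_filter count_word.
  have sz2 : size (filter (predC P) (coweight_word a)) = (\sum_(i < n | i != 0 :> nat) a i)%N by
    rewrite size_filter count_word.
  have w1 : all (fun i => num_steps TC i == 1%N) (filter P (coweight_word a)).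
    by apply: all_filter_eq => i; rewrite /P /num_steps => /eqP ->.
  have w2 : all (fun i => num_steps TC i == 2%N) (filter (predC P) (coweight_word a)).
    by apply: all_filter_eq => i; rewrite /P /num_steps /= => /negPf ->.
  have e : coweight_word a = filter P (coweight_word a) ++ filter (predC P) (coweight_word a) ++
    [::].
    by rewrite cats0 -filter_split // /ord_leq /P => i j; lia.
  have := blocks_index T w1 w2 (erefl : all (fun i => num_steps TC i == 1%N) [::]).
  rewrite -e sz1 sz2 => ->.
  by split=> [[h1 /good_tableau_cond[h2 h3] h4]|[h1 h2 [h3 h4]]]; split=> //;
    apply/good_tableau_cond.
Qed.

Theorem proposition1 (R : realType) (t : cartan_type) (n : nat) (hn : (0 < n)%N)
    (a : 'I_n -> nat) :
  let galleries : set (gallery R t n) :=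
    galleries_of_type (gamma_lambda R t a) in
  let tableaux : set (tableau t n) := [set T | young_tableau a T]%classic in
  exists f : gallery R t n -> tableau t n,
    (forall g T, galleries g -> (tableau_of a g T <-> T = f g)) /\
    set_bij galleries tableaux f.
Proof.
move=> galleries tableaux.
pose f (g : gallery R t n) : tableau t n := xget [::] [set T | tableau_of a g T].
have fP g : galleries g -> tableau_of a g (f g).
  by move=> /(tableau_exists hn)[T hT]; exact: (@xgetPex _ [::] [set T | tableau_of a g T]
    (ex_intro _ T hT)).
exists f; split=> [g T hg|].
  by split=> [hT|->]; [exact: tableau_fun hT (fP g hg)|exact: fP].
split.
- by move=> g hg; apply/blocks_young; exact: tableau_blocks (fP g hg).
- move=> g g' /set_mem hg /set_mem hg' e.
  by apply: tableau_inj (fP g hg) _; rewrite e; exact: fP.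
- move=> T /blocks_young/(blocks_tableau (R := R))[g hg].
  have hG : galleries g by exact: (tableau_type hn hg).
  by exists g => //; exact: tableau_fun (fP g hG) hg.
Qed.
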